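(* Let $u_0 = \frac{1}{x+\mathrm{i}0} := \lim_{\varepsilon\to 0^+}\frac{1}{x+\mathrm{i}\varepsilon} = \mathrm{vp}\frac1x - \mathrm{i}\pi\delta(x)\in\mathcal{D}'(\mathbb{R})$. For every $c>0$, the distribution $u(x,t)=u_0(x)$ (constant in $t$) is a weak solution of the initial value problem $$\frac1{c^2}\,\partial_t^2 u-\partial_x^2 u+2u^3=0,\qquad u(x,0)=u_0(x),\quad \partial_t u(x,0)=0,$$ where the cubic term is understood in the sense of Hörmander's product.
   Context: Here $x\in\mathbb{R}$, $t\ge 0$. The limit defining $u_0$ is taken in $\mathcal{D}'(\mathbb{R})$; $\mathrm{vp}\frac1x=\partial_x\log|x|$ is the principal value distribution and $\delta$ the Dirac measure. The distribution $u(x,t)=u_0(x)$ is $u_0\otimes 1$; as a distribution-valued function of $t\ge 0$ it is the constant map $t\mapsto u_0$, and the initial conditions are understood in this sense. ''Weak solution'' means that the equation holds in the sense of distributions, all derivatives being distributional derivatives. Hörmander's product: the Fourier transform is $\mathcal{F}\varphi(\xi)=\int e^{-2\pi \mathrm{i}x\xi}\varphi(x)\,dx$. Two distributions $v,w$ satisfy Hörmander's wave front set criterion if for every $(y,\xi)$ with $\xi\ne 0$, $(y,\xi)\in \mathrm{WF}(v)$ implies $(y,-\xi)\notin \mathrm{WF}(w)$. In this case their product $v\cdot w$ is defined as follows: for every point $y$ there are a neighborhood $\Omega_y$ and a test function $\chi_y$ with $\chi_y\equiv1$ on $\Omega_y$ such that the $\mathcal{S}'$-convolution of $\mathcal{F}(\chi_y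 v)$ and $\mathcal{F}(\chi_y w)$ exists; near $y$ one sets $v\cdot w=\mathcal{F}^{-1}(\mathcal{F}(\chi_y v)*\mathcal{F}(\chi_y w))$, and globally one uses a partition of unity. The $\mathcal{S}'$-convolution of $S,T\in\mathcal{S}'(\mathbb{R}^n)$ exists if $(\varphi*\check S)T\in\mathcal{D}'_{L^1}(\mathbb{R}^n)$ for all $\varphi\in\mathcal{S}(\mathbb{R}^n)$, where $\check S(x)=S(-x)$, and then $\langle S*T,\varphi\rangle=\langle(\varphi*\check S)T,1\rangle$. The cube is $u^3=(u\cdot u)\cdot u$. *)

(* Defs.v *)
From HB Require Import structures.
From mathcomp Require Import all_boot all_order all_algebra.
From mathcomp Require Import complex.
From mathcomp Require Import all_classical all_reals all_analysis.
Set Implicit Arguments.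
Unset Strict Implicit.
Unset Printing Implicit Defensive.
Import Order.TTheory GRing.Theory Num.Theory.
Import numFieldNormedType.Exports.
Import ComplexField.Normc.
Local Open Scope classical_set_scope.
Local Open Scope ring_scope.
Local Open Scope complex_scope.

(** Distributions, wave front sets and Hörmander's product on open subsets of
    R^n, for complex-valued test functions.

    A distribution is represented by a function on all of R^n -> C, of which
    only the values on the relevant test functions are meaningful; linearity
    and continuity are the predicates [is_distribution], [is_tempered] and
    [is_integrable_distribution].  Accordingly, two functionals are the same
    element of D'(Omega) when they agree on [test_function Omega]. *)

Section Distributions.
Context {R : realType}.
Local Notation C := R[i].
Local Notation Re := (@complex.Re R).
Local Notation Im := (@complex.Im R).

Definition cfun (n : nat) := 'rV[R]_n -> C.
Definition functional (n : nat) := cfun n -> C.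

Definition integralC (D : set R) (f : R -> C) : C :=
  (\int[lebesgue_measure]_(x in D) Re (f x)) +i*
  (\int[lebesgue_measure]_(x in D) Im (f x)).

(* The Lebesgue integral over R^n, as an iterated integral; by Fubini's theorem
   the two agree on the integrable functions to which it is applied below. *)
Fixpoint integralRn (n : nat) : cfun n -> C :=
  match n with
  | 0 => fun f => f 0
  | n'.+1 => fun f : cfun (1 + n') =>
      integralC setT (fun x => integralRn (fun y => f (row_mx x%:M y)))
  end.

Definition partial n (i : 'I_n) (f : cfun n) : cfun n := fun x =>
  'D_(delta_mx 0 i) (fun y => Re (f y)) x +i*
  'D_(delta_mx 0 i) (fun y => Im (f y)) x.

(* [partials s f] is the iterated derivative of f along the indices in s, so a
   multi-index alpha is encoded by the sequences s of size |alpha|. *)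
Definition partials n (s : seq 'I_n) (f : cfun n) : cfun n :=
  foldr (@partial n) f s.

Definition smooth n (f : cfun n) : Prop := forall s : seq 'I_n,
  [/\ continuous (fun x => Re (partials s f x)),
      continuous (fun x => Im (partials s f x)) &
      forall (i : 'I_n) x,
        derivable (fun y => Re (partials s f y)) x (delta_mx 0 i) /\
        derivable (fun y => Im (partials s f y)) x (delta_mx 0 i)].

Definition supported_in n (K : set 'rV[R]_n) (f : cfun n) : Prop :=
  forall x, ~ K x -> f x = 0.

Definition test_function n (Omega : set 'rV[R]_n) (f : cfun n) : Prop :=
  smooth f /\ exists K, [/\ compact K, K `<=` Omega & supported_in K f].

(* The weighted C^m bound: w |d^alpha f| <= M everywhere for all |alpha| <= m *)
Definition Cm_bound n (m : nat) (w : 'rV[R]_n -> R) (M : R) (f : cfun n) :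
    Prop :=
  forall s : seq 'I_n, (size s <= m)%N ->
  forall x, w x * normc (partials s f x) <= M.

Definition schwartz n (f : cfun n) : Prop :=
  smooth f /\ forall m, exists M, Cm_bound m (fun x => (1 + `|x|) ^+ m) M f.

Definition linear_on n (P : cfun n -> Prop) (T : functional n) : Prop :=
  forall (a : C) f g, P f -> P g ->
    T (fun x => a * f x + g x) = a * T f + T g.

Definition is_distribution n (Omega : set 'rV[R]_n) (T : functional n) : Prop :=
  linear_on (test_function Omega) T /\
  forall K, compact K -> K `<=` Omega -> exists (m : nat) (A : R),
    forall f M, smooth f -> supported_in K f ->
      Cm_bound m (fun=> 1) M f -> normc (T f) <= A * M.

Definition is_tempered n (T : functional n) : Prop :=
  linear_on (@schwartz n) T /\
  exists (m : nat) (A : R), forall f M, schwartz f ->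
    Cm_bound m (fun x => (1 + `|x|) ^+ m) M f -> normc (T f) <= A * M.

(* The space D'_{L^1}(R^n), dual of the space of smooth functions all of whose
   derivatives vanish at infinity (topology of uniform convergence of all
   derivatives), in which the test functions are dense. *)
Definition is_integrable_distribution n (T : functional n) : Prop :=
  linear_on (test_function setT) T /\
  exists (m : nat) (A : R), forall f M, test_function setT f ->
    Cm_bound m (fun=> 1) M f -> normc (T f) <= A * M.

(* <T, 1> = l for T in D'_{L^1}, where 1 is not a test function: the extension
   of T to bounded smooth functions is computed by cutting off at infinity. *)
Definition pairing_one n (T : functional n) (l : C) : Prop :=
  forall chi : cfun n, test_function setT chi ->
    (\forall x \near (0 : 'rV[R]_n), chi x = 1) ->
    normc (T (fun x => chi (eps *: x)) - l) @[eps --> 0^'+] --> (0 : R).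

Definition cvg_distribution n (T : R -> functional n) (l : functional n) :
    Prop :=
  forall f, test_function setT f ->
    normc (T eps f - l f) @[eps --> 0^'+] --> (0 : R).

Definition regular n (g : cfun n) : functional n :=
  fun f => integralRn (fun x => g x * f x).

Definition dpartial n (i : 'I_n) (T : functional n) : functional n :=
  fun f => - T (partial i f).

Definition fmul n (g : cfun n) (T : functional n) : functional n :=
  fun f => T (fun x => g x * f x).

Definition reflection n (T : functional n) : functional n :=
  fun f => T (fun x => f (- x)).

Definition dirac0 n : functional n := fun f => f 0.

Definition tensor m n (S : functional m) (T : functional n) :
    functional (m + n) :=
  fun f => S (fun x => T (fun y => f (row_mx x y))).

Definition expi (theta : R) : C := cos theta +i* sin theta.

Definition dot n (x y : 'rV[R]_n) : R := \sum_(i < n) x 0 i * y 0 i.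

Definition fourier n (f : cfun n) : cfun n := fun xi =>
  integralRn (fun x => expi (- (2 * pi * dot x xi)) * f x).

Definition fourier_inv n (f : cfun n) : cfun n := fun x =>
  integralRn (fun xi => expi (2 * pi * dot x xi) * f xi).

Definition dfourier n (T : functional n) : functional n :=
  fun f => T (fourier f).

Definition dfourier_inv n (T : functional n) : functional n :=
  fun f => T (fourier_inv f).

(* For T of compact support, the tempered distribution [dfourier T] is this
   function. *)
Definition fourier_compact n (T : functional n) : cfun n :=
  fun xi => T (fun x => expi (- (2 * pi * dot x xi))).

(* (f * S)(x) = <S(y), f(x - y)> *)
Definition convolution_fun n (f : cfun n) (S : functional n) : cfun n :=
  fun x => S (fun y => f (x - y)).

Definition convolvable n (S T : functional n) : Prop :=
  [/\ is_tempered S, is_tempered T &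
      forall f, schwartz f ->
        is_integrable_distribution
          (fmul (convolution_fun f (reflection S)) T)].

Definition is_convolution n (S T W : functional n) : Prop :=
  convolvable S T /\
  forall f, schwartz f ->
    pairing_one (fmul (convolution_fun f (reflection S)) T) (W f).

Definition conic n (G : set 'rV[R]_n) : Prop :=
  forall (lambda : R) xi, 0 < lambda -> G xi -> G (lambda *: xi).

Definition rapidly_decreasing_on n (G : set 'rV[R]_n) (f : cfun n) : Prop :=
  forall N : nat, exists A : R,
    forall xi, G xi -> (1 + `|xi|) ^+ N * normc (f xi) <= A.

(* (y, xi) is outside the wave front set of v: for some cutoff chi at y, the
   Fourier transform of chi v decreases rapidly in a conic neighborhood of xi. *)
Definition microregular n (Omega : set 'rV[R]_n) (v : functional n)
    (y xi : 'rV[R]_n) : Prop :=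
  exists chi : cfun n, exists G : set 'rV[R]_n,
    [/\ test_function Omega chi, chi y != 0, open G, conic G & G xi] /\
    rapidly_decreasing_on G (fourier_compact (fmul chi v)).

Definition WF n (Omega : set 'rV[R]_n) (v : functional n) :
    set ('rV[R]_n * 'rV[R]_n) :=
  [set z | [/\ Omega z.1, z.2 != 0 & ~ microregular Omega v z.1 z.2]].

Definition hormander_criterion n (Omega : set 'rV[R]_n) (v w : functional n) :
    Prop :=
  forall y xi, xi != 0 -> WF Omega v (y, xi) -> ~ WF Omega w (y, - xi).

(* [p] is the product v . w in D'(Omega).  Its restrictions to the
   neighborhoods V_y are prescribed, which determines p by a partition of
   unity. *)
Definition is_hormander_product n (Omega : set 'rV[R]_n)
    (v w p : functional n) : Prop :=
  [/\ is_distribution Omega v, is_distribution Omega w,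
      hormander_criterion Omega v w, is_distribution Omega p &
      forall y, Omega y ->
        exists (V : set 'rV[R]_n) (chi : cfun n) (W : functional n),
        [/\ [/\ open V, V y & V `<=` Omega],
            test_function Omega chi /\ (forall x, V x -> chi x = 1),
            is_convolution (dfourier (fmul chi v)) (dfourier (fmul chi w)) W &
            forall f, test_function V f -> p f = dfourier_inv W f]].

(* Points of the plane are row vectors (x, t), of type 'rV_(1 + 1). *)
Definition ix : 'I_(1 + 1) := lshift 1 (@ord0 0).
Definition it : 'I_(1 + 1) := rshift 1 (@ord0 0).

Definition positive_times : set 'rV[R]_(1 + 1) := [set z | 0 < z 0 it].

(* c^-2 d_t^2 u - d_x^2 u + 2 u^3 = 0 in D'(Omega), with u^3 = (u . u) . u *)
Definition cubic_wave_equation (Omega : set 'rV[R]_(1 + 1)) (c : R)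
    (u : functional (1 + 1)) : Prop :=
  exists u2 u3 : functional (1 + 1),
    [/\ is_hormander_product Omega u u u2,
        is_hormander_product Omega u2 u u3 &
        forall f, test_function Omega f ->
          (c ^- 2)%:C * dpartial it (dpartial it u) f
          - dpartial ix (dpartial ix u) f + 2%:R * u3 f = 0].

(* [u] is a weak solution for t > 0, and is given by the D'(R)-valued function
   [U] of t >= 0, whose value and one-sided derivative at t = 0 are the
   initial data [v0] and [v1]. *)
Record weak_solution_ivp (c : R) (u : functional (1 + 1))
    (U : R -> functional 1) (v0 v1 : functional 1) : Prop := {
  ivp_equation : cubic_wave_equation positive_times c u;
  ivp_distribution : forall t, 0 <= t -> is_distribution setT (U t);
  ivp_slices : forall f, test_function positive_times f ->
    u f = integralC [set t | 0 < t]
            (fun t => U t (fun x => f (row_mx x t%:M)));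
  ivp_position : forall f, test_function setT f -> U 0 f = v0 f;
  ivp_velocity :
    cvg_distribution (fun h f => (h^-1)%:C * (U h f - U 0 f)) v1
}.

(* x in R is the row vector of size 1 with entry [x 0 0]. *)
Definition vp_inv : functional 1 :=
  dpartial 0 (regular (fun x : 'rV[R]_1 => (ln `|x 0 0|)%:C)).

Definition inv_x_plus_i0 : functional 1 :=
  fun f => vp_inv f - (0 +i* pi) * dirac0 f.

Definition inv_x_plus_ieps (eps : R) : cfun 1 :=
  fun x => (x 0 0 +i* eps)^-1.

End Distributions.

(* Main.v *)
(** The powers v_n = (x + i0)^(-n-1) (x) 1 satisfy v_n . v_0 = v_(n+1) for
    Hörmander's product; hence u^3 = (x + i0)^(-3) (x) 1 = (1/2) d_x^2 u, and the
    equation holds because u does not depend on t.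

    The Fourier transform of (x + i0)^(-n-1) is a multiple of the truncated power
    s_+^n. Localized by a cutoff a(x) b(t), the distribution v_n has the transform
    A_n[a] (x) F b, where A_n[a] = c_n s_+^n * F a has polynomial growth at +oo and
    decreases rapidly at -oo. This one-sidedness gives the wave front set criterion
    (for every xi, v_n is microregular at xi or v_0 is at -xi)
    and makes all the convolution integrals absolutely convergent. The beta
    integral s_+^n * s_+^0 = s_+^(n+1) / (n+1) becomes A_n[a] * A_0[a] = A_(n+1)[a^2],
    which is the product formula near each point. The formula for the transform
    comes from 1 / (x + i eps) = -2 i pi \int_0^oo exp(-2 pi eps s) exp(2 i pi s x) ds
    by letting eps tend to 0. *)

(* The obstacle is the growth of A_n[a] at +oo: the convolution of two such functions is not covered
   by any L^1 or Schwartz argument. What saves it is that the correlation of a Schwartz function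
   with A_n[a] is integrable at +oo and grows only at -oo, exactly where the other factor A_0[a]
   decreases rapidly. Quantitatively this rests on |x| + |y| <= |x + y| + 2 x^- + 2 y^-, where x^-
   is the negative part of x: if a sum and both negative parts are under control, then so are both
   terms.

   Fourier inversion, by which the product is recovered from its transform, is a by-product: 1/(x +
   i0) - 1/(x - i0) = -2 i pi delta, and the two terms on the left are, up to the factor -2 i pi,
   the integrals of the transform of phi over the two half-lines.

   The powers are defined by differentiation, (-1)^n / n! d^n (x + i0)^(-1), so that the relation
   between the cube and d_x^2 u holds by construction and the whole weight of the proof lies on the
   product formula. *)
Require Import Defs.
From mathcomp Require Import all_boot all_order all_algebra.
From mathcomp Require Import complex.
From mathcomp Require Import all_classical all_reals all_analysis.
From mathcomp Require Import measurable_realfun.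
From mathcomp Require Import ring lra.
Import Order.TTheory GRing.Theory Num.Theory.
Import numFieldNormedType.Exports.
Import ComplexField.Normc.
Set Implicit Arguments.
Unset Strict Implicit.
Unset Printing Implicit Defensive.
Local Open Scope classical_set_scope.
Local Open Scope ring_scope.
Local Open Scope complex_scope.

(** * Integrals of complex-valued functions *)

Section ComplexIntegral.
Context {R : realType}.
Local Notation C := R[i].
Local Notation Re := (@complex.Re R).
Local Notation Im := (@complex.Im R).
Local Notation leb := (@lebesgue_measure R).

Lemma ReD (x y : C) : Re (x + y) = Re x + Re y.
Proof. by case: x y => [a b] [c d]. Qed.
Lemma ImD (x y : C) : Im (x + y) = Im x + Im y.
Proof. by case: x y => [a b] [c d]. Qed.
Lemma ReN (x : C) : Re (- x) = - Re x.
Proof. by case: x. Qed.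
Lemma ImN (x : C) : Im (- x) = - Im x.
Proof. by case: x. Qed.
Lemma ReM (x y : C) : Re (x * y) = Re x * Re y - Im x * Im y.
Proof. by case: x y => [a b] [c d]. Qed.
Lemma ImM (x y : C) : Im (x * y) = Re x * Im y + Im x * Re y.
Proof. by case: x y => [a b] [c d]. Qed.
Lemma complexP (x y : C) : Re x = Re y -> Im x = Im y -> x = y.
Proof. by case: x y => [a b] [c d] /= -> ->. Qed.

Lemma normc_ge0 (z : C) : 0 <= normc z.
Proof. by case: z => a b; rewrite /normc sqrtr_ge0. Qed.

Lemma normc_re (z : C) : `|Re z| <= normc z.
Proof. by case: z => a b /=; rewrite -sqrtr_sqr ler_wsqrtr// lerDl sqr_ge0. Qed.

Lemma normc_im (z : C) : `|Im z| <= normc z.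
Proof. by case: z => a b /=; rewrite -sqrtr_sqr ler_wsqrtr// lerDr sqr_ge0. Qed.

Lemma normc_real (a : R) : normc a%:C = `|a|.
Proof. by rewrite /normc/= expr0n/= addr0 sqrtr_sqr. Qed.

Lemma normc_triangle (x y : C) : normc (x + y) <= normc x + normc y.
Proof. exact: le_normcD. Qed.

Lemma normc_opp (x : C) : normc (- x) = normc x.
Proof. by case: x => a b; rewrite /normc/= !sqrrN. Qed.

Lemma normc_reim (z : C) : normc z <= `|Re z| + `|Im z|.
Proof.
have {1}-> : z = (Re z)%:C + (0 +i* 1) * (Im z)%:C.
  by apply: complexP; rewrite ?ReD ?ImD ?ReM ?ImM/=; ring.
apply: (le_trans (normc_triangle _ _)).
rewrite normcM !normc_real.
have -> : normc (0 +i* 1 : C) = 1 by rewrite /normc expr0n expr1n add0r sqrtr1.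
by rewrite mul1r.
Qed.

Definition cm d (T : measurableType d) (f : T -> C) :=
  measurable_fun setT (fun x => Re (f x)) /\
  measurable_fun setT (fun x => Im (f x)).

Definition ri (f : R -> R) := leb.-integrable setT (EFin \o f).
Definition ci (f : R -> C) := ri (fun x => Re (f x)) /\ ri (fun x => Im (f x)).
Definition RInt (f : R -> R) : R := \int[leb]_(x in setT) f x.
Definition Int (f : R -> C) : C := integralC setT f.

Lemma IntE f : Int f = RInt (fun x => Re (f x)) +i* RInt (fun x => Im (f x)).
Proof. by []. Qed.

Lemma RIntE f : ri f -> (\int[leb]_x (f x)%:E = (RInt f)%:E)%E.
Proof. by move=> rf; rewrite /RInt /Rintegral fineK//; exact: integrable_fin_num. Qed.

Lemma ri_dom (f g : R -> R) : measurable_fun setT f -> ri g ->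
  (forall x, `|f x| <= g x) -> ri f.
Proof.
move=> mf ig fg; apply: (le_integrable _ _ _ ig) => //.
  exact/measurable_EFinP.
by move=> x _ /=; rewrite lee_fin (le_trans (fg x))// ler_norm.
Qed.

Lemma ci_dom f g : cm f -> ri g -> (forall x, normc (f x) <= g x) -> ci f.
Proof.
move=> [mr mi] ig fg; split; apply: ri_dom ig _ => // x.
  exact: le_trans (normc_re _) (fg x).
exact: le_trans (normc_im _) (fg x).
Qed.

Lemma riD f g : ri f -> ri g -> ri (fun x => f x + g x).
Proof. by move=> rf rg; apply: (integrableD _ rf rg). Qed.

Lemma riZ c f : ri f -> ri (fun x => c * f x).
Proof. by move=> rf; apply: (integrableZl _ c rf). Qed.

Lemma ri_norm f : ri f -> ri (fun x => `|f x|).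
Proof. by move=> rf; have := integrable_abse rf. Qed.

Lemma RIntD f g : ri f -> ri g -> RInt (fun x => f x + g x) = RInt f + RInt g.
Proof. by move=> rf rg; apply: RintegralD. Qed.

Lemma RIntZ c f : ri f -> RInt (fun x => c * f x) = c * RInt f.
Proof. by move=> rf; apply: RintegralZl. Qed.

Lemma RInt_norm f g : ri f -> ri g -> (forall x, `|f x| <= g x) ->
  `|RInt f| <= RInt g.
Proof.
move=> rf rg fg; apply: (le_trans (le_normr_Rintegral _ rf)) => //.
by apply: le_Rintegral => //; apply: ri_norm.
Qed.

Lemma ciD f g : ci f -> ci g -> ci (fun x => f x + g x).
Proof.
move=> [fr fi] [gr gi]; split.
  under eq_fun do rewrite ReD; exact: riD.
under eq_fun do rewrite ImD; exact: riD.
Qed.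

Lemma ciZ c f : ci f -> ci (fun x => c * f x).
Proof.
move=> [fr fi]; split.
  under eq_fun do rewrite ReM -mulNr; apply: riD; exact: riZ.
under eq_fun do rewrite ImM; apply: riD; exact: riZ.
Qed.

Lemma IntD f g : ci f -> ci g -> Int (fun x => f x + g x) = Int f + Int g.
Proof.
move=> [fr fi] [gr gi]; rewrite !IntE; apply: complexP => /=.
  by under eq_fun do rewrite ReD; rewrite RIntD.
by under eq_fun do rewrite ImD; rewrite RIntD.
Qed.

Lemma IntZ c f : ci f -> Int (fun x => c * f x) = c * Int f.
Proof.
move=> [fr fi]; rewrite !IntE; apply: complexP; rewrite ?ReM ?ImM/=.
  under eq_fun do rewrite ReM -mulNr.
  by rewrite RIntD ?RIntZ//; [rewrite mulNr|exact: riZ|exact: riZ].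
under eq_fun do rewrite ImM.
by rewrite RIntD ?RIntZ//; exact: riZ.
Qed.

Lemma IntZr c f : ci f -> Int (fun x => f x * c) = Int f * c.
Proof. by move=> cf; rewrite mulrC -IntZ//; under eq_fun do rewrite mulrC. Qed.

Lemma IntN f : ci f -> Int (fun x => - f x) = - Int f.
Proof.
move=> cf; rewrite -mulN1r -IntZ//.
by congr Int; apply/funext => x; rewrite mulN1r.
Qed.

(** The factor 2 is the price of estimating the real and imaginary parts separately. *)
Lemma Int_norm f g : ci f -> ri g -> (forall x, normc (f x) <= g x) ->
  normc (Int f) <= 2 * RInt g.
Proof.
move=> [fr fi] rg fg; apply: (le_trans (normc_reim _)).
rewrite mulr_natl mulr2n; apply: lerD; apply: RInt_norm => // x.
  exact: le_trans (normc_re _) (fg x).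
exact: le_trans (normc_im _) (fg x).
Qed.

(* Every integrability statement below is a domination by [wt], which is what
   Fubini's theorem and dominated convergence are applied with. *)
Definition wt (x : R) : R := (oneDsqr x)^-1.

Lemma wt_gt0 x : 0 < wt x.
Proof. by rewrite /wt invr_gt0 /oneDsqr ltr_wpDr ?sqr_ge0. Qed.
Lemma wt_ge0 x : 0 <= wt x. Proof. exact/ltW/wt_gt0. Qed.
Lemma wt_le1 x : wt x <= 1. Proof. exact: oneDsqrV_le1. Qed.
Lemma wtN x : wt (- x) = wt x. Proof. by rewrite /wt /oneDsqr sqrrN. Qed.
Hint Resolve wt_ge0 wt_gt0 : core.

Lemma measurable_wt : measurable_fun setT wt.
Proof. apply: continuous_measurable_fun; exact: continuous_oneDsqrV. Qed.

Lemma ri_wt : ri wt.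
Proof.
apply/integrableP; split; first by apply/measurable_EFinP; exact: measurable_wt.
under eq_integral do rewrite /= ger0_norm//.
rewrite ge0_symfun_integralT//; last first.
- by move=> x; rewrite /= wtN.
- exact: continuous_oneDsqrV.
by rewrite -set_itvcy integral0y_oneDsqr -EFinM ltry.
Qed.

(** Includes the factor 2 of [Int_norm], so that [K * cpi] bounds the integral of any function
    dominated by [K * wt]. *)
Definition cpi : R := 2 * RInt wt.

Lemma cpi_ge0 : 0 <= cpi.
Proof. by apply: mulr_ge0 => //; apply: Rintegral_ge0. Qed.

Lemma ci_wt K f : cm f -> (forall x, normc (f x) <= K * wt x) -> ci f.
Proof. by move=> mf; apply: ci_dom => //; apply: riZ; exact: ri_wt. Qed.

Lemma Int_wt K f : cm f -> (forall x, normc (f x) <= K * wt x) ->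
  normc (Int f) <= K * cpi.
Proof.
move=> mf fK; have rK : ri (fun x => K * wt x) by apply: riZ; exact: ri_wt.
apply: (le_trans (Int_norm (ci_wt mf fK) rK fK)).
by rewrite RIntZ; [rewrite /cpi mulrCA|exact: ri_wt].
Qed.

Lemma cmD d (T : measurableType d) (f g : T -> C) :
  cm f -> cm g -> cm (fun x => f x + g x).
Proof.
move=> [fr fi] [gr gi]; split.
  by under eq_fun do rewrite ReD; exact: measurable_funD.
by under eq_fun do rewrite ImD; exact: measurable_funD.
Qed.

Lemma cmM d (T : measurableType d) (f g : T -> C) :
  cm f -> cm g -> cm (fun x => f x * g x).
Proof.
move=> [fr fi] [gr gi]; split.
  under eq_fun do rewrite ReM.
  by apply: measurable_funB; exact: measurable_funM.
under eq_fun do rewrite ImM.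
by apply: measurable_funD; exact: measurable_funM.
Qed.

Lemma cmN d (T : measurableType d) (f : T -> C) : cm f -> cm (fun x => - f x).
Proof.
move=> [fr fi]; split.
  by under eq_fun do rewrite ReN; exact: measurable_funN.
by under eq_fun do rewrite ImN; exact: measurable_funN.
Qed.

Lemma cm_cst d (T : measurableType d) (c : C) : cm (fun _ : T => c).
Proof. by split; exact: measurable_cst. Qed.

Lemma cm_real d (T : measurableType d) (f : T -> R) :
  measurable_fun setT f -> cm (fun x => (f x)%:C).
Proof. by move=> mf; split => //=; exact: measurable_cst. Qed.

Lemma cm_comp d d' (S : measurableType d) (T : measurableType d') (g : S -> T)
  (f : T -> C) : measurable_fun setT g -> cm f -> cm (fun x => f (g x)).
Proof.
move=> mg [fr fi]; split.
  exact: (measurableT_comp fr mg).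
exact: (measurableT_comp fi mg).
Qed.

Lemma cm_cont (f : R -> C) : continuous (fun x => Re (f x)) ->
  continuous (fun x => Im (f x)) -> cm f.
Proof. by move=> cr cI; split; exact: continuous_measurable_fun. Qed.

Lemma cm_expi d (T : measurableType d) (f : T -> R) :
  measurable_fun setT f -> cm (fun x => expi (f x)).
Proof.
move=> mf; apply: cm_comp mf _; apply: cm_cont => /=.
  exact: continuous_cos.
exact: continuous_sin.
Qed.

(** Holds without integrability: by Tonelli the integrals of the positive and of the negative part
    are measurable in the extended reals, hence so is their difference, and [fine] preserves
    this. *)
Lemma cm_Int d (T : measurableType d) (F : T -> R -> C) :
  cm (fun z : T * R => F z.1 z.2) -> cm (fun x => Int (F x)).
Proof.
have key (G : T * R -> R) : measurable_fun setT G ->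
    measurable_fun setT (fun x => RInt (fun y => G (x, y))).
  move=> mG; rewrite /RInt /Rintegral.
  apply: measurableT_comp => //.
  have mE : measurable_fun setT (EFin \o G) by exact/measurable_EFinP.
  have mp : measurable_fun setT ((EFin \o G)^\+)%E by exact: measurable_funepos.
  have mn : measurable_fun setT ((EFin \o G)^\-)%E by exact: measurable_funeneg.
  have -> : (fun x => \int[leb]_y (G (x, y))%:E)%E =
     (fun x => fubini_F leb ((EFin \o G)^\+)%E x -
               fubini_F leb ((EFin \o G)^\-)%E x)%E.
    apply/funext => x; rewrite integralE /fubini_F; congr (_ - _)%E.
      by apply: eq_integral => y _; rewrite !funeposE.
    by apply: eq_integral => y _; rewrite !funenegE.
  apply: emeasurable_funB.
    exact: measurable_fun_fubini_tonelli_F.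
  exact: measurable_fun_fubini_tonelli_F.
move=> [Fr Fi]; split; rewrite /=.
  exact: (key (fun z => Re (F z.1 z.2)) Fr).
exact: (key (fun z => Im (F z.1 z.2)) Fi).
Qed.

Lemma RFubini (F : R -> R -> R) K :
  measurable_fun setT (fun z : R * R => F z.1 z.2) ->
  (forall x y, `|F x y| <= K * (wt x * wt y)) ->
  RInt (fun x => RInt (F x)) = RInt (fun y => RInt (fun x => F x y)).
Proof.
move=> mF FK.
have K0 : 0 <= K.
  have := FK 0 0; rewrite /wt /oneDsqr expr0n /= addr0 invr1 !mulr1.
  exact: le_trans.
pose f (z : R * R) := (F z.1 z.2)%:E.
have mf : measurable_fun setT f by exact/measurable_EFinP.
have msec1 x : measurable_fun setT (F x).
  exact: (measurableT_comp mF (pair1_measurable x)).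
have msec2 y : measurable_fun setT (F^~ y).
  exact: (measurableT_comp mF (pair2_measurable y)).
have fub : (leb \x leb)%E.-integrable setT f.
  apply/(integrable12ltyP leb leb mf).
  apply: (@le_lt_trans _ _ (\int[leb]_x (K * wt x * RInt wt)%:E)%E).
    apply: ge0_le_integral => //=.
    - by move=> x _; exact: integral_ge0.
    - apply: (@measurable_fun_fubini_tonelli_F _ _ _ _ _ leb
        (fun z : R * R => `|f z|%E)) => //=.
      apply/measurable_EFinP.
      exact: (measurableT_comp (@normr_measurable R setT) mF).
    - apply/measurable_EFinP; apply: measurable_funM => //.
      by apply: measurable_funM => //; exact: measurable_wt.
    move=> x _.
    apply: (@le_trans _ _ (\int[leb]_y (K * wt x * wt y)%:E)%E).
      apply: ge0_le_integral => //=.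
      - apply/measurable_EFinP.
        exact: (measurableT_comp (@normr_measurable R setT) (msec1 x)).
      - by apply/measurable_EFinP/measurable_funM => //; exact: measurable_wt.
      - by move=> y _; rewrite lee_fin -mulrA.
    under eq_integral do rewrite EFinM.
    rewrite integralZl//; last exact: ri_wt.
    by rewrite (RIntE ri_wt) -EFinM.
  have rw : ri (fun x => K * wt x * RInt wt).
    under eq_fun do rewrite mulrAC; apply: riZ; exact: ri_wt.
  by rewrite (RIntE rw) ltry.
have ER (G : R -> R -> R) :
  (forall x, ri (G x)) -> (fun x => \int[leb]_y (G x y)%:E)%E =
  (fun x => (RInt (G x))%:E).
  by move=> iG; apply/funext => x; rewrite RIntE.
have iF1 x : ri (F x).
  apply: (ri_dom (g := fun y => K * wt x * wt y)).
  - by [].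
  - by apply: riZ; exact: ri_wt.
  - by move=> y; rewrite -mulrA.
have iF2 y : ri (F^~ y).
  apply: (ri_dom (g := fun x => K * wt y * wt x)).
  - by [].
  - by apply: riZ; exact: ri_wt.
  - by move=> x; rewrite -mulrA [wt y * _]mulrC.
have := Fubini fub; rewrite /f/= (ER F iF1) (ER (fun y x => F x y) iF2).
by move=> E; rewrite /RInt /Rintegral E.
Qed.

Lemma Int_swap (F : R -> R -> C) K :
  cm (fun z : R * R => F z.1 z.2) ->
  (forall x y, normc (F x y) <= K * (wt x * wt y)) ->
  Int (fun x => Int (F x)) = Int (fun y => Int (fun x => F x y)).
Proof.
move=> [mr mi] FK; apply: complexP.
  apply: (RFubini (F := fun x y => Re (F x y)) (K := K)) => // x y.
  exact: le_trans (normc_re _) (FK x y).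
apply: (RFubini (F := fun x y => Im (F x y)) (K := K)) => // x y.
exact: le_trans (normc_im _) (FK x y).
Qed.

(** Sequential convergence is the form that dominated convergence takes; limits for eps -> 0+ are
    reduced to it by [cvg_at_rightP]. *)
Definition ccvg (u : nat -> C) (l : C) :=
  (fun n => Re (u n)) @ \oo --> Re l /\ (fun n => Im (u n)) @ \oo --> Im l.

Lemma Int_dct (F : nat -> R -> C) (f : R -> C) g : (forall n, cm (F n)) ->
  ri g -> (forall n x, normc (F n x) <= g x) ->
  (forall x, ccvg (F^~ x) (f x)) -> ccvg (fun n => Int (F n)) (Int f).
Proof.
have key (G : nat -> R -> R) (h : R -> R) :
  (forall n, measurable_fun setT (G n)) -> ri g ->
  (forall n x, `|G n x| <= g x) ->
  (forall x, G^~ x @ \oo --> h x) -> (fun n => RInt (G n)) @ \oo --> RInt h.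
  move=> mG ig Gg Gh; rewrite /RInt /Rintegral.
  have mh : measurable_fun setT h.
    by apply: (measurable_fun_cvg (h := G)) => // x _; exact: Gh.
  apply: fine_cvg; rewrite fineK; last first.
    apply: integrable_fin_num => //; apply: (ri_dom mh ig) => x.
    have : (fun n => `|G n x|) @ \oo --> `|h x| by apply: cvg_norm; exact: Gh.
    by move=> c; apply: (cvgr_to_le c); apply: nearW => n; exact: Gg.
  apply: (@dominated_cvg _ _ _ leb _ _ (fun n x => (G n x)%:E) _ (EFin \o g)) => //.
  - by move=> n; apply/measurable_EFinP; exact: mG.
  - by move=> x _; apply: cvg_EFin; [exact: nearW|exact: Gh].
  - by move=> n x _; rewrite lee_fin; exact: Gg.
move=> mF ig Fg Ff; split => /=.
  apply: (key (fun n x => Re (F n x)) (fun x => Re (f x))) => //.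
  - by move=> n; case: (mF n).
  - by move=> n x; exact: le_trans (normc_re _) (Fg n x).
  - by move=> x; case: (Ff x).
apply: (key (fun n x => Im (F n x)) (fun x => Im (f x))) => //.
- by move=> n; case: (mF n).
- by move=> n x; exact: le_trans (normc_im _) (Fg n x).
- by move=> x; case: (Ff x).
Qed.

Lemma ccvg_norm u l : ccvg u l <-> (fun n => normc (u n - l)) @ \oo --> 0.
Proof.
split => [[cr cI]|c0].
  apply: (@squeeze_cvgr _ _ _ _ (fun=> 0)
    (fun n => `|Re (u n) - Re l| + `|Im (u n) - Im l|)).
  - apply: nearW => n; rewrite normc_ge0/=.
    by rewrite (le_trans (normc_reim _))// ReD ReN ImD ImN.
  - exact: cvg_cst.
  - rewrite -[X in _ --> X]addr0; apply: cvgD.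
      rewrite -(@normr0 _ R); apply: cvg_norm.
      by rewrite -(subrr (Re l)); apply: cvgB => //; exact: cvg_cst.
    rewrite -(@normr0 _ R); apply: cvg_norm.
    by rewrite -(subrr (Im l)); apply: cvgB => //; exact: cvg_cst.
split; apply/subr_cvg0; apply: norm_cvg0.
  apply: (@squeeze_cvgr _ _ _ _ (fun=> 0) _ _ _ _ _ c0).
    apply: nearW => n; rewrite normr_ge0/=.
    by rewrite (le_trans _ (normc_re _))// ReD ReN.
  exact: cvg_cst.
apply: (@squeeze_cvgr _ _ _ _ (fun=> 0) _ _ _ _ _ c0).
  apply: nearW => n; rewrite normr_ge0/=.
  by rewrite (le_trans _ (normc_im _))// ImD ImN.
exact: cvg_cst.
Qed.

Lemma ccvg_unique u l l' : ccvg u l -> ccvg u l' -> l = l'.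
Proof.
move=> [a b] [c d]; apply: complexP.
  exact: (cvg_unique _ a c).
exact: (cvg_unique _ b d).
Qed.

End ComplexIntegral.
#[export] Hint Resolve wt_ge0 wt_gt0 : core.

(** * Invariance of the integral under translation and reflection *)

Section Invariance.
Context {R : realType}.
Local Notation C := R[i].
Local Notation leb := (@lebesgue_measure R).

Let mshift (c : R) : measurable_fun setT
  ((fun x => x + c) : measurableTypeR R -> measurableTypeR R).
Proof. exact: (measurable_funD (@measurable_id _ _ _) (measurable_cst c)). Qed.

Let mopp : measurable_fun setT
  ((fun x => - x) : measurableTypeR R -> measurableTypeR R).
Proof. exact: oppr_measurable. Qed.

Let leb_shift (c : R) (A : set R) : measurable A ->
  pushforward leb ((fun x => x + c) : measurableTypeR R -> measurableTypeR R) A = leb A.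
Proof.
move=> mA; apply/esym.
pose m := measure_function_pushforward__canonical__measure_function_Measure leb (mshift c).
apply: (@lebesgue_measure_unique _ m) => // X [[a b] _ <-] /=.
rewrite /pushforward.
have -> : (fun x => x + c) @^-1` `]a, b] = `]a - c, b - c]%classic.
  by apply/seteqP; split => x /=; rewrite !in_itv/= ltrBlDr lerBrDr.
rewrite !lebesgue_measure_itv/= !lte_fin ltrD2r.
by case: ifP => // _; rewrite -!EFinB; congr EFin; ring.
Qed.

(** Change of variables for a map that preserves Lebesgue measure. Treating the positive and
    negative parts separately keeps it free of integrability conditions. *)
Let RInt_pf (phi : measurableTypeR R -> measurableTypeR R) :
  measurable_fun setT phi ->
  (forall A, measurable A -> pushforward leb phi A = leb A) ->
  forall f : R -> R, measurable_fun setT f -> RInt (fun x => f (phi x)) = RInt f.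
Proof.
move=> mphi phiE f mf; rewrite /RInt /Rintegral; congr fine.
have mE : measurable_fun setT (EFin \o f) by exact/measurable_EFinP.
have key (g : R -> \bar R) : measurable_fun setT g -> (forall x, 0 <= g x)%E ->
  (\int[leb]_x g (phi x) = \int[leb]_x g x)%E.
  move=> mg g0.
  rewrite -[LHS](@ge0_integral_pushforward _ _ _ _ _ phi mphi leb setT g) //=.
  by apply: eq_measure_integral => A mA _; exact: phiE.
rewrite integralE [RHS]integralE; congr (_ - _)%E.
  rewrite -(key ((EFin \o f)^\+)%E); [|exact: measurable_funepos|by []].
  by apply: eq_integral => x _; rewrite !funeposE.
rewrite -(key ((EFin \o f)^\-)%E); [|exact: measurable_funeneg|by []].
by apply: eq_integral => x _; rewrite !funenegE.
Qed.

Lemma RInt_shift c (f : R -> R) : measurable_fun setT f -> RInt (fun x => f (x + c)) = RInt f.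
Proof. exact: RInt_pf (mshift c) (@leb_shift c) f. Qed.

Lemma RInt_opp (f : R -> R) : measurable_fun setT f -> RInt (fun x => f (- x)) = RInt f.
Proof. exact: RInt_pf mopp (@lebesgue_measureN R) f. Qed.

Lemma Int_shift c (f : R -> C) : cm f -> Int (fun x => f (x + c)) = Int f.
Proof.
move=> [mr mi]; rewrite !IntE.
by rewrite (RInt_shift c mr) (RInt_shift c mi).
Qed.

Lemma Int_opp (f : R -> C) : cm f -> Int (fun x => f (- x)) = Int f.
Proof.
move=> [mr mi]; rewrite !IntE.
by rewrite (RInt_opp mr) (RInt_opp mi).
Qed.

End Invariance.

(** * Complex-valued derivatives, differentiation under the integral and the fundamental theorem *)

Section Derivative.
Context {R : realType}.
Local Notation C := R[i].
Local Notation Re := (@complex.Re R).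
Local Notation Im := (@complex.Im R).
Local Notation leb := (@lebesgue_measure R).
Implicit Types (f g : R -> C) (x : R) (l : C).

Definition isdC f x l :=
  is_derive x 1 (fun y => Re (f y)) (Re l) /\
  is_derive x 1 (fun y => Im (f y)) (Im l).

Lemma isdC_eq f x l l' : isdC f x l -> l = l' -> isdC f x l'.
Proof. by move=> ? <-. Qed.

Lemma isdC_unique f x l l' : isdC f x l -> isdC f x l' -> l = l'.
Proof.
by move=> [a b] [c d]; apply: complexP;
  [rewrite -(@derive_val _ _ _ _ _ _ _ a) -(@derive_val _ _ _ _ _ _ _ c)
  |rewrite -(@derive_val _ _ _ _ _ _ _ b) -(@derive_val _ _ _ _ _ _ _ d)].
Qed.

Lemma isdC_cst c x : isdC (fun=> c) x 0.
Proof. by split; exact: is_derive_cst. Qed.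

Lemma isdC_real (f : R -> R) x (l : R) : is_derive x 1 f l ->
  isdC (fun y => (f y)%:C) x l%:C.
Proof. by move=> df; split => //=; exact: is_derive_cst. Qed.

Lemma isdCD f g x l m : isdC f x l -> isdC g x m ->
  isdC (fun y => f y + g y) x (l + m).
Proof.
move=> [a b] [c d]; split.
  rewrite ReD; under eq_fun do rewrite ReD; exact: is_deriveD.
rewrite ImD; under eq_fun do rewrite ImD; exact: is_deriveD.
Qed.

Lemma isdCM f g x l m : isdC f x l -> isdC g x m ->
  isdC (fun y => f y * g y) x (l * g x + f x * m).
Proof.
move=> [a b] [c d]; split.
  under eq_fun do rewrite ReM.
  apply: (is_derive_eq (is_deriveB (is_deriveM a c) (is_deriveM b d))).
  by rewrite /GRing.scale/= ReD !ReM; ring.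
under eq_fun do rewrite ImM.
apply: (is_derive_eq (is_deriveD (is_deriveM a d) (is_deriveM b c))).
by rewrite /GRing.scale/= ImD !ImM; ring.
Qed.

Lemma isdCZ c f x l : isdC f x l -> isdC (fun y => c * f y) x (c * l).
Proof.
move=> df; apply: (isdC_eq (isdCM (isdC_cst c x) df)).
by rewrite mul0r add0r.
Qed.

Lemma isdC_expi c x :
  isdC (fun y => expi (c * y)) x ((0 +i* c) * expi (c * x)).
Proof.
have dc : is_derive x 1 (fun y => c * y) c.
  by apply: is_derive_eq; rewrite /GRing.scale/= mulr1.
split; rewrite /expi /=.
  apply: (is_derive_eq (is_derive1_comp (is_derive_cos (c * x)) dc)).
  by rewrite /GRing.scale/=; ring.
apply: (is_derive_eq (is_derive1_comp (is_derive_sin (c * x)) dc)).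
by rewrite /GRing.scale/=; ring.
Qed.

Lemma isdC_cont f g : (forall x, isdC f x (g x)) ->
  continuous (fun x => Re (f x)) /\ continuous (fun x => Im (f x)).
Proof.
move=> df; split => x; apply: differentiable_continuous; apply/derivable1_diffP.
  by case: (df x) => [[]].
by case: (df x) => _ [].
Qed.

Lemma isdC_cm f g : (forall x, isdC f x (g x)) -> cm f.
Proof. by move=> /isdC_cont [cr cI]; exact: cm_cont. Qed.

Lemma Int_isdC (F G : R -> R -> C) (h : R -> R) x : ri h ->
  (forall x, cm (F x)) ->
  (forall x y, isdC (F^~ y) x (G x y)) ->
  (forall x y, normc (F x y) <= h y) -> (forall x y, normc (G x y) <= h y) ->
  isdC (fun x => Int (F x)) x (Int (G x)).
Proof.
move=> rh mF dF Fh Gh.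
have h0 y : 0 <= h y by apply: le_trans (Fh x y); exact: normc_ge0.
have key (f g : R -> R -> R) : (forall x, measurable_fun setT (f x)) ->
   (forall x y, is_derive x 1 (f^~ y) (g x y)) ->
   (forall x y, `|f x y| <= h y) -> (forall x y, `|g x y| <= h y) ->
   is_derive x 1 (fun x => RInt (f x)) (RInt (g x)).
  move=> mf df fh gh.
  (* The domination by [h] is global, so any bounded interval around [x] would do. *)
  have Ix : `]x - 1, x + 1[%classic x.
    by rewrite /= in_itv/= ltrBlDr ltrDl ltr01.
  have rf z : ri (f z) by apply: (ri_dom (mf z) rh).
  have dE z y : derive1 (f^~ y) z = g z y.
    by rewrite derive1E; apply: derive_val.
  have D1 := @derivable_under_integral _ _ _ leb f setT measurableT x (x - 1)
     (x + 1) Ix (fun z _ => rf z) (fun z y _ _ => @ex_derive _ _ _ _ _ _ _ (df z y)) h h0 rh.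
  have D2 := @differentiation_under_integral _ _ _ leb f setT measurableT x
     (x - 1) (x + 1) Ix (fun z _ => rf z)
     (fun z y _ _ => @ex_derive _ _ _ _ _ _ _ (df z y)) h h0 rh.
  have hb z y : `]x - 1, x + 1[%classic z -> setT y -> `|partial1of2 f z y| <= h y.
    by move=> _ _; rewrite /partial1of2 dE.
  apply: DeriveDef; first exact: D1 hb.
  rewrite -derive1E (D2 hb); congr (Rintegral _ _ _).
  by apply/funext => y; rewrite /partial1of2 dE.
split.
  apply: (key (fun x y => Re (F x y)) (fun x y => Re (G x y))).
  - by move=> z; case: (mF z).
  - by move=> z y; case: (dF z y).
  - by move=> z y; exact: le_trans (normc_re _) (Fh z y).
  - by move=> z y; exact: le_trans (normc_re _) (Gh z y).
apply: (key (fun x y => Im (F x y)) (fun x y => Im (G x y))).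
- by move=> z; case: (mF z).
- by move=> z y; case: (dF z y).
- by move=> z y; exact: le_trans (normc_im _) (Fh z y).
- by move=> z y; exact: le_trans (normc_im _) (Gh z y).
Qed.

Lemma RInt_supp (f : R -> R) (a b : R) : (forall x, ~ (a <= x <= b) -> f x = 0) ->
  RInt f = \int[leb]_(x in `[a, b]) f x.
Proof.
move=> f0; rewrite [RHS]Rintegral_mkcond; congr (Rintegral _ _ _).
apply/funext => x; rewrite patchE; case: ifPn => //.
by move=> /negP; rewrite inE/= in_itv/= => /f0.
Qed.

Lemma RInt_deriv_itv (f g : R -> R) (a b : R) : a < b ->
  (forall x, is_derive x 1 f (g x)) -> continuous g ->
  \int[leb]_(x in `[a, b]) g x = f b - f a.
Proof.
move=> ab df cg; rewrite /Rintegral (@continuous_FTC2 _ g f a b ab) //.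
- exact: continuous_subspaceT.
- have cf : continuous f.
    move=> x; apply: differentiable_continuous; apply/derivable1_diffP.
    exact: ex_derive.
  split.
  + by move=> x _; exact: ex_derive.
  + by apply: cvg_at_right_filter; exact: cf.
  + by apply: cvg_at_left_filter; exact: cf.
- by move=> x _; rewrite derive1E; exact: derive_val.
Qed.

Lemma Int_deriv0 f g (r : R) : (forall x, isdC f x (g x)) ->
  continuous (fun x => Re (g x)) -> continuous (fun x => Im (g x)) ->
  (forall x, r < `|x| -> f x = 0) -> (forall x, r < `|x| -> g x = 0) ->
  Int g = 0.
Proof.
(* [r] may be negative; [s] is positive and larger than [r], so [f] vanishes at both ends of [-s, s]
   and [g] outside it. *)
move=> df cr cI f0 g0; pose s := `|r| + 1.
have rs : r < s by rewrite (le_lt_trans (ler_norm _))// /s ltrDl.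
have s0 : 0 < s by rewrite /s ltr_wpDl.
have out x : ~ (- s <= x <= s) -> r < `|x|.
  by rewrite -ler_norml => /negP; rewrite -ltNge; exact: lt_trans.
have fs : f s = 0 by apply: f0; rewrite gtr0_norm.
have fsN : f (- s) = 0 by apply: f0; rewrite normrN gtr0_norm.
rewrite IntE; apply: complexP => /=.
  rewrite (@RInt_supp _ (- s) s); last by move=> x /out/g0 ->.
  have ns : - s < s by rewrite gtrN.
rewrite (RInt_deriv_itv ns (fun x => (df x).1))//.
  by rewrite fs fsN subrr.
rewrite (@RInt_supp _ (- s) s); last by move=> x /out/g0 ->.
have ns : - s < s by rewrite gtrN.
rewrite (RInt_deriv_itv ns (fun x => (df x).2))//.
by rewrite fs fsN subrr.
Qed.

End Derivative.

(** * Test functions on the line and their Fourier transforms *)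

Section TestFunctions.
Context {R : realType}.
Local Notation C := R[i].
Local Notation Re := (@complex.Re R).
Local Notation Im := (@complex.Im R).
Implicit Types (f g : R -> C) (x : R) (l : C).

(** [sm n] is the class C^n. Quantifying over the derivative makes closure under sums, products and
    parameter integrals a direct induction; [smS] recovers the canonical derivative [dC]. *)
Fixpoint sm (n : nat) f : Prop :=
  match n with
  | 0 => continuous (fun x => Re (f x)) /\ continuous (fun x => Im (f x))
  | n'.+1 => exists2 g, (forall x, isdC f x (g x)) & sm n' g
  end.

Definition dC f : R -> C := fun x =>
  derive1 (fun y => Re (f y)) x +i* derive1 (fun y => Im (f y)) x.

Lemma isdC_dC f x l : isdC f x l -> dC f x = l.
Proof.
by move=> [a b]; apply: complexP; rewrite /= derive1E; apply: derive_val.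
Qed.

Lemma isdC_funE f g : (forall x, isdC f x (g x)) -> dC f = g.
Proof. by move=> df; apply/funext => x; exact: isdC_dC. Qed.

Lemma smS n f : sm n.+1 f -> (forall x, isdC f x (dC f x)) /\ sm n (dC f).
Proof. by move=> /= [g dg sg]; rewrite (isdC_funE dg). Qed.

Lemma sm_cont n f : sm n f ->
  continuous (fun x => Re (f x)) /\ continuous (fun x => Im (f x)).
Proof. by case: n => [//|n] /= [g /isdC_cont]. Qed.

Lemma sm_cm n f : sm n f -> cm f.
Proof. by move=> /sm_cont [a b]; exact: cm_cont. Qed.

Lemma sm_pred n f : sm n.+1 f -> sm n f.
Proof.
elim: n f => [|n IH] f; first by move/sm_cont.
by move=> [g dg sg]; exists g => //; exact: IH.
Qed.

Lemma smD n f g : sm n f -> sm n g -> sm n (fun x => f x + g x).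
Proof.
elim: n f g => [|n IH] f g.
  move=> [a b] [c d]; split => x.
    by under eq_fun do rewrite ReD; apply: cvgD; [exact: a|exact: c].
  by under eq_fun do rewrite ImD; apply: cvgD; [exact: b|exact: d].
move=> [f' df sf] [g' dg sg]; exists (fun x => f' x + g' x); last exact: IH.
by move=> x; exact: isdCD.
Qed.

Lemma smM n f g : sm n f -> sm n g -> sm n (fun x => f x * g x).
Proof.
elim: n f g => [|n IH] f g.
  move=> [a b] [c d]; split => x.
    under eq_fun do rewrite ReM.
    by apply: cvgB; apply: cvgM; [exact: a|exact: c|exact: b|exact: d].
  under eq_fun do rewrite ImM.
  by apply: cvgD; apply: cvgM; [exact: a|exact: d|exact: b|exact: c].
move=> sf sg; have sf' := sm_pred sf; have sg' := sm_pred sg.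
case: sf => f' df sf; case: sg => g' dg sg.
exists (fun x => f' x * g x + f x * g' x); first by move=> x; exact: isdCM.
by apply: smD; exact: IH.
Qed.

Lemma sm_cst n (c : C) : sm n (fun=> c).
Proof.
elim: n c => [|n IH] c /=; first by split; move=> x; exact: cvg_cst.
by exists (fun=> 0) => // x; exact: isdC_cst.
Qed.

Lemma sm_expi n (c : R) : sm n (fun y => expi (c * y)).
Proof.
have key (d : C) : sm n (fun y => d * expi (c * y)).
  elim: n d => [|n IH] d.
    apply: (@sm_cont 1).
    by exists (fun y => d * ((0 +i* c) * expi (c * y))) => // [x|];
      [apply: isdCZ; exact: isdC_expi|
       apply: (@isdC_cont _ _ (fun y => d * ((0 +i* c) * ((0 +i* c) * expi (c * y))))) => x;
       do 2!apply: isdCZ; exact: isdC_expi].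
  exists (fun y => d * ((0 +i* c) * expi (c * y))).
    by move=> x; apply: isdCZ; exact: isdC_expi.
  by under eq_fun do rewrite mulrA; exact: IH.
by have := key 1; under eq_fun do rewrite mul1r.
Qed.

Lemma isdC_near f g x l : (\forall y \near x, f y = g y) ->
  isdC f x l -> isdC g x l.
Proof.
move=> fg [a b]; split.
  apply: (near_eq_is_derive (f := fun y => Re (f y))) => //.
  by near=> y; congr Re; near: y.
apply: (near_eq_is_derive (f := fun y => Im (f y))) => //.
by near=> y; congr Im; near: y.
Unshelve. all: by end_near. Qed.

Definition vanish (r : R) f := forall x, r < `|x| -> f x = 0.

Lemma vanish_dC r f : vanish r f -> vanish r (dC f).
Proof.
move=> fr x rx; apply: isdC_dC; apply: (isdC_near _ (isdC_cst 0 x)).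
near=> y; apply/esym/fr; near: y.
apply: (cvgr_gt `|x|) => //; apply: cvg_norm; exact: cvg_id.
Unshelve. all: by end_near. Qed.

Definition test1 f := (forall n, sm n f) /\ exists r, vanish r f.

Lemma test1_isdC f x : test1 f -> isdC f x (dC f x).
Proof. by move=> [sf _]; case: (smS (sf 1%N)) => + _; apply. Qed.

Lemma test1_dC f : test1 f -> test1 (dC f).
Proof.
move=> [sf [r fr]]; split; last by exists r; exact: vanish_dC.
by move=> n; case: (smS (sf n.+1)).
Qed.

Lemma test1D f g : test1 f -> test1 g -> test1 (fun x => f x + g x).
Proof.
move=> [sf [r fr]] [sg [s gs]]; split; first by move=> n; exact: smD.
exists (Num.max r s) => x; rewrite gt_max => /andP[rx sx].
by rewrite fr// gs// addr0.
Qed.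

Lemma test1M f g : test1 f -> (forall n, sm n g) -> test1 (fun x => f x * g x).
Proof.
move=> [sf [r fr]] sg; split; first by move=> n; exact: smM.
by exists r => x rx; rewrite fr// mul0r.
Qed.

Lemma test1Z c f : test1 f -> test1 (fun x => c * f x).
Proof.
move=> [sf [r fr]]; split; first by move=> n; apply: smM => //; exact: sm_cst.
by exists r => x rx; rewrite fr// mulr0.
Qed.

Lemma dCM f g : test1 f -> (forall n, sm n g) ->
  dC (fun x => f x * g x) = (fun x => dC f x * g x + f x * dC g x).
Proof.
move=> tf sg; apply: isdC_funE => x; apply: isdCM; first exact: test1_isdC.
by case: (smS (sg 1%N)) => + _; apply.
Qed.

Lemma test1_cm f : test1 f -> cm f.
Proof. by move=> [sf _]; exact: sm_cm (sf 0%N). Qed.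

Definition odom (K : R) f := forall x, normc (f x) <= K * wt x.

(** On |x| <= r the weight [wt x] is at least 1 / [oneDsqr r]. *)
Lemma vanish_odom r M f : vanish r f -> (forall x, normc (f x) <= M) ->
  odom (M * oneDsqr r) f.
Proof.
move=> fr fM x; have M0 : 0 <= M by apply: le_trans (fM 0); exact: normc_ge0.
have [rx|xr] := ltP r `|x|.
  rewrite fr// normc0; apply: mulr_ge0; last exact: wt_ge0.
  by apply: mulr_ge0 => //; apply: le_trans ler01 _; exact: oneDsqr_ge1.
apply: (le_trans (fM x)); rewrite -mulrA ler_peMr//.
rewrite /wt ler_pdivlMr; last by rewrite /oneDsqr ltr_wpDr// sqr_ge0.
by rewrite mul1r /oneDsqr lerD2l -[x ^+ 2]real_normK ?num_real// lerXn2r// ?nnegrE// (le_trans _ xr).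
Qed.

Lemma vanish_bounded r f : sm 0 f -> vanish r f ->
  exists M, forall x, normc (f x) <= M.
Proof.
move=> [cr cI] fr.
have bd (h : R -> R) : continuous h -> exists2 M, 0 <= M &
   forall x, `|x| <= r -> `|h x| <= M.
  move=> ch; have [r0|r0] := ltP r 0.
    by exists 0 => // x xr; have := le_lt_trans xr r0; rewrite ltNge normr_ge0.
  have : {within `[- r, r], continuous (fun x => `|h x|)}.
    by apply: continuous_subspaceT => x; apply: cvg_norm; exact: ch.
  move=> /(EVT_max _) []; first by rewrite lerNl (le_trans _ r0)// oppr_le0.
  move=> c _ hc; exists `|h c| => // x xr; apply: hc.
  by rewrite in_itv/= -ler_norml.
have [M1 M10 H1] := bd _ cr; have [M2 M20 H2] := bd _ cI.
exists (M1 + M2) => x; have [rx|xr] := ltP r `|x|.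
  by rewrite fr// normc0 addr_ge0.
by apply: (le_trans (normc_reim _)); apply: lerD; [exact: H1|exact: H2].
Qed.

Lemma vanish_ci r f : sm 0 f -> vanish r f -> ci f.
Proof.
move=> sf fr; have [M fM] := vanish_bounded sf fr.
apply: (@ci_wt _ (M * oneDsqr r)); first exact: sm_cm sf.
exact: vanish_odom.
Qed.

Lemma test1_bounded f : test1 f -> exists M, forall x, normc (f x) <= M.
Proof. by move=> [sf [r fr]]; exact: vanish_bounded (sf 0%N) fr. Qed.

Lemma test1_odom f : test1 f -> exists K, odom K f.
Proof.
move=> tf; have [M fM] := test1_bounded tf; have [r fr] := tf.2.
by exists (M * oneDsqr r); exact: vanish_odom.
Qed.

Lemma odom_ge0 K f : odom K f -> 0 <= K.
Proof.
move=> /(_ 0); rewrite /wt /oneDsqr expr0n /= addr0 invr1 mulr1.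
by apply: le_trans; exact: normc_ge0.
Qed.

Lemma test1_ci f : test1 f -> ci f.
Proof. by move=> tf; have [K] := test1_odom tf; apply: ci_wt; exact: test1_cm. Qed.

(** This is -2 i pi. It is both the factor that differentiation of the character [ee] brings down
    and the constant in front of the half-line integral for 1/(x + i eps). *)
Definition kap : C := 0 +i* (- (2 * pi)).

Definition ee (x y : R) : C := expi (- (2 * pi * (x * y))).

Lemma normc_expi (t : R) : normc (expi t) = 1.
Proof. by rewrite /expi /normc cos2Dsin2 sqrtr1. Qed.

Lemma normc_ee x y : normc (ee x y) = 1. Proof. exact: normc_expi. Qed.

Lemma expiD (s t : R) : expi (s + t) = expi s * expi t :> C.
Proof.
by apply: complexP; rewrite ?ReM ?ImM /= ?cosD ?sinD//; ring.
Qed.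

Lemma expi0 : expi 0 = 1 :> C.
Proof. by rewrite /expi cos0 sin0. Qed.

Lemma eeC x y : ee x y = ee y x. Proof. by rewrite /ee (mulrC x). Qed.
Lemma eeDl x y z : ee (x + y) z = ee x z * ee y z.
Proof. by rewrite /ee -expiD; congr expi; ring. Qed.
Lemma eeDr x y z : ee z (x + y) = ee z x * ee z y.
Proof. by rewrite /ee -expiD; congr expi; ring. Qed.
Lemma ee0 x : ee 0 x = 1. Proof. by rewrite /ee mul0r mulr0 oppr0 expi0. Qed.

Lemma eeE x : ee x = fun y => expi (- (2 * pi) * x * y).
Proof. by apply/funext => y; rewrite /ee; congr expi; ring. Qed.

Lemma sm_ee n x : sm n (ee x).
Proof. rewrite eeE; exact: sm_expi. Qed.

Lemma isdC_ee x y : isdC (ee x) y (kap * x%:C * ee x y).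
Proof.
rewrite eeE; apply: (isdC_eq (isdC_expi _ _)).
by congr (_ * _); apply: complexP; rewrite ?ReM ?ImM/=; ring.
Qed.

Lemma cm_ee : cm (fun z : R * R => ee z.1 z.2).
Proof.
apply: cm_expi; apply: measurable_funN; apply: measurable_funM => //.
by apply: measurable_funM; [exact: measurable_fst|exact: measurable_snd].
Qed.

Lemma cm_ee1 x : cm (ee x). Proof. exact: sm_cm (sm_ee 0 x). Qed.

Definition hat f (xi : R) : C := Int (fun x => ee xi x * f x).

Lemma ci_ee xi f : ci f -> cm f -> ci (fun x => ee xi x * f x).
Proof.
move=> [a b] mf; apply: (ci_dom (g := fun x => `|Re (f x)| + `|Im (f x)|)).
- by apply: cmM => //; exact: cm_ee1.
- by apply: riD; exact: ri_norm.
- by move=> x; rewrite normcM normc_ee mul1r normc_reim.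
Qed.

Lemma cm_hat f : cm f -> cm (hat f).
Proof.
move=> mf; apply: cm_Int; apply: cmM; first exact: cm_ee.
exact: (cm_comp (g := snd) measurable_snd mf).
Qed.

Lemma hat_bound K f xi : cm f -> odom K f -> normc (hat f xi) <= K * cpi.
Proof.
move=> mf fK; apply: Int_wt; first by apply: cmM => //; exact: cm_ee1.
by move=> x; rewrite normcM normc_ee mul1r; exact: fK.
Qed.

(** Integration by parts: the derivative of [f * ee xi] has compact support, so it integrates to
    0. *)
Lemma hat_dC f xi : test1 f -> hat (dC f) xi = - (kap * xi%:C) * hat f xi.
Proof.
move=> tf; have tg := test1M tf (fun n => sm_ee n xi).
have tdg := test1_dC tg.
have [r0 gr] := tg.2.
have : Int (dC (fun x => f x * ee xi x)) = 0.
  have [a b] := sm_cont (tdg.1 0%N).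
  apply: (@Int_deriv0 _ (fun x => f x * ee xi x) _ r0) => //.
    by move=> x; exact: test1_isdC.
  exact: vanish_dC.
rewrite dCM//; last by move=> n; exact: sm_ee.
have -> : dC (ee xi) = (fun y => kap * xi%:C * ee xi y).
  by apply: isdC_funE => x; exact: isdC_ee.
rewrite IntD; last 2 first.
- by apply: test1_ci; apply: test1M; [exact: test1_dC|move=> n; exact: sm_ee].
- apply: test1_ci; apply: test1M => // n; apply: smM; first exact: sm_cst.
  exact: sm_ee.
move=> /eqP; rewrite addr_eq0 => /eqP E.
rewrite mulNr /hat -IntZ; last by apply: ci_ee; [exact: test1_ci|exact: test1_cm].
under eq_fun do rewrite mulrC.
rewrite E; congr (- _); congr Int; apply/funext => x; ring.
Qed.

Lemma hat_iter n f xi : test1 f ->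
  hat (iter n dC f) xi = (- (kap * xi%:C)) ^+ n * hat f xi.
Proof.
move=> tf; have ti m : test1 (iter m dC f) by elim: m => //= m /test1_dC.
elim: n => [|n IH]; first by rewrite expr0 mul1r.
by rewrite /= hat_dC// IH exprS mulrA.
Qed.

Lemma normc_kap : normc kap = 2 * pi.
Proof. by rewrite /kap /normc expr0n add0r sqrrN sqrtr_sqr ger0_norm// mulr_ge0// pi_ge0. Qed.

Lemma normcX (z : C) n : normc (z ^+ n) = normc z ^+ n.
Proof. by elim: n => [|n IH]; rewrite ?expr0 ?normc1// !exprS normcM IH. Qed.

(** For |xi| <= 1 the weight is at most 2^N. Otherwise it is at most (2 |xi|)^N, and the power
    |xi|^N is absorbed by N integrations by parts. *)
Lemma hat_decay N K f xi : test1 f -> odom K f -> odom K (iter N dC f) ->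
  normc (hat f xi) * (1 + `|xi|) ^+ N <= 2 ^+ N.+1 * K * cpi.
Proof.
move=> tf fK fNK; have ti m : test1 (iter m dC f) by elim: m => //= m /test1_dC.
have K0 := odom_ge0 fK.
have H0 := hat_bound xi (test1_cm tf) fK.
have H1 := hat_bound xi (test1_cm (ti N)) fNK.
have H2 : normc (hat f xi) * `|xi| ^+ N <= K * cpi.
  apply: le_trans H1; rewrite hat_iter// normcM mulrC ler_wpM2r ?normc_ge0//.
  rewrite normcX normc_opp normcM normc_kap normc_real.
  apply: lerXn2r; rewrite ?nnegrE ?mulr_ge0 ?pi_ge0//.
  rewrite ler_peMl//; have := pi_ge2 R; lra.
have h0 := normc_ge0 (hat f xi).
have [x1|x1] := leP `|xi| 1.
  apply: (@le_trans _ _ (K * cpi * 2 ^+ N)).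
    apply: ler_pM => //.
    by apply: lerXn2r; rewrite ?nnegrE ?addr_ge0// -[2]/(1 + 1) lerD2l.
 have : 0 <= 2 ^+ N * (K * cpi) by rewrite mulr_ge0 ?exprn_ge0// mulr_ge0// cpi_ge0.
  rewrite exprS; lra.
apply: (@le_trans _ _ (normc (hat f xi) * (2 * `|xi|) ^+ N)).
  apply: ler_wpM2l => //; apply: lerXn2r; rewrite ?nnegrE ?addr_ge0//; lra.
rewrite exprMn mulrCA; apply: (@le_trans _ _ (2 ^+ N * (K * cpi))).
  by rewrite ler_wpM2l// exprn_ge0.
have : 0 <= 2 ^+ N * (K * cpi) by rewrite mulr_ge0 ?exprn_ge0// mulr_ge0// cpi_ge0.
rewrite exprS; lra.
Qed.

End TestFunctions.

(** * The distribution 1/(x + i0) *)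

Section LogIntegrable.
Context {R : realType}.
Local Notation leb := (@lebesgue_measure R).

Lemma ri_opp (f : R -> R) : ri f -> ri (fun x => f (- x)).
Proof.
move=> /integrableP[/measurable_EFinP mf fi]; apply/integrableP; split.
  by apply/measurable_EFinP; exact: (measurableT_comp mf (@oppr_measurable R setT)).
rewrite (le_lt_trans _ fi)//.
have mphi : measurable_fun setT (-%R : measurableTypeR R -> measurableTypeR R).
  exact: oppr_measurable.
have := @ge0_integral_pushforward _ _ (measurableTypeR R) (measurableTypeR R) R _ mphi leb setT
   (fun x : R => `|(EFin \o f) x|%E).
move=> /(_ measurableT _ (fun x _ => abse_ge0 _)) <-.
  by rewrite le_eqVlt; apply/orP; left; apply/eqP; apply: eq_measure_integral => A mA _; exact: lebesgue_measureN.
by apply: measurableT_comp => //; exact/measurable_EFinP.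
Qed.

(** Isolates the singularity of the logarithm at 0 as a nonnegative integrable function; by
    [ln_bound] the rest of log |x| is bounded by |x|. *)
Definition lnm (x : R) : R := if (0 < x <= 1) then - ln x else 0.

Lemma lnm_ge0 x : 0 <= lnm x.
Proof. by rewrite /lnm; case: ifP => // /andP[_ x1]; rewrite oppr_ge0 ln_le0. Qed.

Let F (n : nat) : set R := `[n.+1%:R^-1, 1]%classic.

(** With the antiderivative x - x ln x the integral over [a, 1] is 1 - (a - a ln a), hence at most 1
    uniformly in a; monotone convergence then gives integrability on ]0, 1]. *)
Let intF n : (\int[leb]_(x in F n) (lnm x)%:E <= 1)%E.
Proof.
case: n => [|n].
  by rewrite /F invr1 set_itv1 integral_set1.
have a0 : 0 < n.+2%:R^-1 :> R by rewrite invr_gt0.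
have a1 : n.+2%:R^-1 < 1 :> R by rewrite invf_lt1// ltr1n.
have xa0 (x : R) : n.+2%:R^-1 <= x -> 0 < x by move=> ?; exact: lt_le_trans a0 _.
rewrite /F.
have -> : (\int[leb]_(x in `[(n.+2%:R^-1)%R, 1%R]) (lnm x)%:E =
   \int[leb]_(x in `[(n.+2%:R^-1)%R, 1%R]) (- ln x)%:E)%E.
  apply: eq_integral => x.
  by rewrite inE/= in_itv/= => /andP[/xa0 x0 x1]; rewrite /lnm x0 x1.
have D (x : R) : 0 < x -> is_derive x 1 (fun x => x - x * ln x) (- ln x).
  move=> x0; have D := is_derive1_ln x0.
  apply: is_derive_eq; rewrite /GRing.scale/= mulr1 mulfV ?gt_eqF//; ring.
have Dc (x : R) : 0 < x -> {for x, continuous (fun x : R => x - x * ln x)}.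
  move=> x0; apply: differentiable_continuous; apply/derivable1_diffP.
  by have := D x x0 => ?; exact: ex_derive.
rewrite (@continuous_FTC2 _ (fun x => - ln x) (fun x => x - x * ln x)) //.
- rewrite ln1 mulr0 subr0 -EFinB lee_fin lerBlDr lerDl subr_ge0.
  apply: (le_trans _ (ltW a0)).
  by rewrite pmulr_rle0// ln_le0// ltW.
- apply: derivable_within_continuous => x /[!in_itv]/= /andP[/xa0 x0 _].
  apply: derivableN; have := is_derive1_ln x0 => D'; exact: ex_derive.
- split.
  + by move=> x /[!in_itv]/= /andP[/ltW/xa0 /D ? _]; exact: ex_derive.
  + by apply: cvg_at_right_filter; apply: Dc.
  + by apply: cvg_at_left_filter; apply: Dc.
- move=> x /[!in_itv]/= /andP[/ltW/xa0 /D ? _].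
  by rewrite derive1E; apply: derive_val.
Qed.

Lemma measurable_lnm : measurable_fun setT lnm.
Proof.
apply: measurable_fun_ifT => //.
  apply: (@measurable_and _ _ setT (fun t : R => 0 < t) (fun t => t <= 1)).
    exact: (@measurable_fun_ltr _ _ _ setT (cst 0) id).
  exact: (@measurable_fun_ler _ _ _ setT id (cst 1)).
by apply: measurable_funN; exact: measurable_ln.
Qed.

Lemma ri_lnm : ri lnm.
Proof.
apply/integrableP; split; first by apply/measurable_EFinP; exact: measurable_lnm.
have -> : (\int[leb]_x `|(EFin \o lnm) x| = \int[leb]_(x in \bigcup_n F n) (lnm x)%:E)%E.
  rewrite [RHS]integral_mkcond; apply: eq_integral => x _.
  rewrite patchE; case: ifPn => /=; first by rewrite ger0_norm ?lnm_ge0.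
  move=> /negP nF; rewrite /lnm; case: ifPn => [/andP[x0 x1]|]; last by rewrite normr0.
  exfalso; apply: nF; rewrite inE.
  exists (Num.truncn x^-1) => //; rewrite /F /= in_itv/= x1 andbT.
  rewrite invf_ple ?posrE//.
  by apply/ltW/truncnS_gt.
apply: (@le_lt_trans _ _ 1%E); last by rewrite ltry.
have cv : (\int[leb]_(x in F n) (lnm x)%:E @[n --> \oo] --> \int[leb]_(x in \bigcup_n F n) (lnm x)%:E)%E.
  apply: (@ge0_nondecreasing_set_cvg_integral _ (measurableTypeR R) R F (EFin \o lnm) leb).
  - apply/nondecreasing_seqP => n; apply/subsetPset => x.
    rewrite /F/= !in_itv/= => /andP[nx ->]; rewrite andbT (le_trans _ nx)//.
    by rewrite lef_pV2 ?posrE// ler_nat.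
  - by move=> n; exact: measurable_itv.
  - by move=> n; apply/measurable_EFinP; exact: measurable_funTS measurable_lnm.
  - by move=> n x _; rewrite lee_fin lnm_ge0.
rewrite -(cvg_lim _ cv)//; apply: lime_le; first by apply/cvg_ex; eexists; exact: cv.
by apply: nearW; exact: intF.
Qed.

Lemma ln_bound (x : R) : `|ln `|x| | <= lnm x + lnm (- x) + `|x|.
Proof.
have [->|x0] := eqVneq x 0.
  by rewrite normr0 ln0// normr0 !addr_ge0// lnm_ge0.
have ax0 : 0 < `|x| by rewrite normr_gt0.
have ge : lnm `|x| <= lnm x + lnm (- x).
  have [x1|x1] := leP 0 x; first by rewrite ger0_norm// lerDl lnm_ge0.
  by rewrite ltr0_norm// lerDr lnm_ge0.
have [x1|x1] := leP `|x| 1.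
  rewrite ler0_norm ?ln_le0//; apply: ler_wpDr => //.
  by apply: le_trans ge; rewrite /lnm ax0 x1.
rewrite ger0_norm ?ln_ge0 ?(ltW x1)//.
by rewrite (le_trans (ltW (ln_sublinear ax0)))// lerDr addr_ge0// lnm_ge0.
Qed.

End LogIntegrable.

(** * The Heaviside function and integration of derivatives over the half-line *)

Section Resolvent.
Context {R : realType}.
Local Notation C := R[i].
Local Notation Re := (@complex.Re R).
Local Notation Im := (@complex.Im R).
Local Notation leb := (@lebesgue_measure R).

Definition hv (x : R) : R := if 0 <= x then 1 else 0.

Lemma measurable_hv : measurable_fun setT hv.
Proof.
apply: measurable_fun_ifT; [|exact: measurable_cst|exact: measurable_cst].
exact: (@measurable_fun_ler _ _ _ setT (cst 0) id).
Qed.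

Lemma hv_ge0 x : 0 <= hv x. Proof. by rewrite /hv; case: ifP. Qed.
Lemma hv_le1 x : hv x <= 1. Proof. by rewrite /hv; case: ifP. Qed.

Lemma hv_neg (x : R) : x < 0 -> (hv x)%:C = 0 :> C.
Proof. by move=> x0; rewrite /hv leNgt x0. Qed.
Lemma hv_pos (x : R) : 0 <= x -> (hv x)%:C = 1 :> C.
Proof. by move=> x0; rewrite /hv x0. Qed.

(** The antiderivatives of 1/(x + i eps) converge pointwise, and are bounded uniformly in eps, only
    for x <> 0. Dominated convergence is therefore applied to the functions reset to 0 at the
    origin, which does not change their integrals. *)
Definition off0 (f : R -> C) (x : R) : C := if x == 0 then 0 else f x.

Lemma cm_off0 (f : R -> C) : cm f -> cm (off0 f).
Proof.
have me : measurable_fun setT (fun x : R => x == 0).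
  exact: (@measurable_fun_eqr _ _ _ setT id (cst 0)).
move=> [fr fi]; split.
  rewrite (_ : (fun x => _) = fun x => if x == 0 then 0 else Re (f x)).
    by apply: measurable_fun_ifT => //; exact: measurable_cst.
  by apply/funext => x; rewrite /off0; case: ifP.
rewrite (_ : (fun x => _) = fun x => if x == 0 then 0 else Im (f x)).
  by apply: measurable_fun_ifT => //; exact: measurable_cst.
by apply/funext => x; rewrite /off0; case: ifP.
Qed.

Lemma Int_off0 (f : R -> C) : cm f -> ci f -> Int (off0 f) = Int f.
Proof.
have key (h : R -> R) : measurable_fun setT h -> ri h ->
    RInt (fun x => if x == 0 then 0 else h x) = RInt h.
  move=> mh rh; rewrite /RInt /Rintegral; congr fine.
  rewrite [RHS](@negligible_integral _ _ _ leb setT [set 0] (EFin \o h))//; last first.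
    exact: lebesgue_measure_set1.
  rewrite [RHS]integral_mkcond; apply: eq_integral => x _; rewrite patchE.
  rewrite in_setD in_setT /=; have [->|x0] := eqVneq x 0.
    by rewrite ifF//; apply/negbTE; rewrite negbK inE.
  by rewrite ifT// notin_setE => /eqP; rewrite (negbTE x0).
move=> [mr mi] [fr fi]; apply: complexP.
  apply: etrans (key _ mr fr); congr RInt; apply/funext => x.
  by rewrite /off0; case: ifP.
apply: etrans (key _ mi fi); congr RInt; apply/funext => x.
by rewrite /off0; case: ifP.
Qed.

Lemma ccvg_cst (c : C) : ccvg (fun=> c) c.
Proof. by split; exact: cvg_cst. Qed.

Lemma ccvg_near u (l : C) : (\forall n \near \oo, u n = l) -> ccvg u l.
Proof.
move=> ul; split; apply: cvg_near_cst.
  by apply: filterS ul => n ->.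
by apply: filterS ul => n ->.
Qed.

Lemma ccvgD u v (l m : C) : ccvg u l -> ccvg v m ->
  ccvg (fun n => u n + v n) (l + m).
Proof.
move=> [a b] [c d]; split.
  by rewrite ReD; under eq_fun do rewrite ReD; apply: cvgD.
by rewrite ImD; under eq_fun do rewrite ImD; apply: cvgD.
Qed.

Lemma ccvgM u v (l m : C) : ccvg u l -> ccvg v m ->
  ccvg (fun n => u n * v n) (l * m).
Proof.
move=> [a b] [c d]; split.
  by rewrite ReM; under eq_fun do rewrite ReM; apply: cvgB; apply: cvgM.
by rewrite ImM; under eq_fun do rewrite ImM; apply: cvgD; apply: cvgM.
Qed.

Lemma ccvgN u (l : C) : ccvg u l -> ccvg (fun n => - u n) (- l).
Proof.
move=> [a b]; split.
  by rewrite ReN; under eq_fun do rewrite ReN; apply: cvgN.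
by rewrite ImN; under eq_fun do rewrite ImN; apply: cvgN.
Qed.

(** On [0, n+1] the fundamental theorem gives f(n+1) - f(0). The domination by [h] lets the
    truncated integrals converge to the integral over the half-line. *)
Lemma Int_half (f g : R -> C) (h : R -> R) : (forall x, isdC f x (g x)) ->
  continuous (fun x => Re (g x)) -> continuous (fun x => Im (g x)) ->
  ri h -> (forall x, normc ((hv x)%:C * g x) <= h x) ->
  ccvg (fun n => f n.+1%:R) 0 ->
  Int (fun x => (hv x)%:C * g x) = - f 0.
Proof.
move=> df cr cI rh gh f0.
pose F n x : C := if `|x| <= n.+1%:R then (hv x)%:C * g x else 0.
have mg : cm (fun x => (hv x)%:C * g x).
  by apply: cmM; [apply: cm_real; exact: measurable_hv|exact: cm_cont].
have FE n : Int (F n) = f n.+1%:R - f 0.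
  have n0 : (0 : R) < n.+1%:R by rewrite ltr0n.
  rewrite IntE; apply: complexP => /=; rewrite ?ReD ?ReN ?ImD ?ImN.
    rewrite -(RInt_deriv_itv n0 (fun x => (df x).1) cr).
    rewrite (@RInt_supp _ _ 0 n.+1%:R).
      apply: eq_Rintegral => x; rewrite inE/= in_itv/= => /andP[x0 xn].
      by rewrite /F ger0_norm// xn hv_pos// mul1r.
    move=> x /negP; rewrite /F; case: (leP 0 x) => [x0|x0] /=; last first.
      by rewrite hv_neg// mul0r if_same.
    by rewrite ger0_norm// => /negbTE ->.
  rewrite -(RInt_deriv_itv n0 (fun x => (df x).2) cI).
  rewrite (@RInt_supp _ _ 0 n.+1%:R).
    apply: eq_Rintegral => x; rewrite inE/= in_itv/= => /andP[x0 xn].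
    by rewrite /F ger0_norm// xn hv_pos// mul1r.
  move=> x /negP; rewrite /F; case: (leP 0 x) => [x0|x0] /=; last first.
    by rewrite hv_neg// mul0r if_same.
  by rewrite ger0_norm// => /negbTE ->.
have : ccvg (fun n => Int (F n)) (Int (fun x => (hv x)%:C * g x)).
  apply: (Int_dct _ rh).
  - move=> n.
    have mle : measurable_fun setT (fun t : R => `|t| <= n.+1%:R).
      apply: (@measurable_fun_ler _ _ _ setT (@Num.norm _ R) (cst n.+1%:R)) => //.
    split.
      rewrite (_ : (fun x => _) = fun x => if `|x| <= n.+1%:R then Re ((hv x)%:C * g x) else 0).
        apply: measurable_fun_ifT; [|by case: mg|exact: measurable_cst].
        exact: mle.
      by apply/funext => x; rewrite /F; case: ifP.
    rewrite (_ : (fun x => _) = fun x => if `|x| <= n.+1%:R then Im ((hv x)%:C * g x) else 0).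
      apply: measurable_fun_ifT; [|by case: mg|exact: measurable_cst].
      exact: mle.
    by apply/funext => x; rewrite /F; case: ifP.
  - move=> n x; rewrite /F; case: ifP => // _; rewrite normc0.
    by apply: le_trans (gh x); exact: normc_ge0.
  - move=> x; have near_eq : \forall n \near \oo, F n x = (hv x)%:C * g x.
      near=> n; rewrite /F ifT//.
      apply: (@le_trans _ _ n%:R); last by rewrite ler_nat.
      by near: n; exact: nbhs_infty_ger.
    exact: ccvg_near.
under eq_fun do rewrite FE.
move=> /ccvg_unique; apply.
rewrite -[X in ccvg _ X]add0r; apply: ccvgD => //; exact: ccvg_cst.
Unshelve. all: by end_near. Qed.

End Resolvent.

(** * Convergence of 1/(x + i eps) to 1/(x + i0) *)

Section EpsLimit.
Context {R : realType}.
Local Notation C := R[i].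
Local Notation Re := (@complex.Re R).
Local Notation Im := (@complex.Im R).
Local Notation leb := (@lebesgue_measure R).
Implicit Types (phi : R -> C) (e x : R).

Definition U0 phi : C :=
  - Int (fun x => (ln `|x|)%:C * dC phi x) - (0 +i* pi) * phi 0.

(** For e > 0 this is log(x + i e) - i pi / 2 with the principal logarithm. The argument is written
    with the arctangent of x / e, which is smooth across x = 0; in the limit it becomes a step of
    height -pi, the origin of the Dirac term. *)
Definition Leps e x : C := (2^-1 * ln (x ^+ 2 + e ^+ 2)) +i* (- atan (x / e)).
Definition Llim x : C := ln `|x| +i* (- (pi / 2) * (2 * hv x - 1)).

Lemma sqe_gt0 e x : 0 < e -> 0 < x ^+ 2 + e ^+ 2.
Proof. by move=> e0; rewrite ltr_wpDl ?sqr_ge0// exprn_gt0. Qed.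

Lemma isdC_Leps e x : 0 < e -> isdC (Leps e) x ((x +i* e)^-1).
Proof.
move=> e0; have q0 := sqe_gt0 x e0; split => /=.
  have dq : is_derive x 1 (fun x => x ^+ 2 + e ^+ 2) (2 * x).
    by apply: is_derive_eq; rewrite /GRing.scale/=; ring.
  have dl := is_derive1_ln q0.
  have dc := @is_derive1_comp _ (@ln R) (fun x => x ^+ 2 + e ^+ 2) x _ _ dl dq.
  apply: (is_derive_eq (is_deriveZ 2^-1 dc)).
  by rewrite /GRing.scale/=; field; rewrite gt_eqF.
have dq : is_derive x 1 (fun x => x / e) e^-1.
  by apply: is_derive_eq; rewrite /GRing.scale/=; ring.
have dc := @is_derive1_comp _ (@atan R) (fun x => x / e) x _ _ (is_derive1_atan (x / e)) dq.
apply: (is_derive_eq (is_deriveN dc)); rewrite /GRing.scale/=.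
by field; rewrite !gt_eqF//= addrC.
Qed.

Lemma cont_Keps e : 0 < e ->
  continuous (fun x => Re ((x +i* e)^-1)) /\ continuous (fun x => Im ((x +i* e)^-1)).
Proof.
move=> e0; have cq : continuous (fun x : R => x ^+ 2 + e ^+ 2).
  by move=> x; apply: cvgD; [exact: exprn_continuous|exact: cvg_cst].
have cqV : continuous (fun x : R => (x ^+ 2 + e ^+ 2)^-1).
  by move=> x; apply: cvgV; [rewrite gt_eqF// sqe_gt0|exact: cq].
split => x /=.
  by apply: cvgM; [exact: cvg_id|exact: cqV].
by apply: cvgN; apply: cvgM; [exact: cvg_cst|exact: cqV].
Qed.

Lemma Int_Keps e phi : 0 < e -> test1 phi ->
  Int (fun x => (x +i* e)^-1 * phi x) = - Int (fun x => dC phi x * Leps e x).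
Proof.
move=> e0 tphi; have [kr ki] := cont_Keps e0.
have [lr li] := isdC_cont (fun x => isdC_Leps x e0).
have s1 : sm 0 (fun x => (x +i* e)^-1) by split.
have s2 : sm 0 (Leps e) by split.
have s3 : sm 0 (fun x => dC phi x * Leps e x) by apply: smM => //; exact: (test1_dC tphi).1.
have s4 : sm 0 (fun x => phi x * (x +i* e)^-1) by apply: smM => //; exact: tphi.1.
have [r pr] := tphi.2.
have v3 : vanish r (fun x => dC phi x * Leps e x).
  by move=> x rx; rewrite (vanish_dC pr rx) mul0r.
have v4 : vanish r (fun x => phi x * (x +i* e)^-1).
  by move=> x rx; rewrite (pr _ rx) mul0r.
have [cr cI] := smD s3 s4.
have : Int (fun x => dC phi x * Leps e x + phi x * (x +i* e)^-1) = 0.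
  apply: (@Int_deriv0 _ (fun x => phi x * Leps e x) _ r) => //.
  - by move=> x; apply: isdCM; [exact: test1_isdC|exact: isdC_Leps].
  - by move=> x rx; rewrite (pr _ rx) mul0r.
  - by move=> x rx; rewrite (pr _ rx) (vanish_dC pr rx) !mul0r addr0.
rewrite IntD; [|exact: vanish_ci s3 v3|exact: vanish_ci s4 v4].
move=> /eqP; rewrite addrC addr_eq0 => /eqP <-.
by congr Int; apply/funext => x; rewrite mulrC.
Qed.

Lemma Leps_cvg (u : nat -> R) x : (forall n, 0 < u n) -> u @ \oo --> 0 ->
  x != 0 -> ccvg (fun n => Leps (u n) x) (Llim x).
Proof.
move=> u0 uc x0; split => /=.
  have -> : ln `|x| = 2^-1 * ln (x ^+ 2 + 0 ^+ 2).
    rewrite expr0n addr0 -real_normK ?num_real// lnXn ?normr_gt0//.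
    by rewrite mulr2n; field.
  apply: cvgM; first exact: cvg_cst.
  have Q : (fun n => x ^+ 2 + u n ^+ 2) @ \oo --> x ^+ 2 + 0 ^+ 2.
    apply: cvgD; first exact: cvg_cst.
    exact: (continuous_cvg _ (@exprn_continuous R 2 0) uc).
  apply: (continuous_cvg _ _ Q).
  apply: continuous_ln; rewrite expr0n addr0.
  by rewrite lt_def sqr_ge0 sqrf_eq0 x0.
have key (y : R) : 0 < y -> (fun n => atan (y / u n)) @ \oo --> pi / 2.
  move=> y0.
  suff Q : y / u n @[n --> \oo] --> +oo%R.
    by have H := cvg_comp _ _ Q (@cvgy_atan R); exact: H.
  apply/cvgryPge => A; near=> n.
  have : u n <= y / (`|A| + 1).
    near: n; apply: (cvgr_le 0) => //; rewrite divr_gt0// ltr_wpDl//.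
  rewrite ler_pdivlMr ?ltr_wpDl// => h.
  rewrite ler_pdivlMr//; apply: le_trans h; rewrite mulrC.
  by rewrite ler_wpM2l ?(ltW (u0 n))// (le_trans (ler_norm _))// lerDl.
have [xp|xn] := leP 0 x.
  rewrite /hv xp mulr1 (_ : - (pi / 2) * (2 - 1) = - (pi / 2)); last by ring.
  by apply: cvgN; apply: key; rewrite lt_def x0.
rewrite /hv leNgt xn /= mulr0 (_ : - (pi / 2) * (0 - 1) = pi / 2); last by ring.
under eq_fun do rewrite -atanN -mulNr.
by apply: key; rewrite oppr_gt0.
Unshelve. all: by end_near. Qed.

(** Uniform in 0 < e <= B: the real part is at least ln |x|, and at most x^2 + B^2 because ln y <=
    y. The terms in [lnm] are the only singular ones, and they are integrable. *)
Lemma Leps_bound e B x : 0 < e <= B -> x != 0 ->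
  normc (Leps e x) <= (lnm x + lnm (- x)) + (`|x| + (x ^+ 2 + B ^+ 2) + pi / 2).
Proof.
move=> /andP[e0 eB] x0; apply: (le_trans (normc_reim _)) => /=.
have ax0 : 0 < `|x| by rewrite normr_gt0.
have at2 : `|- atan (x / e)| <= pi / 2.
  by rewrite normrN ler_norml (ltW (atan_gtNpi2 _)) (ltW (atan_ltpi2 _)).
have q0 := sqe_gt0 x e0.
have h1 : ln `|x| <= 2^-1 * ln (x ^+ 2 + e ^+ 2).
  have : ln (`|x| ^+ 2) <= ln (x ^+ 2 + e ^+ 2).
    rewrite ler_ln ?posrE ?exprn_gt0// real_normK ?num_real//.
    by rewrite lerDl sqr_ge0.
  rewrite lnXn// -mulr_natl; lra.
have h2 : 2^-1 * ln (x ^+ 2 + e ^+ 2) <= x ^+ 2 + B ^+ 2.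
  have := ltW (ln_sublinear q0).
  have : e ^+ 2 <= B ^+ 2 by rewrite lerXn2r// nnegrE ltW// (lt_le_trans e0).
  nra.
have := ln_bound x; rewrite ler_norml => /andP[h3 h4].
have : `|2^-1 * ln (x ^+ 2 + e ^+ 2)| <=
   (lnm x + lnm (- x)) + `|x| + (x ^+ 2 + B ^+ 2).
  have := lnm_ge0 x; have := lnm_ge0 (- x); have := normr_ge0 x.
  have := sqr_ge0 x; have := sqr_ge0 B.
  rewrite ler_norml => *; apply/andP; split; lra.
by move=> h5; have := lerD h5 at2; rewrite -!addrA.
Qed.

Lemma cm_Leps e : 0 < e -> cm (Leps e).
Proof. by move=> e0; apply: isdC_cm => x; exact: isdC_Leps. Qed.

Lemma cm_Llim : cm Llim.
Proof.
split => /=.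
  exact: (measurableT_comp (@measurable_ln R) (@normr_measurable R setT)).
apply: measurable_funM; first exact: measurable_cst.
apply: measurable_funB; last exact: measurable_cst.
by apply: measurable_funM; [exact: measurable_cst|exact: measurable_hv].
Qed.

Lemma ln_phi phi : test1 phi -> forall B, exists2 h : R -> R, ri h &
  forall x, ((lnm x + lnm (- x)) + (`|x| + (x ^+ 2 + B ^+ 2) + pi / 2)) * normc (phi x) <= h x.
Proof.
move=> tphi B; have [M pM] := test1_bounded tphi; have [r pr] := tphi.2.
have M0 : 0 <= M by apply: le_trans (pM 0); exact: normc_ge0.
pose c := `|r| + (r ^+ 2 + B ^+ 2) + pi / 2.
have c0 : 0 <= c by rewrite /c !addr_ge0 ?sqr_ge0// divr_ge0// pi_ge0.
exists (fun x => M * (lnm x + lnm (- x)) + c * (M * oneDsqr r) * wt x).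
  apply: riD.
    by apply: riZ; apply: riD; [exact: ri_lnm|apply: ri_opp; exact: ri_lnm].
  by apply: riZ; exact: ri_wt.
move=> x; have ph := vanish_odom pr pM x.
rewrite mulrDl; apply: lerD.
  by rewrite mulrC ler_wpM2r// addr_ge0// lnm_ge0.
have [rx|xr] := ltP r `|x|.
  by rewrite (pr _ rx) normc0 mulr0 !mulr_ge0// wt_ge0.
rewrite -mulrA; apply: ler_pM => //.
- by rewrite !addr_ge0 ?sqr_ge0// divr_ge0// pi_ge0.
- exact: normc_ge0.
rewrite /c lerD2r; apply: lerD; first by rewrite (le_trans xr) ?ler_norm.
rewrite lerD2r -[x ^+ 2]real_normK ?num_real// -[r ^+ 2]real_normK ?num_real//.
by rewrite lerXn2r ?nnegrE// (le_trans xr) ?ler_norm.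
Qed.

Lemma Int_hv_dC phi : test1 phi -> Int (fun x => (hv x)%:C * dC phi x) = - phi 0.
Proof.
move=> tphi; have td := test1_dC tphi; have [cr cI] := td.1 0%N.
have [K pK] := test1_odom td; have [r pr] := tphi.2.
apply: (Int_half (h := fun x => K * wt x)) => //.
- by move=> x; exact: test1_isdC.
- by apply: riZ; exact: ri_wt.
- move=> x; rewrite normcM normc_real; apply: le_trans (pK x).
  by rewrite ler_piMl ?normc_ge0// ger0_norm ?hv_ge0 ?hv_le1.
apply: ccvg_near; near=> n; apply: pr; rewrite ger0_norm//.
apply: (@lt_le_trans _ _ (n%:R)); last by rewrite ler_nat.
by near: n; exact: nbhs_infty_gtr.
Unshelve. all: by end_near. Qed.

(** The limit is ln |x| - i pi H + i pi / 2 with H the Heaviside function. The first term gives the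
    principal value, the second -i pi delta since H' = delta, and the constant disappears against
    phi'. *)
Lemma Int_Llim phi : test1 phi ->
  - Int (fun x => off0 (fun x => dC phi x * Llim x) x) = U0 phi.
Proof.
move=> tphi; have td := test1_dC tphi.
have [h rh hb] := ln_phi td 0.
have mln : measurable_fun setT (fun x : R => ln `|x|).
  exact: (measurableT_comp (@measurable_ln R) (@normr_measurable R setT)).
have m1 : cm (fun x => (ln `|x|)%:C * dC phi x).
  by apply: cmM; [exact: cm_real mln|exact: test1_cm].
have c1 : ci (fun x => (ln `|x|)%:C * dC phi x).
  apply: (ci_dom m1 rh) => x; rewrite normcM normc_real; apply: le_trans (hb x).
  apply: ler_wpM2r; first exact: normc_ge0.
  apply: (le_trans (ln_bound x)).
  have := sqr_ge0 x; have := sqr_ge0 (0 : R); have := pi_ge0 R; lra.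
have m2 : cm (fun x => (hv x)%:C * dC phi x).
  by apply: cmM; [apply: cm_real; exact: measurable_hv|exact: test1_cm].
have [K pK] := test1_odom td.
have c2 : ci (fun x => (hv x)%:C * dC phi x).
  apply: (@ci_wt _ K) => // x; rewrite normcM normc_real; apply: le_trans (pK x).
  by rewrite ler_piMl ?normc_ge0// ger0_norm ?hv_ge0 ?hv_le1.
have c3 := test1_ci td.
have E : (fun x => dC phi x * Llim x) = (fun x => (ln `|x|)%:C * dC phi x +
    ((0 +i* (- pi)) * ((hv x)%:C * dC phi x) + (0 +i* (pi / 2)) * dC phi x)).
  apply/funext => x; rewrite /Llim; apply: complexP;
  by rewrite ?(ReD, ImD, ReM, ImM) /=; field.
have c23 := ciD (ciZ (0 +i* (- pi)) c2) (ciZ (0 +i* (pi / 2)) c3).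
rewrite Int_off0; last 2 first.
- by apply: cmM; [exact: test1_cm|exact: cm_Llim].
- by rewrite E; apply: ciD.
rewrite E IntD// (IntD (ciZ _ c2) (ciZ _ c3)) !IntZ// Int_hv_dC//.
have -> : Int (dC phi) = 0.
  have [cr cI] := td.1 0%N; have [r pr] := tphi.2.
  apply: (@Int_deriv0 _ phi _ r) => //; first by move=> x; exact: test1_isdC.
  exact: vanish_dC.
rewrite /U0 mulr0 addr0 opprD; congr (_ - _).
by rewrite mulrN -mulNr; congr (_ * _); apply: complexP; rewrite ?ReN ?ImN/= ?oppr0// opprK.
Qed.

Lemma eps_limit phi (u : nat -> R) : test1 phi ->
  (forall n, 0 < u n) -> u @ \oo --> 0 ->
  ccvg (fun n => Int (fun x => (x +i* u n)^-1 * phi x)) (U0 phi).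
Proof.
move=> tphi u0 uc; have td := test1_dC tphi.
(* A common bound of the eps_n is what [Leps_bound] turns into one dominating function. *)
have [B uB] : exists B, forall n, u n <= B.
  have : cvgn u by apply/cvg_ex; exists 0.
  move=> /cvg_seq_bounded [N [_ uN]]; exists (N + 1) => n.
  apply: (le_trans (ler_norm _)); apply: uN => //.
  by rewrite ltrDl.
have [h rh hb] := ln_phi td B.
under eq_fun do rewrite Int_Keps//.
rewrite -Int_Llim//; apply: ccvgN.
have cmn n : cm (fun x => dC phi x * Leps (u n) x).
  by apply: cmM; [exact: test1_cm|exact: cm_Leps].
have bnd n x : normc (off0 (fun x => dC phi x * Leps (u n) x) x) <= h x.
  have h0 : 0 <= h x.
    apply: le_trans (hb x); apply: mulr_ge0; last exact: normc_ge0.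
    by rewrite !addr_ge0 ?sqr_ge0 ?lnm_ge0// divr_ge0// pi_ge0.
  rewrite /off0; case: eqP => [_|/eqP x0]; first by rewrite normc0.
  apply: le_trans (hb x); rewrite normcM mulrC; apply: ler_wpM2r.
    exact: normc_ge0.
  by apply: Leps_bound => //; rewrite u0 uB.
have -> : (fun n => Int (fun x => dC phi x * Leps (u n) x)) =
    (fun n => Int (off0 (fun x => dC phi x * Leps (u n) x))).
  apply/funext => n; rewrite Int_off0//.
  have [r pr] := tphi.2.
  apply: (@vanish_ci _ r).
    by apply: smM; [exact: td.1|exact: isdC_cont (fun x => isdC_Leps x (u0 n))].
  by move=> x rx; rewrite (vanish_dC pr rx) mul0r.
apply: (Int_dct _ rh) => //; first by move=> n; exact: cm_off0.
move=> x; rewrite /off0; case: eqP => [_|/eqP x0]; first exact: ccvg_cst.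
by apply: ccvgM; [exact: ccvg_cst|exact: Leps_cvg].
Qed.

End EpsLimit.

(** * Half-line Fourier representation of 1/(x + i0) and of its powers *)

Section HalfLine.
Context {R : realType}.
Local Notation C := R[i].
Local Notation leb := (@lebesgue_measure R).
Implicit Types (phi : R -> C) (e x : R).

Let dec (e s : R) : R := expR (- (2 * pi * e * s)).

Let dec_wt e s : 0 < e -> 0 <= s -> dec e s <= (1 + (e ^+ 2)^-1) * wt s.
Proof.
move=> e0 s0; have e2 : 0 < e ^+ 2 by rewrite exprn_gt0.
have t0 : 0 <= 2 * pi * e * s by rewrite !mulr_ge0 ?pi_ge0// ltW.
rewrite /dec expRN /wt /oneDsqr ler_pdivlMr; last by rewrite ltr_wpDr ?sqr_ge0.
rewrite mulrC ler_pdivrMr ?expR_gt0//.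
(* This is 1 + t^2 / 2 <= exp t for t = 2 pi e s. It yields 1 + e^2 s^2 <= exp t, and (1 + e^(-2))
   (1 + e^2 s^2) >= 1 + s^2. *)
have h := expR_ge1Dxn 1 t0.
have i0 : 0 <= (e ^+ 2)^-1 by rewrite invr_ge0 ltW.
apply: le_trans (ler_wpM2l _ h); last by rewrite addr_ge0.
have hp : 4 <= pi ^+ 2 :> R by have := pi_ge2 R; nra.
pose T := (2 * pi * e * s) ^+ (1.+1) / (1.+1)`!%:R.
have hT : e ^+ 2 * s ^+ 2 <= T.
  rewrite /T.
  rewrite (_ : 2`! = 2)%N// (_ : _ / 2 = 2 * pi ^+ 2 * (e ^+ 2 * s ^+ 2)); last by field.
  by rewrite ler_peMl ?mulr_ge0 ?sqr_ge0//; lra.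
rewrite -/T; have H : (1 + (e ^+ 2)^-1) * (1 + e ^+ 2 * s ^+ 2) <= (1 + (e ^+ 2)^-1) * (1 + T).
  by rewrite ler_wpM2l ?addr_ge0// lerD2l.
apply: le_trans _ H.
rewrite (_ : (1 + _) * _ = 1 + e ^+ 2 * s ^+ 2 + e ^- 2 + s ^+ 2); last first.
  by field; rewrite gt_eqF.
have := mulr_ge0 (ltW e2) (sqr_ge0 s); lra.
Qed.

(** The exponential exp(2 i pi s (x + i e)), which decays in s > 0 because e > 0. *)
Let E (e x s : R) : C := (dec e s)%:C * ee (- s) x.

Let isdC_E e x s : isdC (E e x) s (- kap * (x +i* e) * E e x s).
Proof.
have d1 : is_derive s 1 (dec e) (- (2 * pi * e) * dec e s).
  have dl : is_derive s 1 (fun s => - (2 * pi * e * s)) (- (2 * pi * e)).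
    by apply: is_derive_eq; rewrite /GRing.scale/=; ring.
  have dc := @is_derive1_comp _ expR (fun s => - (2 * pi * e * s)) s _ _ (is_derive_expR _) dl.
  by apply: (is_derive_eq dc); rewrite /GRing.scale/= mulrC.
have d2 : isdC (fun s => ee (- s) x) s (- (kap * x%:C) * ee (- s) x).
  have -> : (fun s => ee (- s) x) = ee (- x).
    by apply/funext => t; rewrite eeC /ee; congr expi; ring.
  apply: (isdC_eq (isdC_ee (- x) s)).
  rewrite (_ : ee (- s) x = ee (- x) s); last by rewrite eeC /ee; congr expi; ring.
  by congr (_ * _); rewrite rmorphN mulrN.
apply: (isdC_eq (isdCM (isdC_real d1) d2)); rewrite /E.
move: (dec e s) (ee (- s) x) => a b.
by apply: complexP; rewrite ?(ReD, ImD, ReM, ImM, ReN, ImN) /kap/=; ring.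
Qed.

Let measurable_dec e : measurable_fun setT (dec e).
Proof.
apply: measurableT_comp => //; apply: measurable_funN.
by apply: measurable_funM => //; exact: measurable_cst.
Qed.

Let hvdec_wt e s : 0 < e -> hv s * dec e s <= (1 + (e ^+ 2)^-1) * wt s.
Proof.
move=> e0; rewrite /hv; case: ifPn => [s0|_]; first by rewrite mul1r dec_wt.
by rewrite mul0r mulr_ge0 ?wt_ge0// addr_ge0// invr_ge0 sqr_ge0.
Qed.

Let normc_hE e x s : normc ((hv s)%:C * E e x s) = hv s * dec e s.
Proof.
by rewrite /E !normcM !normc_real normc_ee mulr1 !ger0_norm ?hv_ge0 ?expR_ge0.
Qed.

Let cm_hE e x : cm (fun s => (hv s)%:C * E e x s).
Proof.
apply: cmM; first by apply: cm_real; exact: measurable_hv.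
by apply: (isdC_cm (g := fun s => - kap * (x +i* e) * E e x s)) => s; exact: isdC_E.
Qed.

Lemma kapN0 : kap != 0 :> C.
Proof.
apply/eqP => /(congr1 (fun z => normc z)); rewrite normc_kap normc0 => /eqP.
by rewrite mulf_eq0 pnatr_eq0/= gt_eqF// pi_gt0.
Qed.

Lemma Keps_half e x : 0 < e ->
  (x +i* e)^-1 = kap * Int (fun s => (hv s)%:C * ((expR (- (2 * pi * e * s)))%:C * ee (- s) x)).
Proof.
move=> e0; pose c := - kap * (x +i* e).
have cE : ci (fun s => (hv s)%:C * E e x s).
  apply: (@ci_wt _ (1 + (e ^+ 2)^-1)) => // s; rewrite normc_hE; exact: hvdec_wt.
have sE : sm 0 (E e x) by apply: (isdC_cont (g := fun s => c * E e x s)) => s; exact: isdC_E.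
have [cr cI] : sm 0 (fun s => c * E e x s) by apply: smM => //; exact: sm_cst.
have xe0 : (x +i* e : C) != 0 by rewrite eq_complex /= negb_and (gt_eqF e0) orbT.
have := @Int_half _ (E e x) (fun s => c * E e x s)
  (fun s => normc c * ((1 + (e ^+ 2)^-1) * wt s)) (isdC_E e x) cr cI.
have -> : (fun s => (hv s)%:C * (c * E e x s)) = (fun s => c * ((hv s)%:C * E e x s)).
  by apply/funext => s; rewrite mulrCA.
rewrite IntZ//.
have -> : E e x 0 = 1.
  by rewrite /E /dec mulr0 oppr0 expR0 ee0 mulr1.
move=> H; rewrite -[X in kap * X](mulKf (_ : c != 0)); last first.
  by rewrite mulf_neq0// oppr_eq0 kapN0.
rewrite H.
- by rewrite /c invfM invrN; move: kapN0 => k0; field; rewrite k0 xe0.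
- by apply: riZ; apply: riZ; exact: ri_wt.
- move=> s; rewrite mulrCA normcM normc_hE ler_wpM2l ?normc_ge0//; exact: hvdec_wt.
apply/ccvg_norm; apply: (@squeeze_cvgr _ _ _ _ (fun=> 0)
    (fun n => (1 + (e ^+ 2)^-1) * n.+1%:R^-1)).
- apply: nearW => n; rewrite normc_ge0 subr0 /E normcM normc_ee mulr1 normc_real.
  rewrite ger0_norm ?expR_ge0//; apply: le_trans (dec_wt _ _) _ => //.
  apply: ler_wpM2l; first by rewrite addr_ge0// invr_ge0 sqr_ge0.
  rewrite /wt lef_pV2 ?posrE ?ltr0n//.
  rewrite /oneDsqr; have : (1 : R) <= n.+1%:R by rewrite ler1n.
  move: (n.+1%:R) => y y1; nra.
- exact: cvg_cst.
- rewrite -[X in _ --> X](mulr0 (1 + (e ^+ 2)^-1)).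
  by apply: cvgM; [exact: cvg_cst|exact: cvg_harmonic].
Qed.

(** Fubini is available here because e > 0 provides the decay in s. When e tends to 0 in [U0_rep],
    the decay of [hat phi] takes over. *)
Lemma Int_Keps_hat e phi : 0 < e -> test1 phi ->
  Int (fun x => (x +i* e)^-1 * phi x) =
  kap * Int (fun s => (hv s * expR (- (2 * pi * e * s)))%:C * hat phi (- s)).
Proof.
move=> e0 tphi; have [K pK] := test1_odom tphi.
pose F x s := phi x * ((hv s)%:C * E e x s).
have cmF : cm (fun z : R * R => F z.1 z.2).
  apply: cmM; first exact: (cm_comp measurable_fst (test1_cm tphi)).
  apply: cmM.
    by apply: cm_real; exact: (measurableT_comp measurable_hv measurable_snd).
  apply: cmM.
    by apply: cm_real; exact: (measurableT_comp (measurable_dec e) measurable_snd).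
  apply: (cm_comp (g := fun z : R * R => (- z.2, z.1)) _ cm_ee).
  apply: measurable_fun_pair; last exact: measurable_fst.
  by apply: measurable_funN; exact: measurable_snd.
have FK x s : normc (F x s) <= (K * (1 + (e ^+ 2)^-1)) * (wt x * wt s).
  rewrite normcM normc_hE mulrACA; apply: ler_pM; rewrite ?normc_ge0 ?mulr_ge0 ?hv_ge0 ?expR_ge0//.
  exact: hvdec_wt.
have cEx x : ci (fun s => (hv s)%:C * E e x s).
  apply: (@ci_wt _ (1 + (e ^+ 2)^-1)) => // s; rewrite normc_hE; exact: hvdec_wt.
have -> : (fun x => (x +i* e)^-1 * phi x) = (fun x => kap * Int (F x)).
  apply/funext => x; rewrite Keps_half// /F (IntZ (phi x) (cEx x)).
  by rewrite -[LHS]mulrA; congr (_ * _); rewrite mulrC.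
rewrite IntZ; last first.
  apply: (@ci_wt _ ((K * (1 + (e ^+ 2)^-1)) * cpi)); first exact: cm_Int.
  move=> x; rewrite mulrAC; apply: Int_wt.
    exact: (cm_comp (pair1_measurable x) cmF).
  by move=> s; apply: le_trans (FK x s) _; rewrite mulrA.
rewrite (Int_swap cmF FK); congr (_ * _); congr Int; apply/funext => s.
rewrite /hat -IntZ; last by apply: ci_ee; [exact: test1_ci|exact: test1_cm].
congr Int; apply/funext => x; rewrite /F /E rmorphM /=.
by rewrite -/(dec e s); ring.
Qed.

Lemma hat_wt phi : test1 phi -> exists K, odom K (hat phi).
Proof.
move=> tphi; have [K1 p1] := test1_odom tphi.
have [K2 p2] := test1_odom (test1_dC (test1_dC tphi)).
pose K := Num.max K1 K2; exists (2 ^+ 3 * K * cpi) => xi.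
have le K' f : odom K' f -> K' <= K -> odom K f.
  by move=> fK KK x; apply: le_trans (fK x) _; rewrite ler_wpM2r// wt_ge0.
have := @hat_decay _ 2 K phi xi tphi.
move=> /(_ (le _ _ p1 _) (le _ _ p2 _)).
rewrite !le_max !lexx orbT => /(_ isT isT) h.
rewrite /wt ler_pdivlMr//.
apply: le_trans h; rewrite ler_wpM2l ?normc_ge0// /oneDsqr -[xi ^+ 2]real_normK ?num_real//.
have := normr_ge0 xi; nra.
Qed.

Lemma U0_rep phi : test1 phi ->
  U0 phi = kap * Int (fun s => (hv s)%:C * hat phi (- s)).
Proof.
move=> tphi; have [K hK] := hat_wt tphi.
pose u (n : nat) : R := n.+1%:R^-1.
have u0 n : 0 < u n by rewrite invr_gt0 ltr0n.
have uc : u @ \oo --> 0 by exact: cvg_harmonic.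
have := eps_limit tphi u0 uc.
under eq_fun do rewrite Int_Keps_hat//.
move=> /ccvg_unique; apply; apply: ccvgM; first exact: ccvg_cst.
have mh : cm (fun s : R => hat phi (- s)).
  by apply: (cm_comp (@oppr_measurable R setT)); apply: cm_hat; exact: test1_cm.
apply: (Int_dct (g := fun s => K * wt s)).
- move=> n; apply: cmM => //; apply: cm_real; apply: measurable_funM.
    exact: measurable_hv.
  exact: (measurable_dec (u n)).
- by apply: riZ; exact: ri_wt.
- move=> n s; rewrite normcM normc_real -[wt s]wtN; apply: le_trans (hK (- s)).
  rewrite ler_piMl ?normc_ge0// ger0_norm ?mulr_ge0 ?hv_ge0 ?expR_ge0//.
  rewrite /hv; case: ifPn => [s0|_]; last by rewrite mul0r.
  rewrite mul1r -[leRHS]expR0 ler_expR oppr_le0 !mulr_ge0 ?pi_ge0//.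
  exact: ltW (u0 n).
- move=> s; apply: ccvgM; last exact: ccvg_cst.
  have : hv s * expR (- (2 * pi * u n * s)) @[n --> \oo] --> hv s.
    rewrite -[X in _ --> X]mulr1; apply: cvgM; first exact: cvg_cst.
    have Q : - (2 * pi * u n * s) @[n --> \oo] --> (0 : R).
      rewrite -oppr0 -(mul0r s) -(mulr0 (2 * pi)).
      apply: cvgN; apply: cvgM; last exact: cvg_cst.
      by apply: cvgM => //; exact: cvg_cst.
    rewrite -[X in _ --> X]expR0; exact: (continuous_cvg _ (@continuous_expR R 0) Q).
  by move=> c; split => //=; exact: cvg_cst.
Qed.

(* The pairing of (x + i0)^(-n-1) = (-1)^n / n! d^n (x + i0)^(-1) with [phi]. *)
Definition Un (n : nat) phi : C := (n`!%:R^-1)%:C * U0 (iter n dC phi).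

Lemma test1_iter n phi : test1 phi -> test1 (iter n dC phi).
Proof. by move=> tphi; elim: n => //= n; exact: test1_dC. Qed.

Lemma Un_rep n phi : test1 phi ->
  Un n phi = (n`!%:R^-1)%:C * kap ^+ n.+1 *
             Int (fun s => (hv s * s ^+ n)%:C * hat phi (- s)).
Proof.
move=> tphi; rewrite /Un U0_rep; last exact: test1_iter.
have [K hK] := hat_wt (test1_iter n tphi).
suff -> : Int (fun s => (hv s)%:C * hat (iter n dC phi) (- s)) =
  kap ^+ n * Int (fun s => (hv s * s ^+ n)%:C * hat phi (- s)).
  by rewrite exprS -!mulrA.
case: n hK => [|n] hK.
  by rewrite expr0 mul1r; congr Int; apply/funext => s; rewrite expr0 mulr1.
have E1 : (fun s => (hv s)%:C * hat (iter n.+1 dC phi) (- s)) =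
   (fun s => kap ^+ n.+1 * ((hv s * s ^+ n.+1)%:C * hat phi (- s))).
  apply/funext => s; rewrite hat_iter// rmorphN mulrN opprK exprMn -rmorphXn.
  by rewrite [(hv s * _)%:C]rmorphM; ring.
have k0 : kap ^+ n.+1 != 0 :> C by rewrite expf_neq0// kapN0.
(* Integrability of the integrand with s^n is read off backwards, from the decay of the transform of
   the n-th derivative. *)
rewrite E1 IntZ//; have <- : (fun s => kap ^- n.+1 * ((hv s)%:C * hat (iter n.+1 dC phi) (- s))) =
  (fun s => (hv s * s ^+ n.+1)%:C * hat phi (- s)).
  by apply/funext => s; have /(congr1 (@^~ s)) /= -> := E1; rewrite mulKf.
apply: ciZ; apply: (@ci_wt _ K).
  apply: cmM; first by apply: cm_real; exact: measurable_hv.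
  apply: (cm_comp (@oppr_measurable R setT)); apply: cm_hat; apply: test1_cm.
  exact: (test1_iter n.+1 tphi).
move=> s; rewrite normcM normc_real -[wt s]wtN; apply: le_trans (hK (- s)).
by rewrite ler_piMl ?normc_ge0// ger0_norm ?hv_ge0 ?hv_le1.
Qed.

End HalfLine.

(** * Fourier inversion on the line *)

Section Inversion.
Context {R : realType}.
Local Notation C := R[i].
Local Notation Re := (@complex.Re R).
Local Notation Im := (@complex.Im R).
Implicit Types (phi : R -> C) (e x : R).

Lemma isdC_opp phi x l : isdC phi (- x) l -> isdC (fun y => phi (- y)) x (- l).
Proof.
have dN : is_derive x 1 (fun y : R => - y) (-1).
  by apply: is_derive_eq.
move=> [a b]; split.
  have dc := @is_derive1_comp _ (fun y => Re (phi y)) (fun y => - y) x _ _ a dN.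
  by apply: (is_derive_eq dc); rewrite /GRing.scale/= ReN mulrN1.
have dc := @is_derive1_comp _ (fun y => Im (phi y)) (fun y => - y) x _ _ b dN.
by apply: (is_derive_eq dc); rewrite /GRing.scale/= ImN mulrN1.
Qed.

Lemma isdC_shift phi x c l : isdC phi (x + c) l -> isdC (fun y => phi (y + c)) x l.
Proof.
have dN : is_derive x 1 (fun y : R => y + c) 1.
  by apply: is_derive_eq; rewrite addr0.
move=> [a b]; split.
  have dc := @is_derive1_comp _ (fun y => Re (phi y)) (fun y => y + c) x _ _ a dN.
  by apply: (is_derive_eq dc); rewrite mulr1.
have dc := @is_derive1_comp _ (fun y => Im (phi y)) (fun y => y + c) x _ _ b dN.
by apply: (is_derive_eq dc); rewrite mulr1.
Qed.

Lemma sm_opp n phi : sm n phi -> sm n (fun y => phi (- y)).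
Proof.
have opp0 (f : R -> C) : sm 0 f -> sm 0 (fun y => f (- y)).
  have sh (x : R) : (fun y => - y) @ x --> - x by apply: cvgN; exact: cvg_id.
  move=> [a b]; split => x; [exact: (continuous_cvg _ (a (- x)) (sh x))
    |exact: (continuous_cvg _ (b (- x)) (sh x))].
elim: n phi => [|n IH] phi; first exact: opp0.
move=> [g dg sg]; exists (fun y => (-1) * g (- y)).
  by move=> x; apply: isdC_eq (isdC_opp (dg _)) _; rewrite mulN1r.
by apply: smM; [exact: sm_cst|exact: IH].
Qed.

Lemma sm_shift n phi c : sm n phi -> sm n (fun y => phi (y + c)).
Proof.
elim: n phi => [|n IH] phi.
  move=> [a b]; have sh (x : R) : (fun y => y + c) @ x --> x + c.
    by apply: cvgD; [exact: cvg_id|exact: cvg_cst].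
  by split => x; [exact: (continuous_cvg _ (a (x + c)) (sh x))
    |exact: (continuous_cvg _ (b (x + c)) (sh x))].
move=> [g dg sg]; exists (fun y => g (y + c)); last exact: IH.
by move=> x; exact: isdC_shift.
Qed.

Lemma test1_opp phi : test1 phi -> test1 (fun y => phi (- y)).
Proof.
move=> [sf [r fr]]; split; first by move=> n; exact: sm_opp.
by exists r => x rx; apply: fr; rewrite normrN.
Qed.

Lemma test1_shift phi c : test1 phi -> test1 (fun y => phi (y + c)).
Proof.
move=> [sf [r fr]]; split; first by move=> n; exact: sm_shift.
exists (r + `|c|) => x rx; apply: fr.
have := ler_normD (x + c) (- c); rewrite addrK normrN; lra.
Qed.

(** The principal value is odd and cancels, while the two Dirac terms add up: this is 1/(x + i0) -
    1/(x - i0) = -2 i pi delta. Through [U0_rep] it becomes Fourier inversion at 0. *)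
Lemma U0_opp phi : test1 phi -> U0 phi + U0 (fun y => phi (- y)) = kap * phi 0.
Proof.
move=> tphi; have td := test1_dC tphi.
have -> : U0 (fun y => phi (- y)) = Int (fun x => (ln `|x|)%:C * dC phi x) - (0 +i* pi) * phi 0.
  rewrite /U0 oppr0; congr (_ - _).
  have -> : dC (fun y => phi (- y)) = (fun y => - dC phi (- y)).
    by apply: isdC_funE => x; apply: isdC_opp; exact: test1_isdC.
  have mln : measurable_fun setT (fun x : R => ln `|x|).
    exact: (measurableT_comp (@measurable_ln R) (@normr_measurable R setT)).
  have m1 : cm (fun x => (ln `|x|)%:C * dC phi x).
    by apply: cmM; [exact: cm_real mln|exact: test1_cm].
  rewrite -[in RHS](Int_opp m1) -IntN.
    by congr Int; apply/funext => x; rewrite normrN mulrN opprK.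
  have [h rh hb] := ln_phi (test1_opp td) 0.
  apply: (ci_dom _ rh).
    apply: cmM; first exact: cm_real mln.
    exact: cmN (test1_cm (test1_opp td)).
  move=> x; rewrite normcM normc_opp normc_real; apply: le_trans (hb x).
  apply: ler_wpM2r; first exact: normc_ge0.
  apply: (le_trans (ln_bound x)).
  have := sqr_ge0 x; have := sqr_ge0 (0 : R); have := pi_ge0 R; lra.
rewrite /U0 addrACA addNr add0r -opprD -mulrDl -mulNr; congr (_ * _).
by rewrite /kap; apply: complexP; rewrite /=; ring.
Qed.

Lemma hat_opp phi s : cm phi -> hat (fun y => phi (- y)) s = hat phi (- s).
Proof.
move=> mphi; rewrite /hat -[RHS]Int_opp; last by apply: cmM => //; exact: cm_ee1.
by congr Int; apply/funext => x; congr (_ * _); rewrite /ee; congr expi; ring.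
Qed.

Lemma hat_inv0 phi : test1 phi -> Int (hat phi) = phi 0.
Proof.
move=> tphi; have mphi := test1_cm tphi; have mh := cm_hat mphi.
have [K hK] := hat_wt tphi.
have mhN : cm (fun s : R => hat phi (- s)) by exact: (cm_comp (@oppr_measurable R setT)).
have := U0_opp tphi; rewrite !U0_rep//; last exact: test1_opp.
have chv (f : R -> C) : cm f -> (forall x, normc (f x) <= K * wt x) ->
   cm (fun s => (hv s)%:C * f s) /\ ci (fun s => (hv s)%:C * f s).
  move=> mf fK; have m : cm (fun s => (hv s)%:C * f s).
    by apply: cmM => //; apply: cm_real; exact: measurable_hv.
  split => //; apply: (ci_wt m) => s; apply: le_trans (fK s).
  by rewrite normcM normc_real ler_piMl ?normc_ge0// ger0_norm ?hv_ge0 ?hv_le1.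
have hKN (x : R) : normc (hat phi (- x)) <= K * wt x by rewrite -wtN.
have [m1 c1] := chv _ mhN hKN; have [m2 c2] := chv _ mh hK.
have -> : (fun s => (hv s)%:C * hat (fun y => phi (- y)) (- s)) =
   (fun s => (hv s)%:C * hat phi s).
  by apply/funext => s; rewrite hat_opp// opprK.
rewrite -mulrDr => /(mulfI kapN0); rewrite -(Int_opp m2) => <-.
have m2N : cm (fun x : R => (hv (- x))%:C * hat phi (- x)).
  exact: (cm_comp (@oppr_measurable R setT) m2).
have c2N : ci (fun x : R => (hv (- x))%:C * hat phi (- x)).
  apply: (ci_wt m2N (K := K)) => s; apply: le_trans (hKN s).
  by rewrite normcM normc_real ler_piMl ?normc_ge0// ger0_norm ?hv_ge0 ?hv_le1.
(* [hv x + hv (- x)] is 1 except at 0, where it is 2; [off0] discards that point. *)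
rewrite -IntD// -(Int_opp mh) -Int_off0//; last exact: ci_wt mhN hKN.
rewrite -[RHS]Int_off0; [|exact: cmD|exact: ciD].
congr Int; apply/funext => x; rewrite /off0; case: eqP => // /eqP x0.
have [xp|xn] := leP 0 x.
  by rewrite hv_pos// hv_neg ?mul0r ?mul1r ?addr0// oppr_lt0 lt_def x0.
by rewrite hv_neg// hv_pos ?mul0r ?mul1r ?add0r// oppr_ge0 ltW.
Qed.

Lemma hat_inv phi y : test1 phi -> Int (fun xi => ee xi (- y) * hat phi xi) = phi y.
Proof.
move=> tphi; have := hat_inv0 (test1_shift y tphi); rewrite add0r => <-.
congr Int; apply/funext => xi; rewrite /hat -IntZ; last first.
  by apply: ci_ee; [exact: test1_ci|exact: test1_cm].
rewrite -(@Int_shift _ y); last first.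
  by apply: cmM; [exact: cm_cst|apply: cmM; [exact: cm_ee1|exact: test1_cm]].
congr Int; apply/funext => x; rewrite mulrA -eeDr; congr (ee _ _ * _); ring.
Qed.

Lemma inv_hat phi y : test1 phi ->
  Int (fun xi => ee xi y * Int (fun x => ee xi (- x) * phi x)) = phi y.
Proof.
move=> tphi; rewrite -(hat_inv y tphi) -Int_opp.
  congr Int; apply/funext => xi; congr (_ * _).
    by rewrite /ee; congr expi; ring.
  by congr Int; apply/funext => x; congr (_ * _); rewrite /ee; congr expi; ring.
apply: cmM; first exact: cm_comp (pair2_measurable y) cm_ee.
have := cm_comp (@oppr_measurable R setT) (cm_hat (test1_cm tphi)).
congr cm; apply/funext => xi; congr Int; apply/funext => x.
by congr (_ * _); rewrite /ee; congr expi; ring.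
Qed.

End Inversion.

(** * Fourier transforms of localized powers of 1/(x + i0) *)

Section Convolution.
Context {R : realType}.
Local Notation C := R[i].
Implicit Types (a c phi k : R -> C) (e x y s : R).

Lemma Int_wt1 (F : R -> R -> C) K x : cm (fun z : R * R => F z.1 z.2) ->
  (forall x y, normc (F x y) <= K * (wt x * wt y)) ->
  normc (Int (F x)) <= K * cpi * wt x.
Proof.
move=> mF FK; rewrite mulrAC; apply: Int_wt.
  exact: (cm_comp (pair1_measurable x) mF).
by move=> y; apply: le_trans (FK x y) _; rewrite mulrA.
Qed.

Lemma ci_Int (F : R -> R -> C) K : cm (fun z : R * R => F z.1 z.2) ->
  (forall x y, normc (F x y) <= K * (wt x * wt y)) -> ci (fun x => Int (F x)).
Proof.
by move=> mF FK; apply: (@ci_wt _ (K * cpi)) => [|x]; [exact: cm_Int|exact: Int_wt1].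
Qed.

Lemma cm_swap (F : R -> R -> C) : cm (fun z : R * R => F z.1 z.2) ->
  cm (fun z : R * R => F z.2 z.1).
Proof.
move=> mF; apply: (cm_comp (g := fun z : R * R => (z.2, z.1)) _ mF).
by apply: measurable_fun_pair; [exact: measurable_snd|exact: measurable_fst].
Qed.

Lemma ci_Int2 (F : R -> R -> C) K : cm (fun z : R * R => F z.1 z.2) ->
  (forall x y, normc (F x y) <= K * (wt x * wt y)) ->
  ci (fun y => Int (fun x => F x y)).
Proof.
move=> mF FK; apply: (@ci_Int (fun y x => F x y) K (cm_swap mF)) => y x.
by rewrite [wt y * _]mulrC.
Qed.

Lemma hv0 x : x < 0 -> hv x = 0.
Proof. by move=> x0; rewrite /hv leNgt x0. Qed.

Definition br x : R := 1 + `|x|.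
(** The negative part. The rapid decrease of A_n[a] holds only towards -oo, so it is measured by
    powers of [1 + mm x], and the growth at +oo by powers of [br x]. *)
Definition mm x : R := Num.max 0 (- x).

Lemma br_ge1 x : 1 <= br x. Proof. by rewrite /br lerDl. Qed.
Lemma br_gt0 x : 0 < br x. Proof. exact: lt_le_trans ltr01 (br_ge1 x). Qed.
Lemma br_ge0 x : 0 <= br x. Proof. exact/ltW/br_gt0. Qed.
Lemma mm_ge0 x : 0 <= mm x. Proof. by rewrite /mm le_max lexx. Qed.
Lemma mm_pos x : 0 <= x -> mm x = 0.
Proof. by move=> x0; apply/max_idPl; rewrite oppr_le0. Qed.
Lemma brN x : br (- x) = br x. Proof. by rewrite /br normrN. Qed.
Lemma brX_ge0 x n : 0 <= br x ^+ n. Proof. exact: exprn_ge0 (br_ge0 x). Qed.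

(** Submultiplicativity is what distributes polynomial weights over the arguments of a
    convolution. *)
Lemma br_add x y : br (x + y) <= br x * br y.
Proof.
have := ler_normD x y; rewrite /br.
have := mulr_ge0 (normr_ge0 x) (normr_ge0 y); lra.
Qed.

Lemma br_sub x y : br y <= br x * br (x - y).
Proof. have := br_add x (- (x - y)); rewrite brN.
by rewrite (_ : x + - (x - y) = y)//; ring. Qed.

(** From |z| = z + 2 [mm z] one gets |x| + |y| <= |x + y| + 2 [mm x] + 2 [mm y]. Every convergence
    argument for two functions concentrated at +oo goes through this inequality. *)
Lemma br_mm x y : br x <= 2 * (br (x + y) * ((1 + mm x) * (1 + mm y))).
Proof.
have h : `|x| + `|y| <= `|x + y| + 2 * mm x + 2 * mm y.
  have e (z : R) : `|z| = z + 2 * mm z.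
    have [z0|z0] := leP 0 z; first by rewrite mm_pos// ger0_norm// mulr0 addr0.
    rewrite ltr0_norm// /mm (max_idPr _) ?oppr_ge0 ?ltW//; ring.
  rewrite (e x) (e y); have := ler_norm (x + y); lra.
have := normr_ge0 y; have := mm_ge0 x; have := mm_ge0 y; have := normr_ge0 (x + y).
rewrite /br; move: h; move: `|x + y| `|x| `|y| (mm x) (mm y) => p q r u v h *.
have h1 : 0 <= u * v by exact: mulr_ge0.
have h2 : 0 <= p * u by exact: mulr_ge0.
have h3 : 0 <= p * v by exact: mulr_ge0.
have h4 : 0 <= p * (u * v) by exact: mulr_ge0.
lra.
Qed.

Lemma br2_oneDsqr x : oneDsqr x <= br x ^+ 2.
Proof.
have e : x ^+ 2 = `|x| ^+ 2 by rewrite real_normK ?num_real.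
rewrite /br /oneDsqr e; have := normr_ge0 x; nra.
Qed.

Lemma br2_wt x : (br x ^+ 2)^-1 <= wt x.
Proof. by rewrite /wt lef_pV2 ?posrE ?exprn_gt0 ?br_gt0// br2_oneDsqr. Qed.

(** Each factor [wt] is bought with two powers of [br]; this is the origin of the exponents + 2, + 4
    and + 6 below. *)
Lemma le_wt (v K : R) x : v * br x ^+ 2 <= K -> 0 <= K -> v <= K * wt x.
Proof.
move=> h K0; apply: (@le_trans _ _ (K * (br x ^+ 2)^-1)).
  by rewrite ler_pdivlMr// exprn_gt0// br_gt0.
by rewrite ler_wpM2l// br2_wt.
Qed.

Lemma le_wt2 (v K : R) x y : 0 <= v -> v * (br x ^+ 2 * br y ^+ 2) <= K ->
  v <= K * (wt x * wt y).
Proof.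
move=> v0 h.
have K0 : 0 <= K.
  by apply: le_trans h; apply: mulr_ge0 => //; apply: mulr_ge0; exact: brX_ge0.
rewrite mulrA; apply: le_wt; last by rewrite mulr_ge0// wt_ge0.
by apply: le_wt => //; rewrite -mulrA [br y ^+ 2 * _]mulrC.
Qed.

Definition rdec k := forall N, exists2 K, 0 <= K & forall x, normc (k x) * br x ^+ N <= K.

Lemma rdec_odom k : rdec k -> exists K, odom K k.
Proof.
by move=> /(_ 2%N)[K K0 kK]; exists K => x; apply: le_wt.
Qed.

Lemma rdec_ci k : cm k -> rdec k -> ci k.
Proof. by move=> mk /rdec_odom [K kK]; exact: ci_wt mk kK. Qed.

Lemma rdecZ (z : C) k : rdec k -> rdec (fun x => z * k x).
Proof.
move=> rk N; have [K K0 kK] := rk N; exists (normc z * K).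
  by rewrite mulr_ge0// normc_ge0.
by move=> x; rewrite normcM -mulrA ler_wpM2l// normc_ge0.
Qed.

Lemma rdecX k : rdec k -> rdec (fun x => x%:C * k x).
Proof.
move=> rk N; have [K K0 kK] := rk N.+1; exists K => // x.
apply: le_trans (kK x); rewrite normcM normc_real exprS mulrA [normc _ * _]mulrC.
rewrite ler_wpM2r ?brX_ge0// ler_wpM2r ?normc_ge0// /br; lra.
Qed.

Lemma rdec_opp k : rdec k -> rdec (fun x => k (- x)).
Proof.
by move=> rk N; have [K K0 kK] := rk N; exists K => // x; rewrite -brN.
Qed.

Lemma rdec_shift k y : rdec k -> rdec (fun x => k (x + y)).
Proof.
move=> rk N; have [K K0 kK] := rk N; exists (K * br y ^+ N).
  by rewrite mulr_ge0// brX_ge0.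
move=> x; apply: (@le_trans _ _ (normc (k (x + y)) * (br (x + y) * br y) ^+ N)).
  rewrite ler_wpM2l ?normc_ge0// lerXn2r ?nnegrE ?br_ge0 ?mulr_ge0 ?br_ge0//.
  have := br_add (x + y) (- y); rewrite brN.
  by rewrite addrK.
by rewrite exprMn mulrA ler_wpM2r ?brX_ge0.
Qed.

Lemma test1_rdec phi : test1 phi -> rdec (hat phi).
Proof.
move=> tphi N; have [K1 p1] := test1_odom tphi.
have [K2 p2] := test1_odom (test1_iter N tphi).
have le (K K' : R) (f : R -> C) : odom K' f -> K' <= K -> odom K f.
  by move=> fK KK x; apply: le_trans (fK x) _; rewrite ler_wpM2r// wt_ge0.
pose K := Num.max K1 K2; have K0 : 0 <= K by rewrite /K le_max (odom_ge0 p1).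
exists (2 ^+ N.+1 * K * cpi) => [|xi].
  by apply: mulr_ge0; [apply: mulr_ge0 => //; exact: exprn_ge0|exact: cpi_ge0].
by apply: hat_decay => //; [apply: (le _ _ _ p1)|apply: (le _ _ _ p2)];
   rewrite le_max lexx ?orbT.
Qed.

Lemma isdC_hat k y : cm k -> rdec k ->
  isdC (hat k) y (hat (fun x => kap * (x%:C * k x)) y).
Proof.
move=> mk rk; have rk' := rdecZ kap (rdecX rk).
have [K1 k1] := rdec_odom rk; have [K2 k2] := rdec_odom rk'.
have -> : hat (fun x => kap * (x%:C * k x)) y =
    Int (fun x => kap * x%:C * ee y x * k x).
  by congr Int; apply/funext => x; ring.
apply: (Int_isdC (F := fun y x => ee y x * k x)
  (G := fun y x => kap * x%:C * ee y x * k x) (h := fun x => Num.max K1 K2 * wt x)).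
- by apply: riZ; exact: ri_wt.
- by move=> z; apply: cmM => //; exact: cm_ee1.
- move=> z x; apply: isdC_eq (isdCM _ (isdC_cst (k x) z)) _; last first.
    by rewrite mulr0 addr0.
  have -> : (fun x0 => ee x0 x) = ee x by apply/funext => t; rewrite eeC.
  by apply: isdC_eq (isdC_ee x z) _; rewrite eeC.
- move=> z x; rewrite normcM normc_ee mul1r; apply: le_trans (k1 x) _.
  by rewrite ler_wpM2r ?wt_ge0// le_max lexx.
- move=> z x; rewrite mulrAC normcM normc_ee mulr1 -mulrA; apply: le_trans (k2 x) _.
  by rewrite ler_wpM2r ?wt_ge0// le_max lexx orbT.
Qed.

Lemma cm_id : cm (fun x : R => x%:C : C).
Proof. by apply: cm_real; exact: measurable_id. Qed.

Lemma sm_hat n k : cm k -> rdec k -> sm n (hat k).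
Proof.
elim: n k => [|n IH] k mk rk.
  by apply: isdC_cont => y; exact: isdC_hat.
exists (hat (fun x => kap * (x%:C * k x))); first by move=> y; exact: isdC_hat.
apply: IH; last exact/rdecZ/rdecX.
by apply: cmM; [exact: cm_cst|apply: cmM => //; exact: cm_id].
Qed.

Lemma cm_sub : measurable_fun setT (fun z : R * R => z.1 - z.2).
Proof. by apply: measurable_funB; [exact: measurable_fst|exact: measurable_snd]. Qed.

Lemma hat_mul_hat a k xi : test1 a -> cm k -> rdec k ->
  hat (fun y => a y * hat k y) xi = Int (fun x => k x * hat a (xi + x)).
Proof.
move=> ta mk rk; have ma := test1_cm ta.
have [K1 a1] := test1_odom ta; have [K2 k2] := rdec_odom rk.
rewrite /hat; have -> : (fun y => ee xi y * (a y * Int (fun x => ee y x * k x))) =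
   (fun y => Int (fun x => ee (xi + x) y * a y * k x)).
  apply/funext => y; rewrite mulrA -IntZ; last by apply: ci_ee; [exact: rdec_ci|].
  by congr Int; apply/funext => x; rewrite eeDl [ee x y]eeC; ring.
rewrite (@Int_swap _ _ (K1 * K2)).
- congr Int; apply/funext => x; rewrite -IntZ; last first.
    by apply: ci_ee => //; exact: test1_ci.
  by congr Int; apply/funext => y; rewrite mulrC.
- apply: cmM; last exact: (cm_comp measurable_snd mk).
  apply: cmM; last exact: (cm_comp measurable_fst ma).
  apply: (cm_comp (g := fun z : R * R => (xi + z.2, z.1)) _ cm_ee).
  apply: measurable_fun_pair; last exact: measurable_fst.
  by apply: measurable_funD; [exact: measurable_cst|exact: measurable_snd].
- move=> y x; rewrite !normcM normc_ee mul1r mulrACA.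
  by apply: ler_pM; rewrite ?normc_ge0.
Qed.

(* [cn n] times the truncated power s_+^n is the Fourier transform of
   (x + i0)^(-n-1), and [Ak n a] is that of a (x + i0)^(-n-1). *)
Definition cn (n : nat) : C := (n`!%:R^-1)%:C * kap ^+ n.+1.

Definition Ak (n : nat) a x : C :=
  cn n * Int (fun s => (hv s * s ^+ n)%:C * hat a (x - s)).

Lemma measurable_hvX n : measurable_fun setT (fun s : R => hv s * s ^+ n).
Proof. by apply: measurable_funM; [exact: measurable_hv|exact: exprn_measurable]. Qed.

Lemma cm_hatsub a : cm a -> cm (fun z : R * R => hat a (z.1 - z.2)).
Proof. move=> ma; exact: (cm_comp cm_sub (cm_hat ma)). Qed.

Lemma cm_Ak n a : cm a -> cm (Ak n a).
Proof.
move=> ma; apply: cmM; first exact: cm_cst.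
apply: cm_Int; apply: cmM; last exact: cm_hatsub.
apply: cm_real; exact: (measurableT_comp (measurable_hvX n) measurable_snd).
Qed.

Lemma hv_bound n s : `|hv s * s ^+ n| <= br s ^+ n.
Proof.
rewrite normrM [`|hv s|]ger0_norm ?hv_ge0// normrX.
apply: (@le_trans _ _ (1 * `|s| ^+ n)); first by rewrite ler_wpM2r ?exprn_ge0// hv_le1.
by rewrite mul1r lerXn2r ?nnegrE ?br_ge0// /br lerDr.
Qed.

Lemma Ak_int n a x : test1 a ->
  exists2 K, 0 <= K & forall s, normc ((hv s * s ^+ n)%:C * hat a (x - s)) <= K * wt s.
Proof.
move=> ta; have [K K0 aK] := test1_rdec ta (n + 2)%N.
have KK0 : 0 <= br x ^+ (n + 2) * K by rewrite mulr_ge0// brX_ge0.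
exists (br x ^+ (n + 2) * K) => // s; apply: le_wt => //.
rewrite normcM normc_real mulrAC -/(normc _).
apply: (@le_trans _ _ (br s ^+ (n + 2) * normc (hat a (x - s)))).
  rewrite ler_wpM2r ?normc_ge0// exprD ler_wpM2r ?brX_ge0//; exact: hv_bound.
apply: (@le_trans _ _ ((br x * br (x - s)) ^+ (n + 2) * normc (hat a (x - s)))).
  rewrite ler_wpM2r ?normc_ge0// lerXn2r ?nnegrE ?mulr_ge0 ?br_ge0//; exact: br_sub.
by rewrite exprMn -mulrA ler_wpM2l ?brX_ge0// mulrC.
Qed.

Lemma Ak_cm1 n a x : cm a -> cm (fun s => (hv s * s ^+ n)%:C * hat a (x - s)).
Proof.
move=> ma; apply: cmM; first by apply: cm_real; exact: measurable_hvX.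
exact: (cm_comp (pair1_measurable x) (cm_hatsub ma)).
Qed.

Lemma Un_ee n a x : test1 a -> Un n (fun y => a y * ee x y) = Ak n a x.
Proof.
move=> ta; rewrite Un_rep; last by apply: test1M => // m; exact: sm_ee.
have E s : hat (fun y => a y * ee x y) (- s) = hat a (x - s).
  by congr Int; apply/funext => y; rewrite [x - s]addrC eeDl; ring.
by under eq_fun do rewrite E.
Qed.

Lemma ci_rdec_hat k a s : cm k -> rdec k -> test1 a ->
  ci (fun x => k x * hat a (x - s)).
Proof.
move=> mk rk ta; have [K kK] := rdec_odom rk; have [L aL] := test1_odom ta.
have K0 := odom_ge0 kK; have ma := test1_cm ta.
apply: (@ci_wt _ (K * (L * cpi))) => [|x].
  apply: cmM => //; exact: (cm_comp (pair2_measurable s) (cm_hatsub ma)).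
rewrite normcM mulrAC; apply: ler_pM; rewrite ?normc_ge0//; exact: hat_bound.
Qed.

(** Here [A] is |hat a (x - s)|, [B] is |k x| and [d] is [br (x - s)]. By [bs <= bx * d] the n + 2
    powers of s are shared between the decay of k and that of [hat a]; two further powers of [bx]
    serve the weight in x. *)
Let est_swap n (A B bx bs d q K L : R) : 0 <= A -> 0 <= B -> 0 <= bx ->
  0 <= bs -> 0 <= d -> q <= bs ^+ n -> bs <= bx * d ->
  B * bx ^+ (n + 2 + 2) <= L -> A * d ^+ (n + 2) <= K ->
  B * (q * A) * (bs ^+ 2 * bx ^+ 2) <= L * K.
Proof.
move=> A0 B0 x0 s0 d0 qs sxd BL AK.
have h : bs ^+ (n + 2) <= bx ^+ (n + 2) * d ^+ (n + 2).
  by rewrite -exprMn lerXn2r ?nnegrE ?mulr_ge0.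
apply: (@le_trans _ _ ((B * bx ^+ (n + 2 + 2)) * (A * d ^+ (n + 2)))); last first.
  by apply: ler_pM => //; rewrite mulr_ge0 ?exprn_ge0.
have c0 : 0 <= B * A * bx ^+ 2 by rewrite !mulr_ge0 ?exprn_ge0.
apply: (@le_trans _ _ (B * A * bx ^+ 2 * bs ^+ (n + 2))).
  rewrite (_ : _ * _ = B * A * bx ^+ 2 * (q * bs ^+ 2)); last by ring.
  rewrite exprD; apply: ler_wpM2l => //.
  by rewrite ler_wpM2r ?exprn_ge0.
rewrite [bx ^+ (n + 2 + 2)]exprD (_ : B * (_ * _) * _ =
   B * A * bx ^+ 2 * (bx ^+ (n + 2) * d ^+ (n + 2))); last by ring.
exact: ler_wpM2l.
Qed.

Lemma Un_mul_hat n a k : test1 a -> cm k -> rdec k ->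
  Un n (fun y => a y * hat k y) = Int (fun x => k x * Ak n a x).
Proof.
move=> ta mk rk; have ma := test1_cm ta.
rewrite Un_rep; last by apply: test1M => // m; exact: sm_hat.
rewrite -/(cn n).
have -> : (fun s => (hv s * s ^+ n)%:C * hat (fun y => a y * hat k y) (- s)) =
   (fun s => Int (fun x => k x * ((hv s * s ^+ n)%:C * hat a (x - s)))).
  apply/funext => s; rewrite hat_mul_hat// -IntZ.
    by congr Int; apply/funext => x; rewrite [- s + x]addrC; ring.
  by under eq_fun do rewrite addrC; exact: ci_rdec_hat.
have [K K0 aK] := test1_rdec ta (n + 2)%N; have [L L0 kL] := rk (n + 2 + 2)%N.
pose F s x := k x * ((hv s * s ^+ n)%:C * hat a (x - s)).
have mF : cm (fun z : R * R => F z.1 z.2).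
  apply: cmM; first exact: (cm_comp measurable_snd mk).
  apply: cmM.
    by apply: cm_real; exact: (measurableT_comp (measurable_hvX n) measurable_fst).
  apply: (cm_comp (g := fun z : R * R => z.2 - z.1) _ (cm_hat ma)).
  by apply: measurable_funB; [exact: measurable_snd|exact: measurable_fst].
have FK s x : normc (F s x) <= L * K * (wt s * wt x).
  apply: le_wt2; first exact: normc_ge0.
  rewrite /F !normcM normc_real.
  apply: (@est_swap n _ _ (br x) (br s) (br (x - s))); rewrite ?normc_ge0 ?br_ge0//.
  - exact: hv_bound.
  - exact: br_sub.
rewrite (Int_swap mF FK) -IntZ; last exact: ci_Int2 mF FK.
congr Int; apply/funext => x; rewrite /Ak IntZ; first by ring.
have [M _ aM] := Ak_int n x ta.
exact: ci_wt (Ak_cm1 n x ma) aM.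
Qed.

Lemma ri_wt_sub x : ri (fun s => wt (x - s)).
Proof.
apply: (ri_dom (g := fun s => (2 * br x ^+ 2) * wt s)).
- apply: (measurableT_comp measurable_wt).
  by apply: measurable_funB; [exact: measurable_cst|exact: measurable_id].
- by apply: riZ; exact: ri_wt.
- move=> s; rewrite ger0_norm ?wt_ge0// /wt ler_pdivlMr// mulrC ler_pdivrMr//.
  have e (t : R) : t ^+ 2 = `|t| ^+ 2 by rewrite real_normK ?num_real.
  have := normr_ge0 x; rewrite /oneDsqr /br => x0.
  have : 1 + x ^+ 2 <= (1 + `|x|) ^+ 2 by rewrite e; nra.
  (* Peetre's inequality. *)
  have h : 1 + s ^+ 2 <= 2 * (1 + x ^+ 2) * (1 + (x - s) ^+ 2).
    have := sqr_ge0 (x + (x - s)); have := sqr_ge0 (x * (x - s)); nra.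
  move=> h2; apply: (le_trans h); apply: ler_wpM2r; last by rewrite ler_wpM2l.
  by rewrite addr_ge0// sqr_ge0.
Qed.

Lemma RInt_wt_sub x : RInt (fun s => wt (x - s)) = RInt wt.
Proof.
rewrite -(RInt_shift (- x) measurable_wt); congr RInt; apply/funext => s.
by rewrite -wtN; congr wt; ring.
Qed.

Let est_Ak n N (A bx bxs bs q m K w : R) : 0 <= A -> 0 <= bx -> 0 <= bs -> 0 <= bxs ->
  0 <= q -> q <= bs ^+ n -> bs <= bx * bxs -> 0 <= m -> m <= bxs ->
  A * bxs ^+ (n + N + 2) <= K -> (bxs ^+ 2)^-1 <= w -> 0 < bxs ->
  q * A * m ^+ N <= K * bx ^+ n * w.
Proof.
move=> A0 x0 s0 xs0 q0 qs sxd m0 mxs AK wx xsp.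
apply: (@le_trans _ _ (bs ^+ n * A * bxs ^+ N)).
  apply: ler_pM; rewrite ?mulr_ge0 ?exprn_ge0//.
    exact: ler_wpM2r.
  by rewrite lerXn2r ?nnegrE.
apply: (@le_trans _ _ ((bx * bxs) ^+ n * A * bxs ^+ N)).
  do 2![apply: ler_wpM2r; first by rewrite ?exprn_ge0].
  by rewrite lerXn2r ?nnegrE ?mulr_ge0.
have -> : (bx * bxs) ^+ n * A * bxs ^+ N = (A * bxs ^+ (n + N + 2)) * bx ^+ n * (bxs ^+ 2)^-1.
  by rewrite !exprD exprMn; field; rewrite gt_eqF.
apply: ler_pM => //.
- by rewrite !mulr_ge0 ?exprn_ge0.
- by rewrite invr_ge0 exprn_ge0.
- by apply: ler_wpM2r => //; rewrite exprn_ge0.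
Qed.

(** Since only s >= 0 contributes, [mm x] is at most |x - s|, so the factor (1 + [mm x])^N is
    absorbed by the decay of [hat a (x - s)], and s^n costs [br x ^+ n] and as many powers of
    [br (x - s)]. The exponent n + N + 2 adds two powers for integrability in s. *)
Lemma Ak_bound n N a : test1 a ->
  exists2 K, 0 <= K & forall x, normc (Ak n a x) * (1 + mm x) ^+ N <= K * br x ^+ n.
Proof.
move=> ta; have [K K0 aK] := test1_rdec ta (n + N + 2)%N.
have ma := test1_cm ta.
exists (normc (cn n) * (K * cpi)) => [|x].
  apply: mulr_ge0; first exact: normc_ge0.
  by apply: mulr_ge0 => //; exact: cpi_ge0.
have m1 : 1 <= 1 + mm x by rewrite lerDl mm_ge0.
have mp : 0 < (1 + mm x) ^+ N by rewrite exprn_gt0// (lt_le_trans ltr01).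
have [M _ aM] := Ak_int n x ta.
rewrite /Ak normcM -!mulrA; apply: ler_wpM2l; first exact: normc_ge0.
rewrite -ler_pdivlMr//.
have rg : ri (fun s => K * br x ^+ n / (1 + mm x) ^+ N * wt (x - s)).
  by apply: riZ; exact: ri_wt_sub.
apply: le_trans (Int_norm (ci_wt (Ak_cm1 n x ma) aM) rg _) _; last first.
  rewrite RIntZ; last exact: ri_wt_sub.
  by rewrite RInt_wt_sub /cpi le_eqVlt; apply/orP; left; apply/eqP; field; rewrite gt_eqF.
move=> s; rewrite mulrAC ler_pdivlMr// normcM normc_real.
have [s0|s0] := leP 0 s; last first.
  rewrite (_ : hv s = 0); last by rewrite /hv leNgt s0.
  rewrite mul0r normr0 !mul0r !mulr_ge0 ?brX_ge0 ?wt_ge0//.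
apply: (@est_Ak n N _ (br x) (br (x - s)) (br s)); rewrite ?normc_ge0 ?br_ge0 ?normr_ge0 ?br_gt0//.
- exact: hv_bound.
- exact: br_sub.
- by rewrite addr_ge0// mm_ge0.
- rewrite /br lerD2l /mm ge_max normr_ge0/=; have := ler_norm (- (x - s)).
  rewrite normrN; lra.
- exact: br2_wt.
Qed.

Lemma Int_sub (f : R -> C) w : cm f -> Int (fun x => f (w - x)) = Int f.
Proof.
move=> mf; rewrite -(Int_opp mf) -[RHS](@Int_shift _ (- w)).
  by congr Int; apply/funext => x; congr f; ring.
exact: (cm_comp (@oppr_measurable R setT) mf).
Qed.

(** By inversion, [c] is itself the transform of the reflected [hat c], so [hat_mul_hat] applies. *)
Lemma hat_conv a c w : test1 a -> test1 c ->
  Int (fun x => hat a (w - x) * hat c x) = hat (fun y => a y * c y) w.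
Proof.
move=> ta tc; have mh := cm_hat (test1_cm tc); have rh := test1_rdec tc.
pose k x := hat c (- x).
have mk : cm k by exact: (cm_comp (@oppr_measurable R setT) mh).
have kE : hat k = c.
  apply/funext => y; rewrite -(hat_inv y tc) /hat -[LHS]Int_opp.
    congr Int; apply/funext => x; rewrite /k opprK; congr (_ * _).
    by rewrite /ee; congr expi; ring.
  by apply: cmM => //; exact: cm_ee1.
rewrite -[in RHS]kE (hat_mul_hat w ta mk (rdec_opp rh)) -[RHS]Int_opp.
  by congr Int; apply/funext => x; rewrite /k opprK mulrC.
apply: cmM => //; apply: (cm_comp (g := fun x => w + x) _ (cm_hat (test1_cm ta))).
by apply: measurable_funD; [exact: measurable_cst|exact: measurable_id].
Qed.

Lemma cm_subl (f : R -> C) w : cm f -> cm (fun x => f (w - x)).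
Proof.
move=> mf; apply: (cm_comp (g := fun x => w - x) _ mf).
by apply: measurable_funB; [exact: measurable_cst|exact: measurable_id].
Qed.

Lemma rdec_subl (f : R -> C) w : rdec f -> rdec (fun x => f (w - x)).
Proof.
move=> rf; have -> : (fun x => f (w - x)) = (fun x => (fun t => f (- t)) (x + - w)).
  by apply/funext => x; congr f; ring.
exact: rdec_shift (rdec_opp rf).
Qed.

(** By inversion, x -> [hat a (w - x)] is a rapidly decreasing function with transform [a * ee w].
    Hence by [Un_mul_hat] and [Un_ee] both sides are the pairing of (x + i0)^(-n-1) with a c times
    the same character. *)
Lemma hat_Ak_conv n a c w : test1 a -> test1 c ->
  Int (fun x => hat a (w - x) * Ak n c x) = Ak n (fun y => a y * c y) w.
Proof.
move=> ta tc; have mh := cm_hat (test1_cm ta); have rh := test1_rdec ta.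
have rk := rdec_subl w rh; have mk := cm_subl w mh.
have kE y : hat (fun x => hat a (w - x)) y = a y * ee w y.
  rewrite {1}/hat -[LHS](@Int_sub _ w); last by apply: cmM => //; exact: cm_ee1.
  rewrite -[in RHS](hat_inv y ta) -IntZr.
    congr Int; apply/funext => x; rewrite (_ : w - (w - x) = x); last by ring.
    rewrite eeDr [ee y w]eeC (_ : ee y (- x) = ee x (- y)); first by ring.
    by rewrite /ee; congr expi; ring.
  have m1 : cm (fun x => ee x (- y)) by exact: (cm_comp (pair2_measurable (- y)) cm_ee).
  have [K aK] := rdec_odom rh.
  apply: (@ci_wt _ K); first exact: cmM.
  by move=> x; rewrite normcM normc_ee mul1r.
rewrite -(Un_mul_hat n tc mk rk) -Un_ee.
  by congr (Un n _); apply/funext => y; rewrite kE; ring.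
exact: (test1M ta tc.1).
Qed.

Lemma Int_real (f : R -> R) : Int (fun x => (f x)%:C) = (RInt f)%:C.
Proof.
by rewrite IntE; congr (_ +i* _); rewrite /RInt Rintegral_cst// mul0r.
Qed.

Lemma RInt_hv_pow n q :
  RInt (fun s => hv s * s ^+ n * hv (q - s)) = hv q * q ^+ n.+1 / n.+1%:R.
Proof.
have [q0|q0] := ltP 0 q; last first.
  (* For q <= 0 the integrand can be nonzero only at s = 0. *)
  have -> : (fun s => hv s * s ^+ n * hv (q - s)) = (fun s => (s == 0)%:R * (hv s * s ^+ n * hv (q - s))).
    apply/funext => s; have [->|s0] := eqVneq s 0; first by rewrite mul1r.
    rewrite mul0r /hv; case: (leP 0 s) => [s1|_]; last by rewrite !mul0r.
    by rewrite leNgt (_ : q - s < 0) ?mulr0// subr_lt0 (le_lt_trans q0)// lt_def s0.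
  have -> : hv q * q ^+ n.+1 / n.+1%:R = 0.
    move: q0; rewrite le_eqVlt => /predU1P[->|q0]; first by rewrite expr0n/= mulr0 mul0r.
    by rewrite /hv leNgt q0 !mul0r.
  rewrite (@RInt_supp _ _ 0 0).
    by rewrite set_itv1 Rintegral_set1.
  move=> s s0; have [s1|s1] := eqVneq s 0; last by rewrite mul0r.
  by exfalso; apply: s0; rewrite s1 lexx.
rewrite (@RInt_supp _ _ 0 q).
  have D (x : R) : is_derive x 1 (fun s => n.+1%:R^-1 * s ^+ n.+1) (x ^+ n).
    have dX : is_derive x 1 (fun s : R => s ^+ n.+1) (n.+1%:R * x ^+ n).
      have H := is_deriveX n.+1 (is_derive_id x (1 : R)).
      rewrite exprfctE in H; apply: (is_derive_eq H).
      by rewrite /GRing.scale/= mulr1.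
    apply: (is_derive_eq (is_deriveZ n.+1%:R^-1 dX)).
    by rewrite /GRing.scale/= mulrA mulVf ?mul1r// pnatr_eq0.
  have := RInt_deriv_itv q0 D (@exprn_continuous R n).
  rewrite expr0n /= mulr0 subr0 => E; rewrite (_ : hv q = 1); last by rewrite /hv ltW.
  rewrite mul1r mulrC -E.
  apply: eq_Rintegral => s; rewrite inE/= in_itv/= => /andP[s0 sq].
  by rewrite /hv s0 subr_ge0 sq mul1r mulr1.
move=> s /negP; rewrite negb_and -!ltNge => /orP[s0|s0].
  by rewrite /hv leNgt s0 !mul0r.
by rewrite [hv (q - s)]/hv subr_ge0 leNgt s0 mulr0.
Qed.

(** As [kap] is [cn 0], the factor 1/(n+1) of the beta integral is exactly what turns [cn n * cn 0]
    into [cn n.+1]. *)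
Lemma cnS n : cn n * kap = n.+1%:R * cn n.+1.
Proof.
rewrite /cn -mulrA -exprSr mulrA; congr (_ * _).
rewrite factS natrM invfM rmorphM /= mulrA.
rewrite (_ : n.+1%:R * (n.+1%:R^-1)%:C = 1 :> C) ?mul1r//.
by rewrite -(rmorph_nat (real_complex R)) -rmorphM /= mulfV// pnatr_eq0.
Qed.

(** The integrand is supported in 0 <= s <= q, where every power of s can be traded for a power of
    q. *)
Let hv_hv_bound n m s q :
  `|hv s * s ^+ n * hv (q - s)| * br s ^+ m <= br q ^+ n * br q ^+ m.
Proof.
rewrite normrM [`|hv (q - s)|]ger0_norm ?hv_ge0//.
have [/andP[s0 sq]|] := boolP ((0 <= s) && (s <= q)); last first.
  rewrite negb_and -!ltNge => /orP[s0|s0].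
    by rewrite hv0// mul0r normr0 !mul0r; apply: mulr_ge0; exact: brX_ge0.
  by rewrite [hv (q - s)]hv0 ?subr_lt0// mulr0 !mul0r; apply: mulr_ge0; exact: brX_ge0.
have bsq : br s <= br q by rewrite /br lerD2l !ger0_norm// (le_trans s0).
have bb (N : nat) : br s ^+ N <= br q ^+ N by rewrite lerXn2r ?nnegrE ?br_ge0.
apply: ler_pM => //; last 1 first.
- apply: (@le_trans _ _ (br s ^+ n * 1)); last by rewrite mulr1 bb.
  by apply: ler_pM; [exact: normr_ge0|exact: hv_ge0|exact: hv_bound|exact: hv_le1].
- by apply: mulr_ge0; [exact: normr_ge0|exact: hv_ge0].
- exact: brX_ge0.
Qed.

(** The identity s_+^n * s_+^0 = s_+^(n+1) / (n+1), smeared with [hat b]: after the translation q -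
    s of the inner variable and Fubini, the s-integral is [RInt_hv_pow]. *)
Lemma Ak_beta n b z : test1 b ->
  cn n * Int (fun s => (hv s * s ^+ n)%:C * Ak 0 b (z - s)) = Ak n.+1 b z.
Proof.
move=> tb; have mb := test1_cm tb.
(* n powers for s^n and two for each of the weights in s and q. *)
have [K K0 bK] := test1_rdec tb (n + 4)%N.
pose F s q := (hv s * s ^+ n * hv (q - s))%:C * hat b (z - q).
have mF : cm (fun w : R * R => F w.1 w.2).
  apply: cmM; last first.
    apply: (cm_comp (g := fun w : R * R => z - w.2) _ (cm_hat mb)).
    by apply: measurable_funB; [exact: measurable_cst|exact: measurable_snd].
  apply: cm_real; apply: measurable_funM.
    exact: (measurableT_comp (measurable_hvX n) measurable_fst).
  apply: (measurableT_comp measurable_hv).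
  by apply: measurable_funB; [exact: measurable_snd|exact: measurable_fst].
have FK s q : normc (F s q) <= br z ^+ (n + 4) * K * (wt s * wt q).
  apply: le_wt2; first exact: normc_ge0.
  rewrite /F normcM normc_real.
  apply: (@le_trans _ _ (br q ^+ n * normc (hat b (z - q)) * (br q ^+ 2 * br q ^+ 2))).
    rewrite mulrACA [leRHS]mulrACA.
    apply: ler_wpM2r; last exact: hv_hv_bound.
    by apply: mulr_ge0; [exact: normc_ge0|exact: brX_ge0].
  rewrite (_ : _ * _ = br q ^+ (n + 4) * normc (hat b (z - q))); last by rewrite exprD; ring.
  apply: (@le_trans _ _ ((br z * br (z - q)) ^+ (n + 4) * normc (hat b (z - q)))).
    apply: ler_wpM2r; first exact: normc_ge0.
    by rewrite lerXn2r ?nnegrE ?mulr_ge0 ?br_ge0// br_sub.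
  rewrite exprMn -mulrA; apply: ler_wpM2l; first exact: brX_ge0.
  by rewrite mulrC; exact: bK.
have E s : (hv s * s ^+ n)%:C * Ak 0 b (z - s) = kap * Int (F s).
  have mG : cm (fun q => (hv q)%:C * hat b (z - s - q)).
    have := Ak_cm1 0 (z - s) mb.
    by congr cm; apply/funext => t; rewrite expr0 mulr1.
  rewrite /Ak /cn expr1 fact0 invr1 rmorph1 mul1r mulrCA; congr (_ * _).
  rewrite (_ : (fun t => _) = fun t => (hv t)%:C * hat b (z - s - t)); last first.
    by apply/funext => t; rewrite expr0 mulr1.
  rewrite -(Int_shift (- s) mG) -IntZ.
    congr Int; apply/funext => q; rewrite (_ : z - s - (q - s) = z - q); last by ring.
    by rewrite /F [in RHS]rmorphM/= mulrA.
  have [M _ bM] := Ak_int 0 (z - s) tb.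
  have bM' t : normc ((hv t)%:C * hat b (z - s - t)) <= M * wt t.
    by have := bM t; rewrite expr0 mulr1.
  have ms : measurable_fun setT (fun q : R => q - s).
    by apply: measurable_funB; [exact: measurable_id|exact: measurable_cst].
  have mG' := cm_comp ms mG.
  apply: (ci_dom mG' (g := fun q => M * wt (s - q))).
    by apply: riZ; exact: ri_wt_sub.
  by move=> q; apply: le_trans (bM' _) _; rewrite -[wt (s - q)]wtN opprB.
under eq_fun do rewrite E.
rewrite IntZ; last exact: ci_Int mF FK.
rewrite (Int_swap mF FK) mulrA cnS [n.+1%:R * _]mulrC -mulrA /Ak; congr (_ * _).
have E2 q : Int (fun s => F s q) = n.+1%:R^-1 * ((hv q * q ^+ n.+1)%:C * hat b (z - q)).
  rewrite /F IntZr; last first.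
    apply: (@ci_wt _ (br q ^+ n * br q ^+ 2)).
      apply: cm_real; apply: measurable_funM; first exact: measurable_hvX.
      apply: (measurableT_comp measurable_hv).
      by apply: measurable_funB; [exact: measurable_cst|exact: measurable_id].
    move=> s; apply: le_wt; last by apply: mulr_ge0; exact: brX_ge0.
    by rewrite normc_real; exact: hv_hv_bound.
  rewrite Int_real RInt_hv_pow rmorphM/= fmorphV rmorph_nat; ring.
under eq_fun do rewrite E2.
rewrite IntZ; last by have [M _ bM] := Ak_int n.+1 z tb; exact: ci_wt (Ak_cm1 n.+1 z mb) bM.
by rewrite mulrA mulfV ?mul1r// pnatr_eq0.
Qed.

End Convolution.

(** * The convolution of A_n[a] with A_0[c] *)

Section AkConvolution.
Context {R : realType}.
Local Notation C := R[i].
Implicit Types (a c phi k : R -> C) (e x y s : R).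

(** Here [A], [B], [d], [m] are |hat a (z - x - s)|, |A_0[c](x)|, [br (z - x - s)] and [1 + mm x].
    Both x and s are bounded by their product with [bz], so n + 4 powers pay for s^n and the two
    weights. *)
Let est_conv n (A B bx bs bz d m q K L : R) : 0 <= A -> 0 <= B -> 0 <= bx ->
  0 <= bs -> 0 <= bz -> 0 <= d -> 0 <= m -> 0 <= q -> q <= bs ^+ n -> 1 <= bx ->
  bs <= 2 * (bz * d * m) -> bx <= 2 * (bz * d * m) ->
  A * d ^+ (n + 4) <= K -> B * m ^+ (n + 4) <= L ->
  q * A * B * (bx ^+ 2 * bs ^+ 2) <= (2 * bz) ^+ (n + 4) * K * L.
Proof.
move=> A0 B0 x0 s0 z0 d0 m0 q0 qs bx1 hs hx AK BL.
pose T := 2 * (bz * d * m); have T0 : 0 <= T by rewrite !mulr_ge0.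
apply: (@le_trans _ _ (T ^+ n * A * B * (T ^+ 2 * T ^+ 2))).
  apply: ler_pM; rewrite ?mulr_ge0 ?exprn_ge0//.
    do 2![apply: ler_wpM2r => //]; apply: (le_trans qs).
    by rewrite lerXn2r ?nnegrE.
  by apply: ler_pM; rewrite ?exprn_ge0// lerXn2r ?nnegrE.
have -> : T ^+ n * A * B * (T ^+ 2 * T ^+ 2) = T ^+ (n + 4) * A * B.
  by rewrite exprD; ring.
have -> : T ^+ (n + 4) * A * B = (2 * bz) ^+ (n + 4) * (A * d ^+ (n + 4)) * (B * m ^+ (n + 4)).
  by rewrite /T !exprMn; ring.
apply: ler_pM => //; rewrite ?mulr_ge0 ?exprn_ge0 ?mulr_ge0//.
by apply: ler_wpM2l => //; rewrite exprn_ge0// mulr_ge0.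
Qed.

(** Writing A_n[a](z - x) as its defining integral over s >= 0 and integrating in x first gives
    A_0[a c](z - s) by [hat_Ak_conv]; the remaining integral in s is [Ak_beta]. Fubini holds because
    s has no negative part and A_0[c] absorbs that of x. *)
Lemma Ak_conv n a c z : test1 a -> test1 c ->
  Int (fun x => Ak n a (z - x) * Ak 0 c x) = Ak n.+1 (fun y => a y * c y) z.
Proof.
move=> ta tc; have ma := test1_cm ta; have mc := test1_cm tc.
have tac : test1 (fun y => a y * c y) by exact: test1M ta tc.1.
have [K K0 aK] := test1_rdec ta (n + 4)%N.
have [L L0 cL] := Ak_bound 0 (n + 4) tc.
pose F x s := (hv s * s ^+ n)%:C * hat a (z - x - s) * Ak 0 c x.
have mF : cm (fun w : R * R => F w.1 w.2).
  apply: cmM; last exact: (cm_comp measurable_fst (cm_Ak 0 mc)).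
  apply: cmM.
    by apply: cm_real; exact: (measurableT_comp (measurable_hvX n) measurable_snd).
  apply: (cm_comp (g := fun w : R * R => z - w.1 - w.2) _ (cm_hat ma)).
  apply: measurable_funB; last exact: measurable_snd.
  by apply: measurable_funB; [exact: measurable_cst|exact: measurable_fst].
have FK x s : normc (F x s) <= (2 * br z) ^+ (n + 4) * K * L * (wt x * wt s).
  apply: le_wt2; first exact: normc_ge0.
  rewrite /F 2!normcM normc_real.
  have [s0|s0] := leP 0 s; last first.
    rewrite hv0// mul0r normr0 !mul0r; apply: mulr_ge0 => //; apply: mulr_ge0 => //.
    by apply: exprn_ge0; apply: mulr_ge0 => //; exact: br_ge0.
  have m0 : 0 <= 1 + mm x by rewrite addr_ge0// mm_ge0.
  have key : br (x + s) <= br z * br (z - x - s).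
    by have := br_sub z (x + s); rewrite opprD addrA.
  have h1 := br_mm x s; have h2 := br_mm s x; rewrite (mm_pos s0) addr0 mulr1 in h1.
  rewrite (mm_pos s0) addr0 mul1r [s + x]addrC in h2.
  have H y : y <= 2 * (br (x + s) * (1 + mm x)) ->
     y <= 2 * (br z * br (z - x - s) * (1 + mm x)).
    by move=> /le_trans; apply; rewrite ler_wpM2l// ler_wpM2r.
  apply: (@est_conv n _ _ _ _ (br z) (br (z - x - s)) (1 + mm x));
    rewrite ?normc_ge0 ?br_ge0 ?normr_ge0//.
  - exact: hv_bound.
  - exact: br_ge1.
  - exact: H.
  - exact: H.
  - by have := cL x; rewrite expr0 mulr1.
have E x : Ak n a (z - x) * Ak 0 c x = cn n * Int (F x).
  have [M _ aM] := Ak_int n (z - x) ta.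
  by rewrite {1}/Ak -mulrA -IntZr//; exact: ci_wt (Ak_cm1 n (z - x) ma) aM.
under eq_fun do rewrite E.
rewrite IntZ; last exact: ci_Int mF FK.
rewrite (Int_swap mF FK) -Ak_beta//; congr (_ * _); congr Int; apply/funext => s.
rewrite -hat_Ak_conv//= -IntZ.
  by congr Int; apply/funext => x; rewrite /F mulrA (_ : z - x - s = z - s - x)//; ring.
have [M1 a1] := rdec_odom (rdec_subl (z - s) (test1_rdec ta)).
have [M2 M20 c2] := Ak_bound 0 0 tc.
apply: (@ci_wt _ (M1 * M2)).
  by apply: cmM; [exact: cm_subl (cm_hat ma)|exact: cm_Ak].
move=> x; rewrite normcM mulrAC; apply: ler_pM; rewrite ?normc_ge0//.
by have := c2 x; rewrite !expr0 !mulr1.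
Qed.

End AkConvolution.

Ltac mst := repeat first
  [ exact: measurable_id | exact: measurable_fst | exact: measurable_snd
  | exact: measurable_cst
  | apply: measurable_fun_pair | apply: measurable_funD | apply: measurable_funB
  | apply: measurable_funN | apply: measurable_funM
  | apply: (measurableT_comp measurable_fst)
  | apply: (measurableT_comp measurable_snd) ].

Opaque Int.

(** * Correlations in the plane *)

Section Plane.
Context {R : realType}.
Local Notation C := R[i].
Implicit Types (a b c phi : R -> C) (k f g : R -> R -> C) (e x y s : R).

Lemma eq_Int (f g : R -> C) : f =1 g -> Int f = Int g.
Proof. by move=> /funext ->. Qed.

Definition cm2 k := cm (fun w : R * R => k w.1 w.2).
Definition dom2 (K : R) k := forall x y, normc (k x y) <= K * (wt x * wt y).
Definition Int2 k := Int (fun x => Int (k x)).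

Lemma dom2_ge0 K k : dom2 K k -> 0 <= K.
Proof.
move=> /(_ 0 0); rewrite /wt /oneDsqr expr0n /= addr0 invr1 !mulr1.
by apply: le_trans; exact: normc_ge0.
Qed.

Lemma cm2_row k x : cm2 k -> cm (k x).
Proof. by move=> mk; exact: (cm_comp (pair1_measurable x) mk). Qed.

Lemma dom2_ci K k x : cm2 k -> dom2 K k -> ci (k x).
Proof.
move=> mk kK; apply: (@ci_wt _ (K * wt x)); first exact: cm2_row.
by move=> y; rewrite -mulrA; exact: kK.
Qed.

Lemma Int2_bound K k : cm2 k -> dom2 K k -> normc (Int2 k) <= K * cpi * cpi.
Proof.
move=> mk kK; apply: Int_wt; first exact: cm_Int.
by move=> x; exact: Int_wt1.
Qed.

Lemma Int2Z K (z : C) k : cm2 k -> dom2 K k -> Int2 (fun x y => z * k x y) = z * Int2 k.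
Proof.
move=> mk kK; rewrite /Int2.
under eq_fun do rewrite (IntZ _ (dom2_ci _ mk kK)).
by rewrite IntZ//; exact: ci_Int mk kK.
Qed.

Lemma Int2D K L f k : cm2 f -> cm2 k -> dom2 K f -> dom2 L k ->
  Int2 (fun x y => f x y + k x y) = Int2 f + Int2 k.
Proof.
move=> mf mk fK kL; rewrite /Int2.
under eq_fun do rewrite (IntD (dom2_ci _ mf fK) (dom2_ci _ mk kL)).
by rewrite IntD//; [exact: ci_Int mf fK|exact: ci_Int mk kL].
Qed.

Lemma Int2_dct K (F : nat -> R -> R -> C) f : (forall n, cm2 (F n)) ->
  (forall n, dom2 K (F n)) -> (forall x y, ccvg (fun n => F n x y) (f x y)) ->
  ccvg (fun n => Int2 (F n)) (Int2 f).
Proof.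
move=> mF FK Ff; apply: (Int_dct (g := fun x => K * cpi * wt x)).
- by move=> n; exact: cm_Int (mF n).
- by apply: riZ; exact: ri_wt.
- by move=> n x; exact: Int_wt1 (mF n) (FK n).
move=> x; apply: (Int_dct (g := fun y => K * wt x * wt y)) => //.
- by move=> n; exact: cm2_row (mF n).
- by apply: riZ; exact: ri_wt.
- by move=> n y; rewrite -mulrA; exact: FK.
Qed.

(** x' is moved past z and z', then x past z and z', one [Int_swap] at a time; each partial integral
    inherits a product bound in its two active variables. *)
Lemma Int4_swap K (Q : R -> R -> R -> R -> C) :
  cm (fun w : R * R * R * R => Q w.1.1.1 w.1.1.2 w.1.2 w.2) ->
  (forall x x' z z', normc (Q x x' z z') <= K * (wt x * wt x' * (wt z * wt z'))) ->
  Int2 (fun x x' => Int2 (Q x x')) =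
  Int2 (fun z z' => Int2 (fun x x' => Q x x' z z')).
Proof.
move=> mQ QK.
have K0 : 0 <= K.
  have := QK 0 0 0 0; rewrite /wt /oneDsqr expr0n /= addr0 invr1 !mulr1.
  by apply: le_trans; exact: normc_ge0.
have W (x x' z z' : R) : K * (wt x * wt x' * (wt z * wt z')) =
   K * wt x * (wt x' * (wt z * wt z')) by ring.
rewrite /Int2.
transitivity (Int (fun x : R => Int (fun z : R => Int (fun x' : R => Int (Q x x' z))))).
  apply: eq_Int => x; apply: (@Int_swap _ (fun x' z => Int (Q x x' z)) (K * wt x * cpi)).
    apply: cm_Int; apply: (cm_comp (g := fun w : R * R * R => (x, w.1.1, w.1.2, w.2)) _ mQ).
    mst.
  move=> x' z; apply: (@le_trans _ _ ((K * wt x * (wt x' * wt z)) * cpi)); last by rewrite mulrAC.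
  apply: Int_wt.
    apply: (cm_comp (g := fun w : R => (x, x', z, w)) _ mQ); mst.
  by move=> z'; apply: le_trans (QK _ _ _ _) _; rewrite W !mulrA.
transitivity (Int (fun x : R => Int (fun z : R => Int (fun z' : R =>
   Int (fun x' : R => Q x x' z z'))))).
  apply: eq_Int => x; apply: eq_Int => z; apply: (@Int_swap _ (fun x' z' => Q x x' z z') (K * wt x * wt z)).
    apply: (cm_comp (g := fun w : R * R => (x, w.1, z, w.2)) _ mQ); mst.
  move=> x' z'; apply: le_trans (QK _ _ _ _) _.
  by rewrite le_eqVlt; apply/orP; left; apply/eqP; ring.
transitivity (Int (fun z : R => Int (fun x : R => Int (fun z' : R =>
   Int (fun x' : R => Q x x' z z'))))); last first.
  apply: eq_Int => z; apply: (@Int_swap _ (fun x z' => Int (fun x' : R => Q x x' z z')) (K * wt z * cpi)).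
    apply: cm_Int; apply: (cm_comp (g := fun w : R * R * R => (w.1.1, w.2, z, w.1.2)) _ mQ).
    mst.
  move=> x z'; apply: (@le_trans _ _ ((K * wt z * (wt x * wt z')) * cpi)); last by rewrite mulrAC.
  apply: Int_wt.
    apply: (cm_comp (g := fun w : R => (x, w, z, z')) _ mQ); mst.
  move=> x'; apply: le_trans (QK _ _ _ _) _.
  by rewrite le_eqVlt; apply/orP; left; apply/eqP; ring.
apply: (@Int_swap _ (fun x z => Int (fun z' : R => Int (fun x' : R => Q x x' z z'))) (K * cpi * cpi)).
  apply: cm_Int; apply: cm_Int.
  apply: (cm_comp (g := fun w : R * R * R * R => (w.1.1.1, w.2, w.1.1.2, w.1.2)) _ mQ); mst.
move=> x z.
  have := @Int2_bound (K * (wt x * wt z)) (fun z' x' => Q x x' z z') _ _.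
  rewrite /Int2 => H; apply: le_trans (H _ _) _.
  + apply: (cm_comp (g := fun w : R * R => (x, w.2, z, w.1)) _ mQ); mst.
  + move=> z' x'; apply: le_trans (QK _ _ _ _) _.
    by rewrite le_eqVlt; apply/orP; left; apply/eqP; ring.
  + by rewrite le_eqVlt; apply/orP; left; apply/eqP; ring.
Qed.

Definition rd2 k := cm2 k /\ forall N, exists2 K : R, 0 <= K &
  forall x y, normc (k x y) * (br x ^+ N * br y ^+ N) <= K.

(* [TT n a b k] is the pairing of a (x + i0)^(-n-1) (x) b with the Fourier
   transform of [k], computed on the Fourier side. *)
Definition kerT n a b k := fun x y => k x y * (Ak n a x * hat b y).
Definition TT n a b k := Int2 (kerT n a b k).

Lemma cm2_kerT n a b k : test1 a -> test1 b -> cm2 k -> cm2 (kerT n a b k).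
Proof.
move=> ta tb mk; apply: cmM => //; apply: cmM.
  exact: (cm_comp measurable_fst (cm_Ak n (test1_cm ta))).
exact: (cm_comp measurable_snd (cm_hat (test1_cm tb))).
Qed.

(** Linear in [M], so that it serves as a continuity estimate for the localized transforms. The n +
    2 powers of x pay for the growth of A_n[a] and for the weight. *)
Lemma TT_dom n a b : test1 a -> test1 b -> exists2 K : R, 0 <= K & forall k M,
  (forall x y, normc (k x y) * (br x ^+ (n + 2) * br y ^+ 2) <= M) ->
  dom2 (M * K) (kerT n a b k).
Proof.
move=> ta tb; have [KA KA0 aK] := Ak_bound n 0 ta; have [KB KB0 bK] := test1_rdec tb 0%N.
exists (KA * KB) => [|k M kM x y]; first exact: mulr_ge0.
apply: le_wt2; first exact: normc_ge0.
rewrite /kerT normcM [normc (Ak n a x * _)]normcM.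
have h1 : normc (Ak n a x) <= KA * br x ^+ n by have := aK x; rewrite expr0 mulr1.
have h2 : normc (hat b y) <= KB by have := bK y; rewrite expr0 mulr1.
apply: (@le_trans _ _ (normc (k x y) * (KA * br x ^+ n * KB) * (br x ^+ 2 * br y ^+ 2))).
  apply: ler_wpM2r; first by rewrite mulr_ge0 ?brX_ge0.
  apply: ler_wpM2l; first exact: normc_ge0.
  by apply: ler_pM; rewrite ?normc_ge0.
rewrite (_ : _ * _ = normc (k x y) * (br x ^+ (n + 2) * br y ^+ 2) * (KA * KB)).
  by apply: ler_wpM2r; [exact: mulr_ge0|exact: kM].
by rewrite exprD; ring.
Qed.

Lemma rd2_bound N M k : rd2 k -> exists2 K : R, 0 <= K &
  forall x y, normc (k x y) * (br x ^+ N * br y ^+ M) <= K.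
Proof.
move=> [_ rk]; have [K K0 kK] := rk (N + M)%N; exists K => // x y.
apply: le_trans (kK x y); apply: ler_wpM2l; first exact: normc_ge0.
apply: ler_pM; rewrite ?brX_ge0// ler_weXn2l ?br_ge1 ?leq_addr ?leq_addl//.
Qed.

Lemma rd2_kerT n a b k : test1 a -> test1 b -> rd2 k -> exists K, dom2 K (kerT n a b k).
Proof.
move=> ta tb rk; have [M _ kM] := rd2_bound (n + 2) 2 rk.
by have [K K0 H] := TT_dom n ta tb; exists (M * K); exact: H.
Qed.

Lemma rd2_dom k : rd2 k -> exists K, dom2 K k.
Proof.
move=> rk; have [M M0 kM] := rd2_bound 2 2 rk; exists M => x y.
by apply: le_wt2; [exact: normc_ge0|exact: kM].
Qed.

Lemma rd2_shift k x y : rd2 k -> rd2 (fun s t => k (x + s) (y + t)).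
Proof.
move=> [mk rk]; split.
  apply: (cm_comp (g := fun w : R * R => (x + w.1, y + w.2)) _ mk); mst.
move=> N; have [K K0 kK] := rk N; exists (br x ^+ N * br y ^+ N * K) => [|s t].
  by rewrite mulr_ge0// mulr_ge0 ?brX_ge0.
have h (u v : R) : br v ^+ N <= br u ^+ N * br (u + v) ^+ N.
  rewrite -exprMn lerXn2r ?nnegrE ?mulr_ge0 ?br_ge0//.
  by have := br_sub u (- v); rewrite brN opprK.
apply: (@le_trans _ _ (normc (k (x + s) (y + t)) *
    (br x ^+ N * br (x + s) ^+ N * (br y ^+ N * br (y + t) ^+ N)))).
  apply: ler_wpM2l; first exact: normc_ge0.
  by apply: ler_pM; rewrite ?brX_ge0.
have := kK (x + s) (y + t).
move: (normc (k (x + s) (y + t))) (br x ^+ N) (br y ^+ N) (br (x + s) ^+ N) (br (y + t) ^+ N)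
  (brX_ge0 x N) (brX_ge0 y N) => A p q r u p0 q0 hA.
rewrite (_ : A * _ = p * q * (A * (r * u))); last by ring.
by apply: ler_wpM2l => //; exact: mulr_ge0.
Qed.

Section HatPlane.
Variables (a b : R -> C) (k : R -> R -> C).
Hypotheses (ta : test1 a) (tb : test1 b) (rk : rd2 k).

Definition hat2 x y := Int2 (fun s t => ee x s * ee y t * k s t).
(** Integrating out the second frequency against [hat b] leaves a rapidly decreasing function of one
    variable, which reduces [Un_mul_hat2] to [Un_mul_hat]. *)
Definition krow s := Int (fun t => k s t * hat b t).

Lemma krow_rdec : cm krow /\ rdec krow.
Proof.
have mk := rk.1; have mh := cm_hat (test1_cm tb).
have [L L0 bL] := test1_rdec tb 0%N.
split.
  by apply: cm_Int; apply: cmM => //; exact: (cm_comp measurable_snd mh).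
move=> N; have [K K0 kK] := rd2_bound N 2 rk.
exists (K * L * cpi) => [|s].
  by apply: mulr_ge0; [exact: mulr_ge0|exact: cpi_ge0].
rewrite -ler_pdivlMr ?exprn_gt0 ?br_gt0// mulrAC; apply: Int_wt.
  by apply: cmM => //; exact: cm2_row.
move=> t; apply: le_wt; last by rewrite divr_ge0 ?brX_ge0//; exact: mulr_ge0.
rewrite ler_pdivlMr ?exprn_gt0 ?br_gt0// normcM.
have h2 : normc (hat b t) <= L by have := bL t; rewrite expr0 mulr1.
have h1 := kK s t; have A0 := normc_ge0 (k s t); have B0 := normc_ge0 (hat b t).
move: (normc (k s t)) (normc (hat b t)) A0 B0 h1 h2 => A B A0 B0 h1 h2.
have -> : A * B * br t ^+ 2 * br s ^+ N = A * (br s ^+ N * br t ^+ 2) * B by ring.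
apply: ler_pM => //; apply: mulr_ge0 => //; apply: mulr_ge0; exact: brX_ge0.
Qed.

Lemma Int_hat2 x : Int (fun y => b y * hat2 x y) = hat krow x.
Proof.
have mk := rk.1; have mb := test1_cm tb.
have [K kK] := rd2_dom rk; have [L bL] := test1_odom tb.
have K0 := dom2_ge0 kK; have L0 := odom_ge0 bL.
pose F y s := b y * Int (fun t => ee x s * ee y t * k s t).
have bnd y s t : normc (ee x s * ee y t * k s t) <= K * (wt s * wt t).
  by rewrite !normcM !normc_ee !mul1r.
have mQ : cm (fun w : R * R * R => ee x w.1.2 * ee w.1.1 w.2 * k w.1.2 w.2).
  apply: cmM; last by apply: (cm_comp (g := fun w : R * R * R => (w.1.2, w.2)) _ mk); mst.
  apply: cmM.
    by apply: (cm_comp (g := fun w : R * R * R => (x, w.1.2)) _ cm_ee); mst.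
  by apply: (cm_comp (g := fun w : R * R * R => (w.1.1, w.2)) _ cm_ee); mst.
have mF : cm (fun w : R * R => F w.1 w.2).
  by apply: cmM; [exact: (cm_comp measurable_fst mb)|exact: cm_Int].
have mr y s : cm (fun t => ee x s * ee y t * k s t).
  by apply: (cm_comp (g := fun t : R => (y, s, t)) _ mQ); mst.
have FK y s : normc (F y s) <= L * (K * cpi) * (wt y * wt s).
  rewrite normcM (_ : L * _ * _ = L * wt y * (K * wt s * cpi)); last by ring.
  apply: ler_pM; rewrite ?normc_ge0//; apply: Int_wt => // t.
  by rewrite -[leRHS]mulrA; exact: bnd.
have -> : (fun y => b y * hat2 x y) = (fun y => Int (F y)).
  apply/funext => y; rewrite /F IntZ//.
  apply: (@ci_Int _ (fun s t => ee x s * ee y t * k s t) K); last exact: bnd.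
  by apply: (cm_comp (g := fun w : R * R => (y, w.1, w.2)) _ mQ); mst.
rewrite (Int_swap mF FK); congr Int; apply/funext => s.
rewrite /F /krow.
have -> : (fun y => b y * Int (fun t => ee x s * ee y t * k s t)) =
  (fun y => Int (fun t => b y * (ee x s * ee y t * k s t))).
  apply/funext => y; rewrite IntZ//; apply: (@ci_wt _ (K * wt s)) => // t.
  by rewrite -[leRHS]mulrA; exact: bnd.
rewrite (@Int_swap _ _ (L * (K * wt s))).
- have -> : (fun t => Int (fun y => b y * (ee x s * ee y t * k s t))) =
     (fun t => ee x s * (k s t * hat b t)).
    apply/funext => t; rewrite mulrA /hat -IntZ; last by apply: ci_ee; [exact: test1_ci|].
    by congr Int; apply/funext => y; rewrite [ee t y]eeC; ring.
  rewrite IntZ//; apply: (@ci_wt _ (K * wt s * (L * cpi))).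
    by apply: cmM; [exact: cm2_row|apply: cm_hat].
  move=> t; rewrite normcM mulrAC; apply: ler_pM; rewrite ?normc_ge0//.
    by rewrite -mulrA; exact: kK.
  exact: hat_bound.
- apply: cmM; first exact: (cm_comp measurable_fst mb).
  by apply: (cm_comp (g := fun w : R * R => (w.1, s, w.2)) _ mQ); mst.
- move=> y t; rewrite normcM (_ : L * _ * _ = L * wt y * (K * (wt s * wt t))); last by ring.
  by apply: ler_pM; rewrite ?normc_ge0.
Qed.

Lemma Un_mul_hat2 n :
  Un n (fun x => a x * Int (fun y => b y * hat2 x y)) = TT n a b k.
Proof.
have [mk rk1] := krow_rdec.
under eq_fun do rewrite Int_hat2.
rewrite Un_mul_hat// /TT /Int2 /kerT; congr Int; apply/funext => s.
rewrite /krow -IntZr; first by congr Int; apply/funext => t; ring.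
have [L L0 bL] := test1_rdec tb 0%N; have [K kK] := rd2_dom rk.
apply: (@ci_wt _ (K * wt s * L)).
  by apply: cmM; [exact: cm2_row rk.1|apply: cm_hat; exact: test1_cm].
move=> t; rewrite normcM mulrAC; apply: ler_pM; rewrite ?normc_ge0//.
  by rewrite -mulrA; exact: kK.
by have := bL t; rewrite expr0 mulr1.
Qed.

End HatPlane.

End Plane.

(** * Correlation of a rapidly decreasing function with a localized power *)

Section Correlation.
Context {R : realType}.
Local Notation C := R[i].
Implicit Types (e x y s : R).

Lemma le_of_eq (x y : R) : x = y -> x <= y.
Proof. by move=> ->. Qed.

(** Unprimed letters belong to the first coordinate, where A_n grows at +oo, primed ones to the
    second, where [hat b] decreases on both sides. The powers of [q] = 1 + [mm y1] are paid by the
    decay of A_n at -oo; those of [p] = 1 + [mm x1] remain in the bound. *)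
Let est_g n (F A B X Y Z p q X' Y' Z' K1 K2 K3 : R) :
  0 <= F -> 0 <= A -> 0 <= B -> 0 <= X -> 0 <= Y -> 0 <= Z -> 0 <= p -> 0 < q ->
  0 <= X' -> 0 <= Y' -> 0 <= Z' -> 0 <= K2 ->
  F * (Z ^+ (n + 6) * Z' ^+ 4) <= K1 -> A * q ^+ (n + 4) <= K2 * Y ^+ n ->
  B * Y' ^+ 4 <= K3 -> X <= 2 * (Z * (p * q)) -> Y <= 2 * (Z * (p * q)) ->
  X' <= Z' * Y' ->
  F * (A * B) * (X ^+ 2 * Y ^+ 2 * Z ^+ 2 * (X' ^+ 2 * Y' ^+ 2 * Z' ^+ 2)) <=
  2 ^+ (n + 4) * K1 * K2 * K3 * p ^+ (n + 4).
Proof.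
move=> F0 A0 B0 X0 Y0 Z0 p0 q0 X'0 Y'0 Z'0 K20 HF HA HB HX HY HX'.
pose T := 2 * (Z * (p * q)).
have qq0 : 0 < q ^+ (n + 4) by exact: exprn_gt0.
have T0 : 0 <= T by rewrite !mulr_ge0// ltW.
have hA : A * (X ^+ 2 * Y ^+ 2) <= K2 * (2 * (Z * p)) ^+ (n + 4).
  rewrite -(ler_pM2r qq0).
  apply: (@le_trans _ _ ((K2 * Y ^+ n) * (X ^+ 2 * Y ^+ 2))).
    rewrite mulrAC; apply: ler_wpM2r => //.
    by apply: mulr_ge0; exact: exprn_ge0.
  apply: (@le_trans _ _ ((K2 * T ^+ n) * (T ^+ 2 * T ^+ 2))).
    have h m (u : R) : 0 <= u -> u <= T -> u ^+ m <= T ^+ m by move=> *; rewrite lerXn2r ?nnegrE.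
    apply: ler_pM.
    - by apply: mulr_ge0 => //; exact: exprn_ge0.
    - by apply: mulr_ge0; exact: exprn_ge0.
    - by apply: ler_wpM2l => //; exact: h.
    - by apply: ler_pM; rewrite ?exprn_ge0// h.
  by apply: le_of_eq; rewrite /T !exprMn !exprD; ring.
have hB : X' ^+ 2 * Y' ^+ 2 * Z' ^+ 2 <= Z' ^+ 4 * Y' ^+ 4.
  apply: (@le_trans _ _ ((Z' * Y') ^+ 2 * Y' ^+ 2 * Z' ^+ 2)).
    do 2![apply: ler_wpM2r; first exact: exprn_ge0].
    by rewrite lerXn2r ?nnegrE ?mulr_ge0.
  by apply: le_of_eq; ring.
have ZZ : 0 <= (2 * (Z * p)) ^+ (n + 4) by rewrite exprn_ge0// !mulr_ge0.
apply: (@le_trans _ _ (F * B * Z ^+ 2 * ((K2 * (2 * (Z * p)) ^+ (n + 4)) * (Z' ^+ 4 * Y' ^+ 4)))).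
  rewrite (_ : _ * _ = F * B * Z ^+ 2 * ((A * (X ^+ 2 * Y ^+ 2)) * (X' ^+ 2 * Y' ^+ 2 * Z' ^+ 2))); last by ring.
  apply: ler_wpM2l; first by apply: mulr_ge0; [exact: mulr_ge0|exact: exprn_ge0].
  apply: ler_pM => //; first by apply: mulr_ge0 => //; apply: mulr_ge0; exact: exprn_ge0.
  by do 2?[apply: mulr_ge0; last exact: exprn_ge0]; exact: exprn_ge0.
rewrite (_ : _ * _ = 2 ^+ (n + 4) * (F * (Z ^+ (n + 6) * Z' ^+ 4)) * K2 * (B * Y' ^+ 4) * p ^+ (n + 4)); last first.
  by rewrite !exprMn !exprD; ring.
have P0 : 0 <= F * (Z ^+ (n + 6) * Z' ^+ 4) by rewrite !mulr_ge0 ?exprn_ge0.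
have P1 : 0 <= B * Y' ^+ 4 by rewrite !mulr_ge0 ?exprn_ge0.
have P2 : 0 <= 2 ^+ (n + 4) :> R by exact: exprn_ge0.
apply: ler_wpM2r; first exact: exprn_ge0.
apply: ler_pM => //; first by do 2?[apply: mulr_ge0 => //].
by apply: ler_wpM2r => //; apply: ler_wpM2l.
Qed.

Let est_c n (A B X Z Y p q K L : R) :
  0 <= A -> 0 <= B -> 0 <= X -> 0 <= Z -> 0 <= Y -> 0 <= K -> 0 <= L ->
  B * p ^+ (n + 2) <= L -> A * q ^+ (n + 2) <= K * Y ^+ n ->
  Y <= 2 * (Z * (q * p)) -> X <= 2 * (Z * (p * q)) -> 0 < p -> 0 < q ->
  A * B * X ^+ 2 <= K * L * (2 * Z) ^+ (n + 2).
Proof.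
move=> A0 B0 X0 Z0 Y0 K0 L0 hB hA hY hX p0 q0.
have P0 : 0 < (p * q) ^+ (n + 2) by rewrite exprn_gt0// mulr_gt0.
rewrite -(ler_pM2r P0).
have T0 : 0 <= 2 * (Z * (p * q)) by rewrite !mulr_ge0// ltW.
have hY' : Y <= 2 * (Z * (p * q)) by rewrite [p * q]mulrC.
have h m (u : R) : 0 <= u -> u <= 2 * (Z * (p * q)) -> u ^+ m <= (2 * (Z * (p * q))) ^+ m.
  by move=> *; rewrite lerXn2r ?nnegrE.
apply: (@le_trans _ _ ((A * q ^+ (n + 2)) * (B * p ^+ (n + 2)) * X ^+ 2)).
  by apply: le_of_eq; rewrite exprMn; ring.
apply: (@le_trans _ _ ((K * Y ^+ n) * L * X ^+ 2)).
  apply: ler_wpM2r; first exact: exprn_ge0.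
  by apply: ler_pM => //; apply: mulr_ge0 => //; apply: exprn_ge0; exact: ltW.
apply: (@le_trans _ _ (K * L * ((2 * (Z * (p * q))) ^+ n * (2 * (Z * (p * q))) ^+ 2))).
  apply: (@le_trans _ _ (K * L * (Y ^+ n * X ^+ 2))); first by apply: le_of_eq; ring.
  apply: ler_wpM2l; first exact: mulr_ge0.
  by apply: ler_pM; rewrite ?exprn_ge0// h.
by apply: le_of_eq; rewrite -exprD [2 * (Z * _)]mulrA [(2 * Z * _) ^+ _]exprMn; ring.
Qed.

Section Fixed.
Variables (n : nat) (a b : R -> C) (f : R -> R -> C).
Hypotheses (ta : test1 a) (tb : test1 b) (rf : rd2 f).

(* The function f * S^ of the definition of the S'-convolution, where S is the
   Fourier transform of a (x + i0)^(-n-1) (x) b. *)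
Definition corr x y := TT n a b (fun s t => f (x + s) (y + t)).

Let wt6 x1 y1 x2 y2 :=
  wt x1 * wt y1 * wt (x1 + y1) * (wt x2 * wt y2 * wt (x2 + y2)).

(** Weights are kept in each coordinate for both variables and for their sum: the correlation is
    integrated in the shift, but [TT_corr] integrates in the sum after a change of variables. Of the
    n + 6 powers of the sum, n + 4 control x1 and y1 and two give its own weight. *)
Lemma kerT_shift_bound : exists2 K : R, 0 <= K & forall x1 y1 x2 y2,
  normc (kerT n a b (fun s t => f (x1 + s) (x2 + t)) y1 y2) <=
  K * (1 + mm x1) ^+ (n + 4) * wt6 x1 y1 x2 y2.
Proof.
have [K1 K10 fK] := rd2_bound (n + 6) 4 rf.
have [K2 K20 aK] := Ak_bound n (n + 4) ta.
have [K3 K30 bK] := test1_rdec tb 4%N.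
pose M : R := 2 ^+ (n + 4) * K1 * K2 * K3.
have M0 : 0 <= M by do 3![apply: mulr_ge0 => //]; exact: exprn_ge0.
exists M => // x1 y1 x2 y2.
have p0 : 0 <= 1 + mm x1 by rewrite addr_ge0// mm_ge0.
have q0 : 0 < 1 + mm y1 by rewrite (lt_le_trans ltr01)// lerDl mm_ge0.
have := @est_g n (normc (f (x1 + y1) (x2 + y2))) (normc (Ak n a y1)) (normc (hat b y2))
  (br x1) (br y1) (br (x1 + y1)) (1 + mm x1) (1 + mm y1) (br x2) (br y2) (br (x2 + y2))
  K1 K2 K3 (normc_ge0 _) (normc_ge0 _) (normc_ge0 _) (br_ge0 _) (br_ge0 _) (br_ge0 _)
  p0 q0 (br_ge0 _) (br_ge0 _) (br_ge0 _) K20 (fK _ _) (aK _) (bK _) (br_mm _ _).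
have h1 := br_mm y1 x1; rewrite [y1 + x1]addrC [(1 + mm y1) * _]mulrC in h1.
have h2 := br_sub (- y2) x2; rewrite brN in h2.
have {}h2 : br x2 <= br (x2 + y2) * br y2.
  by move: h2; rewrite (_ : - y2 - x2 = - (x2 + y2)); [rewrite brN mulrC|ring].
move=> /(_ h1 h2); rewrite -/M.
have kE : normc (kerT n a b (fun s t => f (x1 + s) (x2 + t)) y1 y2) =
    normc (f (x1 + y1) (x2 + y2)) * (normc (Ak n a y1) * normc (hat b y2)).
  by rewrite /kerT /= !normcM.
rewrite -{}kE; move: (normc (kerT _ _ _ _ _ _)) => v hv.
have Mp : 0 <= M * (1 + mm x1) ^+ (n + 4) by rewrite mulr_ge0 ?exprn_ge0.
rewrite /wt6 (_ : _ * _ = M * (1 + mm x1) ^+ (n + 4) * wt x1 * wt y1 * wt (x1 + y1) * wt x2 * wt y2 * wt (x2 + y2)); last by ring.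
have w0 := @wt_ge0 R.
do 6![apply: le_wt; last by do ?[apply: mulr_ge0 => //]; exact: exprn_ge0].
by apply: le_trans hv; apply: le_of_eq; ring.
Qed.

Lemma cm2_corr : cm2 corr.
Proof.
have [mf _] := rf; apply: cm_Int; apply: cm_Int.
apply: cmM.
  by apply: (cm_comp (g := fun w : R * R * R * R => (w.1.1.1 + w.1.2, w.1.1.2 + w.2)) _ mf); mst.
apply: cmM.
  by apply: (cm_comp (g := fun w : R * R * R * R => w.1.2) _ (cm_Ak n (test1_cm ta))); mst.
by apply: (cm_comp (g := fun w : R * R * R * R => w.2) _ (cm_hat (test1_cm tb))); mst.
Qed.

Lemma corr_bound : exists2 K : R, 0 <= K & forall x y,
  normc (corr x y) <= K * (1 + mm x) ^+ (n + 4) * (wt x * wt y).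
Proof.
have [K K0 hK] := kerT_shift_bound; exists (K * cpi * cpi).
  by apply: mulr_ge0; [apply: mulr_ge0 => //|]; exact: cpi_ge0.
move=> x y; have p0 : 0 <= 1 + mm x by rewrite addr_ge0// mm_ge0.
have H : dom2 (K * (1 + mm x) ^+ (n + 4) * (wt x * wt y)) (kerT n a b (fun s t => f (x + s) (y + t))).
  move=> s t; apply: le_trans (hK x s y t) _; rewrite -mulrA.
  rewrite -[leRHS]mulrA -[leRHS]mulrA.
  apply: ler_wpM2l; first by [].
  apply: ler_wpM2l; first exact: exprn_ge0.
  rewrite /wt6; have := wt_le1 (x + s); have := wt_le1 (y + t).
  have := wt_ge0 (x + s); have := wt_ge0 (y + t); have := @wt_ge0 R => w0.
  move: (wt (x + s)) (wt (y + t)) => u v v0 u0 v1 u1.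
  rewrite (_ : _ * _ = wt x * wt y * (wt s * wt t) * (u * v)); last by ring.
  apply: ler_piMr; first by do 3?[apply: mulr_ge0 => //].
  by rewrite -[1]mulr1; apply: ler_pM.
apply: le_trans (Int2_bound _ H) _; last by apply: le_of_eq; ring.
by apply: cm2_kerT => //; exact: (rd2_shift x y rf).1.
Qed.

(** The growth of the correlation towards -oo meets the rapid decrease of A_0[a] there. This
    integrability is the existence of the S'-convolution. *)
Lemma corr_dom : exists K, dom2 K (kerT 0 a b corr).
Proof.
have [K K0 hK] := corr_bound; have [L L0 aL] := Ak_bound 0 (n + 4) ta.
have [M M0 bM] := test1_rdec tb 0%N.
exists (K * L * M) => x y; have p0 : 0 <= 1 + mm x by rewrite addr_ge0// mm_ge0.
have := hK x y; have := aL x; have := bM y.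
rewrite /kerT /= [normc (corr x y * _)]normcM [normc (_ * hat b y)]normcM.
rewrite [br x ^+ 0]expr0 [br y ^+ 0]expr0 !mulr1.
have := normc_ge0 (corr x y); have := normc_ge0 (Ak 0 a x); have := normc_ge0 (hat b y).
move: (normc (corr x y)) (normc (Ak 0 a x)) (normc (hat b y)) => G A B B0 A0 G0 hB hA hG.
have ww : 0 <= wt x * wt y by apply: mulr_ge0; exact: wt_ge0.
apply: (@le_trans _ _ (K * (1 + mm x) ^+ (n + 4) * (wt x * wt y) * (A * B))).
  by apply: ler_wpM2r => //; exact: mulr_ge0.
rewrite (_ : _ * _ = K * (A * (1 + mm x) ^+ (n + 4)) * B * (wt x * wt y)); last by ring.
apply: ler_wpM2r => //; apply: ler_pM => //.
  by apply: mulr_ge0 => //; apply: mulr_ge0 => //; exact: exprn_ge0.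
exact: ler_wpM2l.
Qed.

Lemma ci_Ak_conv z : ci (fun x => Ak n a (z - x) * Ak 0 a x).
Proof.
have ma := test1_cm ta.
have [K K0 aK] := Ak_bound n (n + 2) ta; have [L L0 aL] := Ak_bound 0 (n + 2) ta.
pose c : R := K * L * (2 * br z) ^+ (n + 2).
have c0 : 0 <= c.
  apply: mulr_ge0; [exact: mulr_ge0|apply: exprn_ge0; apply: mulr_ge0 => //; exact: br_ge0].
apply: (@ci_wt _ c).
  by apply: cmM; [exact: cm_subl (cm_Ak n ma)|exact: cm_Ak].
move=> x; apply: le_wt => //.
have p0 : 0 < 1 + mm x by rewrite (lt_le_trans ltr01)// lerDl mm_ge0.
have q0 : 0 < 1 + mm (z - x) by rewrite (lt_le_trans ltr01)// lerDl mm_ge0.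
have := br_mm x (z - x); have := br_mm (z - x) x.
rewrite (_ : x + (z - x) = z); last by ring.
rewrite (_ : z - x + x = z); last by ring.
rewrite [normc (Ak n a (z - x) * _)]normcM.
have := aK (z - x); have := aL x; rewrite [br x ^+ 0]expr0 mulr1.
move=> h1 h2 h3 h4; move: h1 h2 h3 h4 p0 q0.
exact: est_c (normc_ge0 _) (normc_ge0 _) (br_ge0 _) (br_ge0 _) (br_ge0 _) K0 L0.
Qed.

(** With the sums (z, z') of the two arguments as new variables, integrating in (x, x') first
    produces the convolutions of [Ak_conv] and [hat_conv]. Squares appear because both factors carry
    the same cutoff. *)
Lemma TT_corr :
  TT 0 a b corr = TT n.+1 (fun x => a x * a x) (fun x => b x * b x) f.
Proof.
have ma := test1_cm ta; have mb := test1_cm tb; have [mf _] := rf.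
pose Q x x' z z' := f z z' * (Ak n a (z - x) * hat b (z' - x')) * (Ak 0 a x * hat b x').
have mQ : cm (fun w : R * R * R * R => Q w.1.1.1 w.1.1.2 w.1.2 w.2).
  apply: cmM; first apply: cmM.
  - by apply: (cm_comp (g := fun w : R * R * R * R => (w.1.2, w.2)) _ mf); mst.
  - apply: cmM.
      by apply: (cm_comp (g := fun w : R * R * R * R => w.1.2 - w.1.1.1) _ (cm_Ak n ma)); mst.
    by apply: (cm_comp (g := fun w : R * R * R * R => w.2 - w.1.1.2) _ (cm_hat mb)); mst.
  apply: cmM.
    by apply: (cm_comp (g := fun w : R * R * R * R => w.1.1.1) _ (cm_Ak 0 ma)); mst.
  by apply: (cm_comp (g := fun w : R * R * R * R => w.1.1.2) _ (cm_hat mb)); mst.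
have [K K0 hK] := kerT_shift_bound.
have [L L0 aL] := Ak_bound 0 (n + 4) ta.
have [M M0 bM] := test1_rdec tb 0%N.
have w0 := @wt_ge0 R; have w1 := @wt_le1 R.
have QK x x' z z' : normc (Q x x' z z') <= K * L * M * (wt x * wt x' * (wt z * wt z')).
  have := hK x (z - x) x' (z' - x'); rewrite /kerT.
  rewrite (_ : x + (z - x) = z); last by ring.
  rewrite (_ : x' + (z' - x') = z'); last by ring.
  move=> h; have := aL x; have := bM x'.
  rewrite /Q [normc (_ * (Ak 0 a x * _))]normcM [normc (Ak 0 a x * _)]normcM.
  rewrite [br x ^+ 0]expr0 [br x' ^+ 0]expr0 !mulr1.
  have := normc_ge0 (Ak 0 a x); have := normc_ge0 (hat b x').
  have := normc_ge0 (f z z' * (Ak n a (z - x) * hat b (z' - x'))).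
  move: (normc (f z z' * _)) (normc (Ak 0 a x)) (normc (hat b x')) h => G A B hG G0 B0 A0 hB hA.
  have p0 : 0 <= 1 + mm x by rewrite addr_ge0// mm_ge0.
  have W : wt6 x (z - x) x' (z' - x') <= wt x * wt x' * (wt z * wt z').
    rewrite /wt6 (_ : x + (z - x) = z); last by ring.
    rewrite (_ : x' + (z' - x') = z'); last by ring.
    rewrite (_ : _ * _ = wt x * wt x' * (wt z * wt z') * (wt (z - x) * wt (z' - x'))); last by ring.
    apply: ler_piMr; first by do 3?[apply: mulr_ge0 => //].
    by rewrite -[1]mulr1; apply: ler_pM.
  apply: (@le_trans _ _ ((K * (1 + mm x) ^+ (n + 4) * (wt x * wt x' * (wt z * wt z'))) * (A * B))).
    apply: ler_wpM2r; first exact: mulr_ge0.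
    apply: (le_trans hG); apply: ler_wpM2l => //.
    by apply: mulr_ge0 => //; exact: exprn_ge0.
  rewrite (_ : _ * _ = K * (A * (1 + mm x) ^+ (n + 4)) * B * (wt x * wt x' * (wt z * wt z'))); last by ring.
  apply: ler_wpM2r; first by do 3?[apply: mulr_ge0 => //].
  apply: ler_pM => //.
    by apply: mulr_ge0 => //; apply: mulr_ge0 => //; exact: exprn_ge0.
  exact: ler_wpM2l.
have E x x' : kerT 0 a b corr x x' = Int2 (Q x x').
  have mk := cm2_kerT n ta tb (rd2_shift x x' rf).1.
  have [D dD] := rd2_kerT n ta tb (rd2_shift x x' rf).
  rewrite /kerT /corr /TT mulrC -(Int2Z _ mk dD).
  apply: (etrans (y := Int (fun z => Int (fun t => Q x x' z (x' + t))))).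
    rewrite -[RHS](Int_shift x).
      apply: eq_Int => z; apply: eq_Int => t; rewrite /kerT /Q.
      rewrite (_ : z + x - x = z); last by ring.
      rewrite (_ : x' + t - x' = t); last by ring.
      by rewrite mulrC [x + z]addrC.
    apply: (cm_Int (F := fun z t => Q x x' z (x' + t))).
    by apply: (cm_comp (g := fun w : R * R => (x, x', w.1, x' + w.2)) _ mQ); mst.
  apply: eq_Int => z; rewrite -[RHS](Int_shift x').
    by apply: eq_Int => t; rewrite [x' + t]addrC.
  by apply: (cm_comp (g := fun w : R => (x, x', z, w)) _ mQ); mst.
have -> : TT 0 a b corr = Int2 (fun x x' => Int2 (Q x x')).
  by apply: eq_Int => x; apply: eq_Int => x'; exact: E.
rewrite (Int4_swap mQ QK); apply: eq_Int => z; apply: eq_Int => z'.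
rewrite /kerT -Ak_conv// -hat_conv//.
have cA := ci_Ak_conv z.
have cB : ci (fun x' => hat b (z' - x') * hat b x').
  have [N bN] := rdec_odom (test1_rdec tb).
  apply: (@ci_wt _ (M * N)); first by apply: cmM; [exact: cm_subl (cm_hat mb)|exact: cm_hat].
  move=> x; rewrite normcM -mulrA; apply: ler_pM; rewrite ?normc_ge0//.
  by have := bM (z' - x); rewrite expr0 mulr1.
rewrite -IntZr// -IntZ; last by have := ciZ (Int (fun x' => hat b (z' - x') * hat b x')) cA; under eq_fun do rewrite mulrC.
have ac (p q1 q2 r1 r2 : C) : p * (q1 * q2) * (r1 * r2) = p * (q1 * r1) * (q2 * r2).
  by ring.
apply: eq_Int => x; rewrite mulrA -IntZ//.
by apply: eq_Int => x'; exact: ac.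
Qed.

End Fixed.

End Correlation.

Transparent Int.

(** * Coordinates and test functions in the plane *)

Section Coordinates.
Context {R : realType}.
Local Notation Re := (@complex.Re R).
Local Notation Im := (@complex.Im R).
Implicit Types (x t : R) (f g : @cfun R (1 + 1)).

Definition pt x t : 'rV[R]_(1 + 1) := row_mx x%:M t%:M.
Definition at_pt f := fun x t => f (pt x t).

Lemma pt_ix x t : pt x t 0 ix = x.
Proof. by rewrite /pt /ix row_mxEl !mxE eqxx mulr1n. Qed.
Lemma pt_it x t : pt x t 0 it = t.
Proof. by rewrite /pt /it row_mxEr !mxE eqxx mulr1n. Qed.

Lemma ixitP (P : 'I_(1 + 1) -> Prop) : P ix -> P it -> forall i, P i.
Proof.
move=> p0 p1 i; case: (splitP i) => j ij.
  by rewrite (_ : i = ix)//; apply: val_inj; rewrite /= ij ord1.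
by rewrite (_ : i = it)//; apply: val_inj; rewrite /= ij ord1.
Qed.

Lemma eq_rV2 (z w : 'rV[R]_(1 + 1)) : z 0 ix = w 0 ix -> z 0 it = w 0 it -> z = w.
Proof. by move=> a b; apply/rowP; apply: ixitP. Qed.

Lemma ptE (z : 'rV[R]_(1 + 1)) : z = pt (z 0 ix) (z 0 it).
Proof. by apply: eq_rV2; rewrite ?pt_ix ?pt_it. Qed.

Lemma rV1E (z : 'rV[R]_1) : z = (z 0 0)%:M.
Proof. by apply/rowP => i; rewrite ord1 !mxE eqxx mulr1n. Qed.

Lemma scal1E x : (x%:M : 'rV[R]_1) 0 0 = x.
Proof. by rewrite !mxE eqxx mulr1n. Qed.

Lemma integral1E (f : @cfun R 1) : integralRn f = Int (fun x => f x%:M).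
Proof.
congr integralC; apply/funext => x /=; congr f.
apply/rowP => i; rewrite mxE; case: splitP => [j _|[]//].
by rewrite !mxE !ord1.
Qed.

Lemma integral2E f : integralRn f = Int2 (at_pt f).
Proof.
congr integralC; apply/funext => x.
exact: (integral1E (fun y => f (row_mx x%:M y))).
Qed.

Lemma delta_ix h x t : h *: delta_mx 0 ix + pt x t = pt (h + x) t.
Proof.
by apply: eq_rV2; rewrite !(pt_ix, pt_it, mxE) /= ?(pt_ix, pt_it) ?mulr1 ?mulr0 ?add0r.
Qed.

Lemma delta_it h x t : h *: delta_mx 0 it + pt x t = pt x (h + t).
Proof.
by apply: eq_rV2; rewrite !(pt_ix, pt_it, mxE) /= ?(pt_ix, pt_it) ?mulr1 ?mulr0 ?add0r.
Qed.

Lemma delta1 h x : h *: delta_mx 0 (0 : 'I_1) + x%:M = (h + x)%:M :> 'rV[R]_1.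
Proof. by rewrite [LHS]rV1E; congr (_%:M); rewrite !mxE /= mulr1 mulr1n. Qed.

(** Along an axis the difference quotients of a directional derivative and of the restricted
    function are literally the same. The parameter [ax] covers both axes of the plane and the line
    of row vectors of size 1. *)
Lemma is_derive_axis (V : normedModType R) (g : V -> R) (ax : R -> V) x (v : V) (l : R) :
  (forall h x, h *: v + ax x = ax (h + x)) ->
  (is_derive (ax x) v g l <-> is_derive x 1 (g \o ax) l).
Proof.
move=> hv.
have E : (fun h : R => h^-1 *: ((g \o shift (ax x)) (h *: v) - g (ax x))) =
    (fun h => h^-1 *: (((g \o ax) \o shift x) (h *: (1 : R)) - (g \o ax) x)).
  by apply/funext => h /=; rewrite hv /GRing.scale /= mulr1.
by split => -[d e]; (apply: DeriveDef; first by move: d; rewrite /derivable E);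
  rewrite -e /derive E.
Qed.

Lemma partial_axis n (i : 'I_n) (g : @cfun R n) (ax : R -> 'rV[R]_n) x :
  (forall h x, h *: delta_mx 0 i + ax x = ax (h + x)) ->
  derivable (fun y => Re (g y)) (ax x) (delta_mx 0 i) ->
  derivable (fun y => Im (g y)) (ax x) (delta_mx 0 i) ->
  isdC (fun y => g (ax y)) x (partial i g (ax x)).
Proof.
move=> ha dr di; split.
  apply/(is_derive_axis (fun y => Re (g y)) x _ ha); exact/derivableP.
apply/(is_derive_axis (fun y => Im (g y)) x _ ha); exact/derivableP.
Qed.

Lemma isdC_axis n (i : 'I_n) (g : @cfun R n) (ax : R -> 'rV[R]_n) x l :
  (forall h x, h *: delta_mx 0 i + ax x = ax (h + x)) ->
  isdC (fun y => g (ax y)) x l ->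
  [/\ derivable (fun y => Re (g y)) (ax x) (delta_mx 0 i),
      derivable (fun y => Im (g y)) (ax x) (delta_mx 0 i) &
      partial i g (ax x) = l].
Proof.
move=> ha [dr di].
have [dr' er] := (is_derive_axis (fun y => Re (g y)) x _ ha).2 dr.
have [di' ei] := (is_derive_axis (fun y => Im (g y)) x _ ha).2 di.
by split => //; apply: complexP.
Qed.

Lemma partials_cat n (s s' : seq 'I_n) (f : @cfun R n) :
  partials s (partials s' f) = partials (s ++ s') f.
Proof. by rewrite /partials foldr_cat. Qed.

Lemma smooth_partials n (s : seq 'I_n) (f : @cfun R n) : smooth f -> smooth (partials s f).
Proof. by move=> sf s'; rewrite partials_cat; exact: sf. Qed.

Lemma smooth_isd n (i : 'I_n) (f : @cfun R n) (ax : R -> 'rV[R]_n) x : smooth f ->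
  (forall h x, h *: delta_mx 0 i + ax x = ax (h + x)) ->
  isdC (fun y => f (ax y)) x (partial i f (ax x)).
Proof.
by move=> sf ha; have [_ _ /(_ i (ax x))[]] := sf [::]; exact: partial_axis.
Qed.

Lemma smooth_ix f x t : smooth f -> isdC (fun y => f (pt y t)) x (partial ix f (pt x t)).
Proof. by move=> sf; apply: (smooth_isd x sf (ax := pt^~ t)) => h y; exact: delta_ix. Qed.

Lemma smooth_it f x t : smooth f -> isdC (fun y => f (pt x y)) t (partial it f (pt x t)).
Proof. by move=> sf; apply: (smooth_isd t sf (ax := pt x)) => h y; exact: delta_it. Qed.

Lemma smooth_1 (f : @cfun R 1) x : smooth f ->
  isdC (fun y => f y%:M) x (partial (0 : 'I_1) f x%:M).
Proof. by move=> sf; apply: (smooth_isd x sf (ax := fun x => x%:M)) => h y; exact: delta1. Qed.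

Lemma continuous_scal1 : continuous (fun y : R => y%:M : 'rV[R]_1).
Proof.
move=> x; apply/cvg_ballP => e e0; near=> y.
split => // i j; rewrite !ord1 !scal1E; near: y; apply/nbhs_ballP; exists e.
Unshelve. all: by end_near. Qed.

Lemma smooth_sm (f : @cfun R 1) n : smooth f -> sm n (fun y => f y%:M).
Proof.
elim: n f => [|n IH] f sf.
  have [cr cI _] := sf [::]; split => x.
    apply: (@continuous_comp _ _ _ (fun y : R => y%:M : 'rV[R]_1) (fun z => Re (f z))).
    exact: continuous_scal1.
  exact: cr.
  apply: (@continuous_comp _ _ _ (fun y : R => y%:M : 'rV[R]_1) (fun z => Im (f z))).
    exact: continuous_scal1.
  exact: cI.
exists (fun x => partial 0 f x%:M); first by move=> x; exact: smooth_1.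
exact: (IH _ (smooth_partials [:: 0] sf)).
Qed.

Lemma pt_box x t (P : 'rV[R]_(1 + 1) -> Prop) : (\forall z \near pt x t, P z) ->
  exists2 e : R, 0 < e & forall y s, `|x - y| < e -> `|t - s| < e -> P (pt y s).
Proof.
move=> /nbhs_ballP[e /= e0 eP]; exists e => // y s xy ts.
apply: eP; split => // i j; rewrite ord1.
by move: j; apply: ixitP; rewrite ?pt_ix ?pt_it.
Qed.

(** The topology is that of row vectors, the sigma-algebra that of R * R. They are reconciled by
    writing the preimage of an open half-line as a countable union of open boxes with rational
    ends. *)
Lemma measurable_pt (g : 'rV[R]_(1 + 1) -> R) : continuous g ->
  measurable_fun setT (fun w : R * R => g (pt w.1 w.2)).
Proof.
move=> cg; apply: (measurability _ (RGenOInfty.measurableE R)) => _ [_ [a ->] <-].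
apply: measurableI => //.
pose box (q : rat * rat * (rat * rat)) : set (R * R) :=
  `]ratr q.1.1, ratr q.1.2[%classic `*` `]ratr q.2.1, ratr q.2.2[%classic.
pose S : set (R * R) := [set w | a < g (pt w.1 w.2)].
(* Boxes that stick out of [S] are replaced by the empty set, so that the union runs over a
   countable type. *)
rewrite (_ : _ @^-1` _ = \bigcup_q (if `[< box q `<=` S >] then box q else set0)); last first.
  apply/seteqP; split => [[x t]|[x t] [q _]]; last first.
    by case: ifP => // /asboolP bS /bS; rewrite /= in_itv /= andbT.
  rewrite /= in_itv /= andbT => axt.
  have : \forall z \near pt x t, a < g z by have /cvgr_gt := cg (pt x t); apply.
  move=> /pt_box[e e0 eP].
  have lt1 y : y - e < y by rewrite ltrBlDr ltrDl.
  have lt2 y : y < y + e by rewrite ltrDl.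
  have [q1 q1x] := rat_in_itvoo (lt1 x); have [q2 q2x] := rat_in_itvoo (lt2 x).
  have [q3 q3t] := rat_in_itvoo (lt1 t); have [q4 q4t] := rat_in_itvoo (lt2 t).
  move: q1x q2x q3t q4t; rewrite !in_itv /= => /andP[a1 b1] /andP[a2 b2] /andP[a3 b3] /andP[a4 b4].
  exists ((q1, q2), (q3, q4)) => //; case: ifP => [_|/negP[]].
    by rewrite /box /= !in_itv /= b1 a2 b3 a4.
  apply/asboolP => -[y s]; rewrite /box /= !in_itv /= => -[/andP[c1 d1] /andP[c2 d2]].
  by apply: eP; rewrite ltr_distlC /=; apply/andP; split; lra.
apply: countable_bigcupT_measurable => [|q]; first exact: countableP.
by case: ifP => // _; apply: measurableX; exact: measurable_itv.
Qed.

Lemma smooth_cm2 f : smooth f -> cm2 (at_pt f).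
Proof. by move=> sf; have [cr cI _] := sf [::]; split; [exact: (measurable_pt cr)|exact: (measurable_pt cI)]. Qed.

End Coordinates.

(** * Test functions of two variables and their marginals *)

Section PlaneTestFunctions.
Context {R : realType}.
Local Notation C := R[i].
Implicit Types (x t r : R) (f g : @cfun R (1 + 1)) (h : R -> R -> C).

Lemma partial_dC n (i : 'I_n) (g : @cfun R n) (ax : R -> 'rV[R]_n) x :
  (forall s x, s *: delta_mx 0 i + ax x = ax (s + x)) ->
  partial i g (ax x) = dC (fun y => g (ax y)) x.
Proof.
move=> ha; have E (G : 'rV[R]_n -> R) : 'D_(delta_mx 0 i) G (ax x) = derive1 (G \o ax) x.
  rewrite derive1E /derive (_ : (fun s : R => s^-1 *: ((G \o shift (ax x)) (s *: _) - G (ax x))) =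
    (fun s => s^-1 *: (((G \o ax) \o shift x) (s *: (1 : R)) - (G \o ax) x)))//.
  by apply/funext => s /=; rewrite ha /GRing.scale /= mulr1.
by apply: complexP; rewrite /= E.
Qed.

Lemma inv_x_plus_i0E (phi : @cfun R 1) : inv_x_plus_i0 phi = U0 (fun x => phi x%:M).
Proof.
rewrite /inv_x_plus_i0 /vp_inv /dpartial /regular /Defs.dirac0 /U0 integral1E.
have -> : phi 0 = phi 0%:M by congr phi; rewrite [LHS]rV1E mxE.
have -> // : Int (fun x => (ln `|x%:M 0 (0 : 'I_1)|)%:C * partial 0 phi x%:M) =
    Int (fun x => (ln `|x|)%:C * dC (fun x0 => phi x0%:M) x).
apply: eq_Int => x; rewrite scal1E.
by rewrite -(@partial_dC 1 0 phi (fun x => x%:M))// => y s; exact: delta1.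
Qed.

Definition vanish2 r h := forall x t, (r < `|x|) || (r < `|t|) -> h x t = 0.
Definition test2 f := smooth f /\ exists r, vanish2 r (at_pt f).

Lemma oneDsqr_wt (r x : R) : `|x| <= r -> 1 <= oneDsqr r * wt x.
Proof.
move=> xr; rewrite /wt ler_pdivlMr ?mul1r; last by rewrite /oneDsqr ltr_wpDr ?sqr_ge0.
by rewrite /oneDsqr lerD2l -[leLHS]real_normK ?num_real// lerXn2r ?nnegrE// (le_trans _ xr).
Qed.

Lemma vanish2_dom r M h : vanish2 r h -> (forall x t, normc (h x t) <= M) ->
  dom2 (M * (oneDsqr r * oneDsqr r)) h.
Proof.
move=> hr hM x t; have M0 : 0 <= M by apply: le_trans (hM 0 0); exact: normc_ge0.
have q0 : 0 <= oneDsqr r by rewrite /oneDsqr addr_ge0 ?sqr_ge0.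
have [rxt|/norP[]] := boolP ((r < `|x|) || (r < `|t|)).
  by rewrite hr// normc0; do ?[apply: mulr_ge0 => //]; exact: wt_ge0.
rewrite -!leNgt => xr tr; apply: le_trans (hM x t) _.
rewrite -mulrA [_ * _ * (wt x * _)]mulrACA; apply: ler_peMr => //.
by rewrite -[1]mulr1; apply: ler_pM => //; exact: oneDsqr_wt.
Qed.

Lemma vanish2_rd2 r M h : cm2 h -> vanish2 r h -> (forall x t, normc (h x t) <= M) -> rd2 h.
Proof.
move=> mh hr hM; have M0 : 0 <= M by apply: le_trans (hM 0 0); exact: normc_ge0.
split => // N; exists (M * (br r ^+ N * br r ^+ N)).
  by do ?[apply: mulr_ge0 => //]; exact: exprn_ge0 (br_ge0 _).
move=> x t; have [rxt|/norP[]] := boolP ((r < `|x|) || (r < `|t|)).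
  rewrite hr// normc0 mul0r.
  by do ?[apply: mulr_ge0 => //]; exact: exprn_ge0 (br_ge0 _).
rewrite -!leNgt => xr tr.
have H y : `|y| <= r -> br y ^+ N <= br r ^+ N.
  move=> yr; apply: lerXn2r; rewrite ?nnegrE ?br_ge0//.
  by rewrite /br lerD2l (le_trans yr)// ler_norm.
apply: ler_pM => //; rewrite ?normc_ge0//.
  by apply: mulr_ge0; exact: exprn_ge0 (br_ge0 _).
by apply: ler_pM; rewrite ?H ?exprn_ge0 ?br_ge0.
Qed.

Lemma coord_norm n (z : 'rV[R]_n) i : `|z 0 i| <= `|z|.
Proof.
rewrite [leRHS]mx_normrE.
by apply: (le_trans _ (le_bigmax _ (fun ij : 'I_1 * 'I_n => `|z ij.1 ij.2|) (0, i))).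
Qed.

Lemma compact_coord n (K : set 'rV[R]_n) : compact K ->
  exists r, forall z i, K z -> `|z 0 i| <= r.
Proof.
move=> /compact_bounded[M [_ MK]]; exists (M + 1) => z i Kz.
by apply: le_trans (coord_norm z i) _; apply: MK => //; rewrite ltrDl.
Qed.

Lemma supported_vanish2 (K : set 'rV[R]_(1 + 1)) : compact K ->
  exists r, forall f, supported_in K f -> vanish2 r (at_pt f).
Proof.
move=> /compact_coord[r Kr]; exists r => f fK x t xt; apply: fK => Kz.
have := Kr _ ix Kz; have := Kr _ it Kz; rewrite pt_ix pt_it !leNgt => /negbTE a /negbTE b.
by move: xt; rewrite a b.
Qed.

Lemma test_function_test2 (Omega : set 'rV[R]_(1 + 1)) f :
  test_function Omega f -> test2 f.
Proof.
move=> [sf [K [cK _ fK]]]; split => //.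
by have [r Hr] := supported_vanish2 cK; exists r; exact: Hr.
Qed.

Lemma vanish2_partials r f s : smooth f -> vanish2 r (at_pt f) ->
  vanish2 r (at_pt (partials s f)).
Proof.
move=> sf fr; elim: s => [//|i s IH] x t xt.
have sg := smooth_partials s sf.
have key : isdC (fun y => partials s f (pt y t)) x 0 /\ isdC (fun y => partials s f (pt x y)) t 0.
  case/orP: xt => H; split.
  - apply: (isdC_near _ (isdC_cst 0 x)); near=> y; rewrite -[LHS](IH y t)//.
    apply/orP; left; near: y; apply: (cvgr_gt `|x|) => //; apply: cvg_norm; exact: cvg_id.
  - by rewrite (_ : (fun y => _) = fun=> 0); [exact: isdC_cst|apply/funext => y; apply: IH; rewrite H].
  - by rewrite (_ : (fun y => _) = fun=> 0); [exact: isdC_cst|apply/funext => y; apply: IH; rewrite H orbT].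
  - apply: (isdC_near _ (isdC_cst 0 t)); near=> y; rewrite -[LHS](IH x y)//.
    apply/orP; right; near: y; apply: (cvgr_gt `|t|) => //; apply: cvg_norm; exact: cvg_id.
rewrite /at_pt /=; move: i; apply: ixitP.
  exact: isdC_unique (smooth_ix x t sg) key.1.
exact: isdC_unique (smooth_it x t sg) key.2.
Unshelve. all: by end_near. Qed.

Lemma test2_partials f s : test2 f -> test2 (partials s f).
Proof.
move=> [sf [r fr]]; split; first exact: smooth_partials.
by exists r; exact: vanish2_partials.
Qed.

Lemma test2_bounded f : test2 f -> exists M, forall x t, normc (f (pt x t)) <= M.
Proof.
move=> [sf [r fr]]; have [cr cI _] := sf [::].
pose K : set 'rV[R]_(1 + 1) := [set v | forall i, `[- r, r]%classic (v 0 i)].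
have cK : compact K.
  apply: (@rV_compact R (1 + 1) (fun=> `[- r, r]%classic)) => i.
  exact: segment_compact.
have key (g : 'rV[R]_(1 + 1) -> R) : continuous g -> exists M, forall z, K z -> `|g z| <= M.
  move=> cg; have : compact (g @` K).
    by apply: continuous_compact => //; exact: continuous_subspaceT.
  move=> /compact_bounded[M [_ MK]]; exists (M + 1) => z Kz.
  by apply: MK; [rewrite ltrDl|exists z].
have [M1 H1] := key _ cr; have [M2 H2] := key _ cI.
exists (Num.max (M1 + M2) 0) => x t.
have [xt|/norP[]] := boolP ((r < `|x|) || (r < `|t|)).
  by rewrite [f _](fr x t)// normc0 le_max lexx orbT.
rewrite -!leNgt !ler_norml => xr tr; rewrite le_max; apply/orP; left.
have Kz : K (pt x t).
  by move=> i; move: i; apply: ixitP; rewrite ?pt_ix ?pt_it /= in_itv.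
by apply: le_trans (normc_reim _) _; apply: lerD; [exact: H1|exact: H2].
Qed.

Lemma test2_cm2 f : test2 f -> cm2 (at_pt f).
Proof. by move=> [sf _]; exact: smooth_cm2. Qed.

Lemma test2_dom f : test2 f -> exists K, dom2 K (at_pt f).
Proof.
move=> tf; have [M fM] := test2_bounded tf; have [r fr] := tf.2.
by exists (M * (oneDsqr r * oneDsqr r)); apply: vanish2_dom fr fM.
Qed.

(** [D m] is the m-th derivative in the variable that is kept. The weight [w] is 1 when t is
    integrated out against the constant, and a character for partial Fourier transforms; both have
    modulus at most 1. *)
Lemma marginal_family (D : nat -> R -> R -> C) (w : R -> C) r :
  (forall m, cm2 (D m)) ->
  (forall m x t, isdC (fun y => D m y t) x (D m.+1 x t)) ->
  (forall m, exists K, dom2 K (D m)) ->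
  (forall x t, r < `|x| -> D 0 x t = 0) ->
  cm w -> (forall t, normc (w t) <= 1) ->
  test1 (fun x => Int (fun t => w t * D 0 x t)) /\
  forall m, iter m dC (fun x => Int (fun t => w t * D 0 x t)) =
            (fun x => Int (fun t => w t * D m x t)).
Proof.
move=> mD dD bD vD mw w1.
pose P m x := Int (fun t => w t * D m x t).
have bw m : exists2 K, 0 <= K & forall x t, normc (w t * D m x t) <= K * wt t.
  have [K KD] := bD m; have K0 := dom2_ge0 KD; exists K => // x t.
  rewrite normcM -[K * _]mul1r; apply: ler_pM; rewrite ?normc_ge0//.
  apply: le_trans (KD x t) _; apply: ler_wpM2l => //.
  by rewrite -[leRHS]mul1r; apply: ler_wpM2r; [exact: wt_ge0|exact: wt_le1].
have dP m x : isdC (P m) x (P m.+1 x).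
  have [K K0 KD] := bw m; have [L L0 LD] := bw m.+1.
  apply: (@Int_isdC _ (fun x t => w t * D m x t) (fun x t => w t * D m.+1 x t)
    (fun t => (K + L) * wt t)).
  - by apply: riZ; exact: ri_wt.
  - by move=> y; apply: cmM => //; exact: cm2_row.
  - by move=> y t; apply: isdCZ; exact: dD.
  - move=> y t; apply: (le_trans (KD y t)).
    by apply: ler_wpM2r; [exact: wt_ge0|rewrite lerDl].
  - move=> y t; apply: (le_trans (LD y t)).
    by apply: ler_wpM2r; [exact: wt_ge0|rewrite lerDr].
have sP n : forall m, sm n (P m).
  elim: n => [|n IH] m; first by apply: isdC_cont => x; exact: dP.
  by exists (P m.+1) => //; exact: dP.
split; last by elim=> [//|m /= ->]; exact: isdC_funE (dP m).
split; first by move=> n; exact: (sP n 0%N).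
exists r => x rx; rewrite (_ : (fun t => _) = fun=> 0 * 0).
  rewrite IntZ ?mul0r//; apply: (@ci_wt _ 0); first exact: cm_cst.
  by move=> t; rewrite normc0 mul0r.
by apply/funext => t; rewrite vD// mulr0 mulr0.
Qed.

Definition margx (w : R -> C) f x := Int (fun t => w t * f (pt x t)).
Definition margt (w : R -> C) f t := Int (fun x => w x * f (pt x t)).

Section Weight.
Variable w : R -> C.
Hypotheses (mw : cm w) (w1 : forall t, normc (w t) <= 1).

Lemma margx_family f : test2 f -> test1 (margx w f) /\
  forall m, iter m dC (margx w f) = margx w (partials (nseq m ix) f).
Proof.
move=> tf; have [r fr] := tf.2.
apply: (marginal_family (D := fun m => at_pt (partials (nseq m ix) f)) (r := r)) => //.
- by move=> m; apply: test2_cm2; exact: test2_partials.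
- by move=> m x t; apply: smooth_ix; apply: smooth_partials; case: tf.
- by move=> m; apply: test2_dom; exact: test2_partials.
- by move=> x t rx; apply: fr; rewrite rx.
Qed.

Lemma margt_family f : test2 f -> test1 (margt w f) /\
  forall m, iter m dC (margt w f) = margt w (partials (nseq m it) f).
Proof.
move=> tf; have [r fr] := tf.2.
apply: (marginal_family (D := fun m t x => partials (nseq m it) f (pt x t)) (r := r)) => //.
- move=> m; apply: (cm_comp (g := fun w : R * R => (w.2, w.1)) _ (test2_cm2 (test2_partials (nseq m it) tf))); mst.
- by move=> m x t; apply: smooth_it; apply: smooth_partials; case: tf.
- move=> m; have [K KD] := test2_dom (test2_partials (nseq m it) tf).
  by exists K => x t; rewrite [wt x * _]mulrC; exact: KD.
- by move=> x t rx; apply: fr; rewrite rx orbT.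
Qed.

End Weight.

End PlaneTestFunctions.

(** * The distributions v_n and the wave operator *)

Section Distributions.
Context {R : realType}.
Local Notation C := R[i].
Implicit Types (x t r : R) (f g : @cfun R (1 + 1)) (phi psi : R -> C).

(** The distribution v_n = (x + i0)^(-n-1) (x) 1: the factor 1 integrates t out before [Un n]
    acts. *)
Definition un n f : C := Un n (margx (fun=> 1) f).

Let m1 : cm ((fun=> 1) : R -> C). Proof. exact: cm_cst. Qed.
Let n1 (t : R) : normc (1 : C) <= 1.
Proof. by rewrite normc1. Qed.

Lemma Un_0 phi : Un 0 phi = U0 phi.
Proof. by rewrite /Un fact0 invr1 mul1r. Qed.

Lemma tensor_un : tensor inv_x_plus_i0 (regular (fun=> 1)) = un 0 :> functional (1 + 1).
Proof.
apply/funext => f; rewrite /tensor inv_x_plus_i0E /un Un_0; congr U0.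
by apply/funext => x; rewrite /regular integral1E.
Qed.

Lemma hv_hat_bound n phi K s : test1 phi -> odom K phi -> odom K (iter (n + 2) dC phi) ->
  normc ((hv s * s ^+ n)%:C * hat phi (- s)) <= 2 ^+ (n + 2).+1 * K * cpi * wt s.
Proof.
move=> tphi h1 h2; have H := hat_decay (- s) tphi h1 h2; have K0 := odom_ge0 h1.
apply: le_wt; last by apply: mulr_ge0; [apply: mulr_ge0 => //; exact: exprn_ge0|exact: cpi_ge0].
apply: le_trans H; rewrite normcM normc_real normrN exprD.
rewrite [leLHS](_ : _ = normc (hat phi (- s)) * (`|hv s * s ^+ n| * br s ^+ 2)); last first.
  by rewrite mulrAC mulrC mulrA.
apply: ler_wpM2l; first exact: normc_ge0.
apply: ler_wpM2r; [exact: exprn_ge0 (br_ge0 s)|exact: hv_bound].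
Qed.

Lemma cm_hv_hat n phi : test1 phi -> cm (fun s => (hv s * s ^+ n)%:C * hat phi (- s)).
Proof.
move=> tphi; apply: cmM; first by apply: cm_real; exact: measurable_hvX.
exact: cm_comp (@oppr_measurable R setT) (cm_hat (test1_cm tphi)).
Qed.

Lemma test1_odom2 N phi : test1 phi -> exists K, odom K phi /\ odom K (iter N dC phi).
Proof.
move=> tphi; have [K h1] := test1_odom tphi; have [L h2] := test1_odom (test1_iter N tphi).
have K0 := odom_ge0 h1; have L0 := odom_ge0 h2.
exists (K + L); split => x; [apply: le_trans (h1 x) _|apply: le_trans (h2 x) _];
  by apply: ler_wpM2r; rewrite ?wt_ge0 ?lerDl ?lerDr.
Qed.

Lemma ci_hv_hat n phi : test1 phi -> ci (fun s => (hv s * s ^+ n)%:C * hat phi (- s)).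
Proof.
move=> tphi; have [K [h1 h2]] := test1_odom2 (n + 2) tphi.
by apply: ci_wt; [exact: cm_hv_hat|move=> s; exact: hv_hat_bound].
Qed.

(** n + 2 derivatives of phi give [hat phi] enough decay for s^n [hat phi (- s)] to be dominated by
    [wt]. *)
Lemma Un_bound n : exists2 A : R, 0 <= A & forall phi K, test1 phi -> odom K phi ->
  odom K (iter (n + 2) dC phi) -> normc (Un n phi) <= A * K.
Proof.
exists (normc (cn n : C) * (2 ^+ (n + 2).+1 * cpi * cpi)).
  apply: mulr_ge0; first exact: normc_ge0.
  by do 2?[apply: mulr_ge0; last exact: cpi_ge0]; exact: exprn_ge0.
move=> phi K tphi h1 h2; rewrite Un_rep// -/(cn n) normcM -[leRHS]mulrA.
apply: ler_wpM2l; first exact: normc_ge0.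
apply: le_trans (Int_wt (cm_hv_hat n tphi) (fun s => hv_hat_bound s tphi h1 h2)) _.
by apply: le_of_eq; rewrite -!mulrA; congr (_ * _); rewrite mulrC -!mulrA.
Qed.

Lemma hat_lin (a : C) phi psi xi : test1 phi -> test1 psi ->
  hat (fun x => a * phi x + psi x) xi = a * hat phi xi + hat psi xi.
Proof.
move=> tphi tpsi; have e1 := ci_ee xi (test1_ci tphi) (test1_cm tphi).
have e2 := ci_ee xi (test1_ci tpsi) (test1_cm tpsi).
rewrite /hat -IntZ// -IntD//; last exact: ciZ.
by apply: eq_Int => x; rewrite mulrDr mulrCA.
Qed.

Lemma Un_lin n (a : C) phi psi : test1 phi -> test1 psi ->
  Un n (fun x => a * phi x + psi x) = a * Un n phi + Un n psi.
Proof.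
move=> tphi tpsi; rewrite !Un_rep//; last by apply: test1D => //; exact: test1Z.
rewrite -/(cn n) mulrCA -mulrDr; congr (_ * _).
have e1 := ci_hv_hat n tphi; have e2 := ci_hv_hat n tpsi.
rewrite -IntZ// -IntD//; last exact: ciZ.
by apply: eq_Int => s; rewrite hat_lin// mulrDr mulrCA.
Qed.

Lemma margx1_lin (a : C) f g : test2 f -> test2 g ->
  margx (fun=> 1) (fun z => a * f z + g z) =
  (fun x => a * margx (fun=> 1) f x + margx (fun=> 1) g x).
Proof.
move=> tf tg; have [K fK] := test2_dom tf; have [L gL] := test2_dom tg.
apply/funext => x; rewrite /margx.
have c1 := dom2_ci x (test2_cm2 tf) fK; have c2 := dom2_ci x (test2_cm2 tg) gL.
have e h : (fun t => 1 * h (pt x t)) = (at_pt h x) :> (R -> C).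
  by apply/funext => t; rewrite mul1r.
by rewrite (e f) (e g) (e (fun z => a * f z + g z)) -IntZ// -IntD//; exact: ciZ.
Qed.

Lemma margx1_test1 f : test2 f -> test1 (margx (fun=> 1) f).
Proof. by move=> tf; exact: (margx_family m1 n1 tf).1. Qed.

Lemma margx1_odom f K m : test2 f -> dom2 K (at_pt (partials (nseq m ix) f)) ->
  odom (K * cpi) (iter m dC (margx (fun=> 1) f)).
Proof.
move=> tf fK x; have [_ ->] := margx_family m1 n1 tf.
rewrite /margx (_ : (fun t => _) = at_pt (partials (nseq m ix) f) x).
  by apply: Int_wt1 fK; apply: test2_cm2; exact: test2_partials.
by apply/funext => t; rewrite mul1r.
Qed.

Lemma un_distribution n (Omega : set 'rV[R]_(1 + 1)) : is_distribution Omega (un n).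
Proof.
split=> [a f g /test_function_test2 tf /test_function_test2 tg|K cK _].
  rewrite /un margx1_lin// Un_lin//; exact: margx1_test1.
have [r Kr] := supported_vanish2 cK; have [A A0 HA] := Un_bound n.
exists (n + 2)%N, (A * (oneDsqr r * oneDsqr r * cpi)) => f M sf fK fM.
have fr := Kr _ fK; have tf : test2 f by split => //; exists r.
have H m : (m <= n + 2)%N -> odom (M * (oneDsqr r * oneDsqr r) * cpi) (iter m dC (margx (fun=> 1) f)).
  move=> mn; apply: margx1_odom => //; apply: vanish2_dom; first exact: vanish2_partials.
  by move=> x t; have := fM (nseq m ix); rewrite size_nseq => /(_ mn (pt x t)); rewrite mul1r.
apply: le_trans (HA _ _ (margx1_test1 tf) (H 0%N isT) (H _ (leqnn _))) _.
by apply: le_of_eq; rewrite -[RHS]mulrA; congr (_ * _); rewrite -mulrA mulrC.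
Qed.

Lemma test_function_test1 (Omega : set 'rV[R]_1) (f : @cfun R 1) :
  test_function Omega f -> test1 (fun x => f x%:M).
Proof.
move=> [sf [K [/compact_coord[r Kr] _ fK]]]; split; first by move=> n; exact: smooth_sm.
exists r => x rx; apply: fK => Kx; have := Kr _ 0 Kx.
by rewrite scal1E leNgt rx.
Qed.

Lemma iter_dC_1 m (f : @cfun R 1) : smooth f ->
  iter m dC (fun x => f x%:M) = (fun x => partials (nseq m (0 : 'I_1)) f x%:M).
Proof.
move=> sf; elim: m => //= m ->; apply: isdC_funE => x.
by apply: smooth_1; exact: smooth_partials.
Qed.

Lemma inv_x_plus_i0_distribution : is_distribution setT (@inv_x_plus_i0 R).
Proof.
split=> [a f g /test_function_test1 tf /test_function_test1 tg|K cK _].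
  by rewrite !inv_x_plus_i0E -!Un_0 Un_lin.
have [r Kr] := compact_coord cK; have [A A0 HA] := Un_bound 0.
exists 2%N, (A * oneDsqr r) => f M sf fK fM.
have tf : test1 (fun x => f x%:M) by apply: (@test_function_test1 setT); split => //; exists K.
have H m : (m <= 2)%N -> odom (M * oneDsqr r) (iter m dC (fun x => f x%:M)).
  move=> mn; apply: vanish_odom.
    elim: m {mn} => [x rx|m IH]; last exact: vanish_dC.
    by apply: fK => Kx; have := Kr _ 0 Kx; rewrite scal1E leNgt rx.
  move=> x; rewrite iter_dC_1//.
  by have := fM (nseq m 0); rewrite size_nseq => /(_ mn x%:M); rewrite mul1r.
rewrite inv_x_plus_i0E -Un_0.
apply: le_trans (HA _ _ tf (H 0%N isT) (H _ (leqnn _))) _.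
by apply: le_of_eq; rewrite -mulrA [M * _]mulrC.
Qed.

Lemma inv_x_plus_i0_limit :
  cvg_distribution (fun eps => regular (inv_x_plus_ieps eps)) (@inv_x_plus_i0 R).
Proof.
move=> f /test_function_test1 tf; apply/cvg_at_rightP => u [u0 ul].
have := eps_limit tf u0 ul => /ccvg_norm; rewrite inv_x_plus_i0E.
have e n : regular (inv_x_plus_ieps (u n)) f = Int (fun x => (x +i* u n)^-1 * f x%:M).
  by rewrite /regular integral1E; apply: eq_Int => x; rewrite /inv_x_plus_ieps scal1E.
by under [in X in _ -> X]eq_fun do rewrite e.
Qed.

Lemma Int_0 : Int (fun _ : R => 0) = 0 :> C.
Proof.
have c0 : ci (fun _ : R => 0 : C).
  by apply: (@ci_wt _ 0); [exact: cm_cst|move=> x; rewrite normc0 mul0r].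
by rewrite -[RHS](mul0r (Int (fun=> 0))) -IntZ//; under [in RHS]eq_fun do rewrite mul0r.
Qed.

Lemma U0_0 : U0 (fun _ : R => 0) = 0 :> C.
Proof.
rewrite /U0 mulr0 subr0 (isdC_funE (fun x => isdC_cst 0 x)).
by under eq_fun do rewrite mulr0; rewrite Int_0 oppr0.
Qed.

Lemma un0_it f : test2 f -> un 0 (partial it f) = 0.
Proof.
move=> tf; have tg := test2_partials [:: it] tf.
have E : margx (fun=> 1) (partial it f) = fun=> 0.
  apply/funext => x; rewrite /margx.
  have [sg [s gs]] := tg; have [sf [r fr]] := tf; have [K fK] := test2_dom tg.
  have d t := smooth_it x t sf.

  have /isdC_cont [cr cI] : forall t, isdC (fun t => partial it f (pt x t)) t (partial it (partial it f) (pt x t)).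
    by move=> t; exact: (smooth_it x t sg).
  rewrite (_ : (fun t => _) = fun t => partial it f (pt x t)); last by apply/funext => t; rewrite mul1r.
  apply: (@Int_deriv0 _ (fun t => f (pt x t)) _ (Num.max r s)) => // t; rewrite gt_max => /andP[rt st].
    by apply: fr; rewrite rt orbT.
  by apply: gs; rewrite st orbT.
by rewrite /un E Un_0 U0_0.
Qed.

(** The factor 1/2! and the two derivatives sit in the definition of [Un 2]; it remains that d_x
    commutes with the integral in t. *)
Lemma un_ix f : test2 f -> un 0 (partial ix (partial ix f)) = 2%:R * un 2 f.
Proof.
move=> tf; rewrite /un Un_0 /Un (margx_family m1 n1 tf).2 /=.
rewrite mulrA (_ : 2%:R * _ = 1) ?mul1r//.
by rewrite (_ : 2 = 2%:C) -?rmorphM ?divff// rmorph_nat.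
Qed.

Lemma wave_identity f c : test2 f ->
  (c ^- 2)%:C * dpartial it (dpartial it (un 0)) f
  - dpartial ix (dpartial ix (un 0)) f + 2%:R * un 2 f = 0.
Proof.
move=> tf; have H (a z1 z2 z3 : C) : z1 = 0 -> z2 = z3 -> a * - - z1 - - - z2 + z3 = 0.
  by move=> -> ->; rewrite !opprK mulr0 sub0r addNr.
by apply: H; [exact: un0_it (test2_partials [:: it] tf)|exact: un_ix].
Qed.

End Distributions.

(** * The distribution u as an integral of its time slices *)

Section Slices.
Context {R : realType}.
Local Notation C := R[i].
Implicit Types (x t r : R) (f g : @cfun R (1 + 1)) (phi psi : R -> C).

Lemma test2_slice f t : test2 f -> test1 (fun x => f (pt x t)) /\
  forall m, iter m dC (fun x => f (pt x t)) = (fun x => partials (nseq m ix) f (pt x t)).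
Proof.
move=> [sf [r fr]]; have d g x := @smooth_ix _ g x t.
have S n : forall g, smooth g -> sm n (fun x => g (pt x t)).
  elim: n => [|n IH] g sg; first by apply: isdC_cont => x; exact: d.
  exists (fun x => partial ix g (pt x t)); first by move=> x; exact: d.
  exact: (IH _ (smooth_partials [:: ix] sg)).
split; first by split; [move=> n; exact: S|exists r => x rx; apply: fr; rewrite rx].
elim=> //= m ->; apply: isdC_funE => x; exact: (d _ x (smooth_partials (nseq m ix) sf)).
Qed.

Lemma integralC_Int (D : set R) (F : R -> C) : (forall t, ~ D t -> F t = 0) ->
  integralC D F = Int F.
Proof.
move=> F0; rewrite IntE /integralC; congr (_ +i* _); rewrite Rintegral_mkcond /RInt;
  congr (Rintegral _ _ _); apply/funext => t; rewrite patchE; case: ifPn => //;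
  by rewrite notin_setE => /F0 ->.
Qed.

(** The exchange of 1/(x + i0) with the integral in t is made on the Fourier side, by [U0_rep],
    where the integrand is dominated by a product weight; the kernel log |x| of the definition is
    unbounded. *)
Lemma Int_U0 f : test2 f ->
  U0 (margx (fun=> 1) f) = Int (fun t => U0 (fun x => f (pt x t))).
Proof.
move=> tf; have mf := test2_cm2 tf.
have tm := margx1_test1 tf.
pose G s t := hat (fun x => f (pt x t)) (- s).
have mG : cm2 G.
  apply: (cm_Int (F := fun (w : R * R) x => ee (- w.1) x * f (pt x w.2))); apply: cmM.
    by apply: (cm_comp (g := fun w : R * R * R => (- w.1.1, w.2)) _ cm_ee); mst.
  by apply: (cm_comp (g := fun w : R * R * R => (w.2, w.1.2)) _ mf); mst.
have [K0 h0] := test2_dom tf; have [K2 h2] := test2_dom (test2_partials [:: ix; ix] tf).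
have K00 := dom2_ge0 h0; have K20 := dom2_ge0 h2.
have GK : dom2 (2 ^+ 3 * (K0 + K2) * cpi) (fun s t => (hv s)%:C * G s t).
  move=> s t; have [ts it2] := test2_slice t tf.
  have o m K : 0 <= K -> K <= K0 + K2 -> dom2 K (at_pt (partials (nseq m ix) f)) ->
      odom ((K0 + K2) * wt t) (iter m dC (fun x => f (pt x t))).
    move=> K_ge0 KK fK x; rewrite it2 -mulrA [wt t * _]mulrC; apply: le_trans (fK x t) _.
    by apply: ler_wpM2r => //; apply: mulr_ge0; exact: wt_ge0.
  have := @hv_hat_bound _ 0 _ _ s ts (o 0%N _ K00 _ h0) (o 2%N _ K20 _ h2).
  rewrite expr0 mulr1 lerDl lerDr => /(_ K20 K00) H; apply: le_trans H _.
  by apply: le_of_eq; ring.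
have mhG : cm2 (fun s t => (hv s)%:C * G s t).
  apply: cmM => //.
  apply: cm_real; exact: (measurableT_comp (@measurable_hv R) measurable_fst).
have -> : Int (fun t => U0 (fun x => f (pt x t))) =
    Int (fun t => kap * Int (fun s => (hv s)%:C * G s t)).
  by apply: eq_Int => t; rewrite U0_rep//; case: (test2_slice t tf).
rewrite U0_rep//.
have GK' : dom2 (2 ^+ 3 * (K0 + K2) * cpi) (fun t s => (hv s)%:C * G s t).
  by move=> t s; rewrite [wt t * _]mulrC; exact: GK.
have mhG' : cm2 (fun t s => (hv s)%:C * G s t).
  by apply: (cm_comp (g := fun w : R * R => (w.2, w.1)) _ mhG); mst.
apply: (etrans _ (esym (IntZ kap (ci_Int mhG' GK')))).
congr (_ * _); rewrite -(Int_swap mhG GK); apply: eq_Int => s.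
have [K fK] := test2_dom tf.
rewrite /hat /margx; under eq_Int => x.
  rewrite -IntZ; last first.
    by have := dom2_ci x mf fK; rewrite /at_pt; under eq_fun do rewrite -[f _]mul1r.
  over.
rewrite (Int_swap (K := K)); last 2 first.
- apply: cmM; first by apply: (cm_comp (g := fun w : R * R => (- s, w.1)) _ cm_ee); mst.
  by apply: cmM; [exact: cm_cst|exact: mf].
- by move=> x t; rewrite normcM normc_ee !mul1r; exact: fK.
rewrite -IntZ; last first.
  apply: (ci_Int (K := K) (F := fun t x => ee (- s) x * (1 * f (pt x t)))).
    apply: cmM; first by apply: (cm_comp (g := fun w : R * R => (- s, w.2)) _ cm_ee); mst.
    by apply: cmM; [exact: cm_cst|apply: (cm_comp (g := fun w : R * R => (w.2, w.1)) _ mf); mst].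
  by move=> t x; rewrite normcM normc_ee !mul1r [wt t * _]mulrC; exact: fK.
by apply: eq_Int => t; congr (_ * _); apply: eq_Int => x; rewrite mul1r.
Qed.

Lemma un0_slices f : test_function positive_times f ->
  un 0 f = integralC [set t | 0 < t] (fun t => inv_x_plus_i0 (fun y : 'rV[R]_1 => f (row_mx y t%:M))).
Proof.
move=> tf; rewrite /un Un_0 (Int_U0 (test_function_test2 tf)) integralC_Int.
  by apply: eq_Int => t; rewrite inv_x_plus_i0E.
move=> t tneg; rewrite inv_x_plus_i0E -[RHS]U0_0; congr U0; apply/funext => x.
have [_ [K [_ KO fK]]] := tf; apply: fK => /KO.
by rewrite /positive_times /= -/(pt x t) pt_it.
Qed.

End Slices.

(** * Cutoffs and microregularity *)

Section Bumps.
Context {R : realType}.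
Local Notation C := R[i].
Local Notation Re := (@complex.Re R).
Local Notation Im := (@complex.Im R).
Implicit Types (x y t r d : R) (a b phi : R -> C).

(** The functions x^(-k) exp(-1/x) on x > 0. Differentiation stays inside their linear span, so
    smoothness of exp(-1/x) is proved by one induction for all k together. *)
Definition flat (k : nat) x : R := if 0 < x then x ^- k * expR (- x^-1) else 0.

(** For m > 0, exp y = exp(y / m)^m >= (y / m)^m. *)
Lemma expR_pow_bound (m : nat) y : 0 < y -> y ^+ m * expR (- y) <= m%:R ^+ m.
Proof.
case: m => [|m] y0; first by rewrite !expr0 mul1r -expR0 ler_expR lerNl oppr0 ltW.
rewrite expRN ler_pdivrMr ?expR_gt0//.
have m0 : 0 < m.+1%:R :> R by rewrite ltr0n.
rewrite (_ : expR y = expR (y / m.+1%:R) ^+ m.+1); last first.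
  by rewrite -expRM_natl mulrC divfK// gt_eqF.
rewrite -exprMn; apply: lerXn2r; rewrite ?nnegrE; first exact: ltW.
  by rewrite mulr_ge0 ?expR_ge0// ltW.
rewrite mulrC -ler_pdivrMr//; apply: le_trans (expR_ge1Dx _).
by rewrite lerDr.
Qed.

(** [expR_pow_bound] at y = 1/x with exponent k + 2: the two spare powers leave a factor x^2, which
    forces the derivative at 0 to exist and vanish. *)
Lemma flat_bound k x : `|flat k x| <= (k + 2)%:R ^+ (k + 2) * x ^+ 2.
Proof.
rewrite /flat; case: ifPn => [x0|_]; last first.
  by rewrite normr0; apply: mulr_ge0; [exact: exprn_ge0|exact: sqr_ge0].
have y0 : 0 < x^-1 by rewrite invr_gt0.
rewrite ger0_norm; last by rewrite mulr_ge0 ?expR_ge0 ?invr_ge0 ?exprn_ge0 ?ltW.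
rewrite -ler_pdivrMr ?exprn_gt0//; apply: le_trans (expR_pow_bound (k + 2) y0).
by rewrite mulrAC exprD !exprVn.
Qed.

Lemma flat_derive k x : is_derive x 1 (flat k) (flat (k + 2) x - k%:R * flat k.+1 x).
Proof.
have [x0|x0|->] := ltgtP x 0.
- rewrite /flat !ltNge (ltW x0) /= mulr0 subr0.
  apply: (near_eq_is_derive _ (is_derive_cst (0 : R) x (1 : R))).
  near=> y; rewrite ltNge (_ : y <= 0)//; apply: ltW; near: y.
  by apply: (cvgr_lt x) => //; exact: cvg_id.
- rewrite /flat x0 -!exprVn.
  apply: (near_eq_is_derive (f := fun y => y^-1 ^+ k * expR (- y^-1))).
    near=> y; rewrite (_ : 0 < y) ?exprVn//; near: y.
    by apply: (cvgr_gt x) => //; exact: cvg_id.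
  have dV : is_derive x 1 (fun y : R => y^-1) (- x^-1 ^+ 2).
    apply: (is_derive_eq (is_deriveV (f := fun y : R => y) _ _)); first by rewrite gt_eqF.
    by rewrite /GRing.scale /= mulr1 exprVn.
  have dE : is_derive x 1 (fun y : R => expR (- y^-1)) (x^-1 ^+ 2 * expR (- x^-1)).
    have dN : is_derive x 1 (fun y : R => - y^-1) (x^-1 ^+ 2).
      by apply: is_derive_eq; rewrite opprK.
    have H := @is_derive1_comp R expR (fun y => - y^-1) x _ _ (is_derive_expR _) dN.
    by apply: (is_derive_eq H); rewrite mulrC.
  have dX : is_derive x 1 (fun y : R => y^-1 ^+ k) (- (k%:R * x^-1 ^+ k.+1)).
    elim: k => [|k IH].
      by rewrite mul0r oppr0; under eq_fun do rewrite expr0; exact: is_derive_cst.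
    under eq_fun do rewrite exprS; apply: (is_derive_eq (is_deriveM dV IH)).
    by rewrite /GRing.scale /= -natr1 !exprS; ring.
  by apply: is_derive_eq; rewrite /GRing.scale /= exprD exprS; ring.
- have -> : flat (k + 2) 0 - k%:R * flat k.+1 0 = 0 by rewrite /flat ltxx mulr0 subr0.
  (* By [flat_bound] the difference quotient at 0 is at most B |h|. *)
  have c : (fun h : R => h^-1 *: ((flat k \o shift 0) (h *: (1 : R)) - flat k 0)) @ 0^' --> 0.
    pose B : R := (k + 2)%:R ^+ (k + 2).
    have B0 : 0 <= B by exact: exprn_ge0.
    apply/cvgr0Pnorm_le => e e0; near=> h.
    have h0 : h != 0 by near: h; exact: nbhs_dnbhs_neq.
    have f0 : flat k 0 = 0 by rewrite /flat ltxx.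
    rewrite f0 subr0 /GRing.scale /= addr0 mulr1 normrM normfV.
    rewrite mulrC ler_pdivrMr ?normr_gt0//; apply: le_trans (flat_bound k h) _.
    rewrite -/B -[h ^+ 2]real_normK ?num_real// expr2 mulrA; apply: ler_wpM2r => //.
    have : `|h| <= e / (B + 1).
      near: h; apply: (@dnbhs0_le _ R); first by rewrite divr_gt0// ltr_wpDl.
    rewrite ler_pdivlMr ?ltr_wpDl// => H; apply: le_trans H.
    by rewrite mulrDr mulr1 mulrC lerDl.
  by apply: DeriveDef; [apply/cvg_ex; exists 0|exact: cvg_lim c].
Unshelve. all: by end_near. Qed.

Definition cflat k x : C := (flat k x)%:C.

Lemma isdC_cflat k x : isdC (cflat k) x (cflat (k + 2) x - k%:R%:C * cflat k.+1 x).
Proof.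
apply: (isdC_eq (isdC_real (flat_derive k x))).
by rewrite /cflat rmorphB rmorphM.
Qed.

Lemma sm_cflat n k : sm n (cflat k).
Proof.
elim: n k => [|n IH] k; first by apply: isdC_cont => x; exact: isdC_cflat.
exists (fun x => cflat (k + 2) x + (- k%:R%:C) * cflat k.+1 x).
  by move=> x; apply: (isdC_eq (isdC_cflat k x)); rewrite mulNr.
by apply: smD => //; apply: smM => //; exact: sm_cst.
Qed.

Lemma sm_inv n (q : R -> R) : (forall m, sm m (fun x => (q x)%:C)) -> (forall x, 0 < q x) ->
  sm n (fun x => ((q x)^-1)%:C).
Proof.
move=> sq q0; pose g x : C := - dC (fun x => (q x)%:C) x * (((q x)^-1)%:C * ((q x)^-1)%:C).
have dq x : isdC (fun x => ((q x)^-1)%:C) x (g x).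
  have [a b] := (smS (sq 1%N)).1 x.
  have i0 : Im (dC (fun x => (q x)%:C) x) = 0 by rewrite /dC /= derive1_cst.
  have /isdC_real H := is_deriveV (f := q) (lt0r_neq0 (q0 x)) a.
  apply: (isdC_eq H); apply: complexP; rewrite /g ?ReM ?ImM ?ReN ?ImN i0 /=.
    rewrite /GRing.scale /= -exprVn; ring.
  by rewrite !(mulr0, mul0r, oppr0, addr0).
elim: n => [|n IH]; first exact: isdC_cont dq.
exists g => //; apply: smM; last exact: smM.
rewrite (_ : (fun x => _) = fun x => -1 * dC (fun x => (q x)%:C) x).
  by apply: smM; [exact: sm_cst|exact: (smS (sq n.+1)).2].
by apply/funext => x; rewrite mulN1r.
Qed.

Definition sigm x : R := flat 0 x / (flat 0 x + flat 0 (1 - x)).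

Lemma flat_neg k x : x <= 0 -> flat k x = 0.
Proof. by rewrite /flat leNgt => /negbTE ->. Qed.
Lemma flat_pos k x : 0 < x -> 0 < flat k x.
Proof. by move=> x0; rewrite /flat x0 mulr_gt0 ?expR_gt0// invr_gt0 exprn_gt0. Qed.
Lemma flat_ge0 k x : 0 <= flat k x.
Proof. by have [x0|x0] := ltP 0 x; [exact/ltW/flat_pos|rewrite flat_neg]. Qed.

Lemma sigm_den x : 0 < flat 0 x + flat 0 (1 - x).
Proof.
have [x0|x0] := ltP 0 x; first by rewrite ltr_pwDl ?flat_pos ?flat_ge0.
by rewrite ltr_wpDl ?flat_ge0 ?flat_pos// subr_gt0 (le_lt_trans x0).
Qed.

Lemma sigm0 x : x <= 0 -> sigm x = 0.
Proof. by move=> x0; rewrite /sigm flat_neg// mul0r. Qed.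
Lemma sigm1 x : 1 <= x -> sigm x = 1.
Proof.
move=> x1; rewrite /sigm [flat 0 (1 - x)]flat_neg ?subr_le0// addr0 divff//.
by rewrite gt_eqF// flat_pos// (lt_le_trans ltr01).
Qed.

Lemma sm_sigm n : sm n (fun x => (sigm x)%:C).
Proof.
rewrite (_ : (fun x => _) = fun x => cflat 0 x * ((flat 0 x + flat 0 (1 - x))^-1)%:C); last first.
  by apply/funext => x; rewrite /sigm /cflat rmorphM.
apply: smM; first exact: sm_cflat.
apply: sm_inv sigm_den => m.
rewrite (_ : (fun x => _) = fun x => cflat 0 x + (fun y => cflat 0 (y + 1)) (- x)); last first.
  by apply/funext => x; rewrite /cflat rmorphD [- x + 1]addrC.
apply: smD; first exact: sm_cflat.
exact: (sm_opp (sm_shift 1 (sm_cflat m 0))).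
Qed.

Lemma sm_scale n phi (c : R) : sm n phi -> sm n (fun y => phi (c * y)).
Proof.
elim: n phi => [|n IH] phi.
  have sh (x : R) : (fun y => c * y) @ x --> c * x by apply: cvgMr; exact: cvg_id.
  move=> [u v]; split => x.
    exact: (@continuous_comp _ _ _ (fun y : R => c * y) (fun z => Re (phi z)) x (sh x) (u _)).
  exact: (@continuous_comp _ _ _ (fun y : R => c * y) (fun z => Im (phi z)) x (sh x) (v _)).
move=> [g dg sg]; exists (fun x => c%:C * g (c * x)); last first.
  by apply: smM; [exact: sm_cst|exact: IH].
move=> x; have dN : is_derive x 1 (fun y : R => c * y) c.
  by apply: is_derive_eq; rewrite /GRing.scale /= mulr1.
have [u v] := dg (c * x); split.
  have H := @is_derive1_comp _ (fun y => Re (phi y)) (fun y => c * y) x _ _ u dN.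
  by apply: (is_derive_eq H); rewrite ReM /= mul0r subr0 mulrC.
have H := @is_derive1_comp _ (fun y => Im (phi y)) (fun y => c * y) x _ _ v dN.
by apply: (is_derive_eq H); rewrite ImM /= mul0r addr0 mulrC.
Qed.

Lemma bump_exists y d : 0 < d -> exists a, [/\ test1 a,
  forall x, `|x - y| <= d -> a x = 1 & forall x, 2 * d <= `|x - y| -> a x = 0].
Proof.
move=> d0; have dn0 : d != 0 by rewrite gt_eqF.
(* A rising step times a falling one: 1 on [-1, 1] and 0 outside ]-2, 2[. It is then rescaled by [d]
   and centred at [y]. *)
pose w x : C := (sigm (x + 2))%:C * (sigm (- x + 2))%:C.
have sw n : sm n w.
  apply: smM; first exact: (sm_shift 2 (sm_sigm n)).
  exact: (sm_opp (sm_shift 2 (sm_sigm n))).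
pose a x := w (d^-1 * (x + - y)).
have a0 x : 2 * d <= `|x - y| -> a x = 0.
  rewrite /a /w ler_normr => /orP[|] H.
    rewrite [X in _ * X%:C]sigm0 ?mulr0// addrC subr_le0.
    by rewrite mulrC ler_pdivlMr.
  rewrite sigm0 ?mul0r// -lerBrDr sub0r mulrC ler_pdivrMr// mulNr lerNr.
  exact: H.
exists a; split => //.
  split; first by move=> n; exact: (sm_shift (- y) (sm_scale d^-1 (sw n))).
  exists (2 * d + `|y|) => x H; apply: a0; rewrite -(lerD2r `|y|).
  by apply: (le_trans (ltW H)); rewrite -{1}[x](subrK y) ler_normD.
move=> x; rewrite ler_norml => /andP[h1 h2]; rewrite /a /w.
rewrite !sigm1 ?mulr1//.
  have : d^-1 * (x - y) <= 1 by rewrite mulrC ler_pdivrMr// mul1r.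
  lra.
have : - 1 <= d^-1 * (x - y) by rewrite mulrC ler_pdivlMr// mulN1r.
lra.
Qed.

End Bumps.

(** * Tensor product cutoffs and the wave front set criterion *)

Section Tensor.
Context {R : realType}.
Local Notation C := R[i].
Local Notation Re := (@complex.Re R).
Local Notation Im := (@complex.Im R).
Implicit Types (x t r d : R) (a b phi : R -> C) (f g : @cfun R (1 + 1))
  (y z xi zeta : 'rV[R]_(1 + 1)).

Definition tens a b : @cfun R (1 + 1) := fun z => a (z 0 ix) * b (z 0 it).

Lemma tens_pt a b x t : tens a b (pt x t) = a x * b t.
Proof. by rewrite /tens pt_ix pt_it. Qed.

Lemma tens_continuous a b : test1 a -> test1 b ->
  continuous (fun z => Re (tens a b z)) /\ continuous (fun z => Im (tens a b z)).
Proof.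
move=> [sa _] [sb _]; have [ar ai] := sa 0%N; have [bar bi] := sb 0%N.
have key (h : R -> R) i : continuous h -> continuous (fun z : 'rV[R]_(1 + 1) => h (z 0 i)).
  move=> ch z; apply: (@continuous_comp _ _ _ (fun z : 'rV[R]_(1 + 1) => z 0 i) h).
    exact: coord_continuous.
  exact: ch.
have k1 := key _ ix ar; have k2 := key _ ix ai; have k3 := key _ it bar; have k4 := key _ it bi.
split => z; rewrite /tens.
  under eq_fun do rewrite ReM.
  exact: (cvgB (cvgM (k1 z) (k3 z)) (cvgM (k2 z) (k4 z))).
under eq_fun do rewrite ImM.
exact: (cvgD (cvgM (k1 z) (k4 z)) (cvgM (k2 z) (k3 z))).
Qed.

Lemma tens_axis a b x t : test1 a -> test1 b ->
  isdC (fun x => tens a b (pt x t)) x (tens (dC a) b (pt x t)) /\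
  isdC (fun t => tens a b (pt x t)) t (tens a (dC b) (pt x t)).
Proof.
move=> ta tb; split; rewrite tens_pt.
  under eq_fun do rewrite tens_pt mulrC; rewrite mulrC.
  by apply: isdCZ; exact: test1_isdC.
by under eq_fun do rewrite tens_pt; apply: isdCZ; exact: test1_isdC.
Qed.

Lemma tens_derivable a b i z : test1 a -> test1 b ->
  [/\ derivable (fun z => Re (tens a b z)) z (delta_mx 0 i),
      derivable (fun z => Im (tens a b z)) z (delta_mx 0 i) &
      partial i (tens a b) z = (if i == ix then tens (dC a) b z else tens a (dC b) z)].
Proof.
move=> ta tb; rewrite [z]ptE; move: (z 0 ix) (z 0 it) => x t.
have [dx dt] := tens_axis x t ta tb.
move: i; apply: ixitP.
  have [u v w] := @isdC_axis _ _ ix (tens a b) (pt^~ t) x _ (fun h s => delta_ix h s t) dx.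
  by rewrite eqxx.
rewrite (_ : (it == ix) = false)//.
by have [u v w] := @isdC_axis _ _ it (tens a b) (pt x) t _ (fun h s => delta_it h x s) dt.
Qed.

Lemma partials_tens a b s : test1 a -> test1 b -> exists p q,
  partials s (tens a b) = tens (iter p dC a) (iter q dC b).
Proof.
move=> ta tb; elim: s => [|i s [p [q E]]]; first by exists 0%N, 0%N.
have H z := tens_derivable i z (test1_iter p ta) (test1_iter q tb).
case: (eqVneq i ix) H => [_|_] H; [exists p.+1, q|exists p, q.+1];
  by rewrite /= E; apply/funext => z; case: (H z).
Qed.

Lemma smooth_tens a b : test1 a -> test1 b -> smooth (tens a b).
Proof.
move=> ta tb s; have [p [q ->]] := partials_tens s ta tb.
have tp := test1_iter p ta; have tq := test1_iter q tb.
have [cr cI] := tens_continuous tp tq.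
by split => // i z; have [u v _] := tens_derivable i z tp tq.
Qed.

Lemma cutoff_exists y : positive_times y -> exists a b d,
  [/\ test1 a, test1 b, 0 < d, ball y d `<=` positive_times &
      test_function positive_times (tens a b) /\ forall z, ball y d z -> tens a b z = 1].
Proof.
(* The cutoff in time lives within 2 d of the time coordinate 4 d of y, so its support stays in t >=
   2 d > 0. *)
rewrite /positive_times /= => y0; pose d := y 0 it / 4.
have d0 : 0 < d by rewrite divr_gt0.
have [a [ta a1 a0]] := bump_exists (y 0 ix) d0.
have [b [tb b1 b0]] := bump_exists (y 0 it) d0.
have yd : y 0 it = 4 * d by rewrite /d mulrC divfK.
have dist z i : ball y d z -> `|z 0 i - y 0 i| < d.
  by move=> [_ /(_ 0 i)]; rewrite /ball /= distrC.
exists a, b, d; split => //.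
  by move=> z zd; have := dist z it zd; rewrite /= ltr_norml yd => /andP[]; lra.
split; last first.
  by move=> z zd; rewrite /tens a1 ?b1 ?mulr1// ltW//; exact: dist.
split; first exact: smooth_tens.
exists [set v : 'rV[R]_(1 + 1) | forall i, `[y 0 i - 2 * d, y 0 i + 2 * d]%classic (v 0 i)]; split.
- apply: (@rV_compact R (1 + 1) (fun i => `[y 0 i - 2 * d, y 0 i + 2 * d]%classic)) => i.
  exact: segment_compact.
- by move=> v /(_ it); rewrite /= in_itv /= yd => /andP[]; lra.
- move=> v /= vK; have [i vi] := (existsNP _).2 vK; rewrite in_itv /= in vi.
  have H : 2 * d <= `|v 0 i - y 0 i|.
    rewrite leNgt; apply/negP => /ltW; rewrite ler_norml => h; apply: vi.
    by move: h => /andP[]; lra.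
  by move: i H {vi}; apply: ixitP => H; rewrite /tens ?(a0 _ H) ?(b0 _ H) ?mul0r ?mulr0.
Qed.

Lemma UnZ n (c : C) phi : test1 phi -> Un n (fun x => c * phi x) = c * Un n phi.
Proof.
move=> tphi; rewrite (_ : (fun x => _) = fun x => (c - 1) * phi x + phi x).
  by rewrite Un_lin// mulrBl mul1r subrK.
by apply/funext => x; rewrite mulrBl mul1r subrK.
Qed.

Lemma dot_pt x t zeta : dot (pt x t) zeta = x * zeta 0 ix + t * zeta 0 it.
Proof. by rewrite /dot big_split_ord !big_ord1 pt_ix pt_it. Qed.

Lemma expi_dot x t zeta : expi (- (2 * pi * dot (pt x t) zeta)) =
  ee (zeta 0 ix) x * ee (zeta 0 it) t :> C.
Proof. by rewrite dot_pt /ee -expiD; congr expi; ring. Qed.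

(** The character splits over the coordinates: the t-integral is the constant factor [hat b], and
    what remains is [Un_ee]. *)
Lemma fourier_compact_un n a b zeta : test1 a -> test1 b ->
  fourier_compact (fmul (tens a b) (un n)) zeta = Ak n a (zeta 0 ix) * hat b (zeta 0 it).
Proof.
move=> ta tb; rewrite /fourier_compact /fmul /un.
rewrite (_ : margx _ _ = fun x => hat b (zeta 0 it) * (a x * ee (zeta 0 ix) x)).
  rewrite UnZ ?Un_ee 1?mulrC//; apply: test1M => // m; exact: sm_ee.
have ac (p q r s : C) : 1 * (p * q * (r * s)) = p * r * (s * q) by ring.
apply/funext => x; rewrite [RHS]mulrC /hat -IntZ; last exact: ci_ee (test1_ci tb) (test1_cm tb).
by apply: eq_Int => t; rewrite tens_pt expi_dot; exact: ac.
Qed.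

Lemma fourier_pt f x t : fourier f (pt x t) = hat2 (at_pt f) x t.
Proof.
rewrite /fourier integral2E; apply: eq_Int => s; apply: eq_Int => s'.
rewrite /at_pt expi_dot pt_ix pt_it.
by rewrite -/(pt s s').
Qed.

Lemma un_fourier n a b f : test1 a -> test1 b -> rd2 (at_pt f) ->
  un n (fun z => tens a b z * fourier f z) = TT n a b (at_pt f).
Proof.
move=> ta tb rf; rewrite /un.
suff -> : margx (fun=> 1) (fun z => tens a b z * fourier f z) =
  (fun x => a x * Int (fun t => b t * hat2 (at_pt f) x t)) by exact: Un_mul_hat2.
apply/funext => x.
have [mf _] := rf; have [K fK] := rd2_dom rf; have [L bL] := test1_odom tb.
have m2 : cm2 (hat2 (at_pt f)).
  apply: (cm_Int (F := fun (w : R * R) s => Int (fun s' => ee w.1 s * ee w.2 s' * at_pt f s s'))).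
  apply: (cm_Int (F := fun (w : R * R * R) s' => ee w.1.1 w.2 * ee w.1.2 s' * at_pt f w.2 s')).
  apply: cmM; first apply: cmM.
  - by apply: (cm_comp (g := fun w : R * R * R * R => (w.1.1.1, w.1.2)) _ cm_ee); mst.
  - by apply: (cm_comp (g := fun w : R * R * R * R => (w.1.1.2, w.2)) _ cm_ee); mst.
  - by apply: (cm_comp (g := fun w : R * R * R * R => (w.1.2, w.2)) _ mf); mst.
have b2 s t : normc (hat2 (at_pt f) s t) <= K * cpi * cpi.
  apply: Int2_bound.
    apply: cmM => //; apply: cmM.
    - by apply: (cm_comp (g := fun w : R * R => (s, w.1)) _ cm_ee); mst.
    - by apply: (cm_comp (g := fun w : R * R => (t, w.2)) _ cm_ee); mst.
  by move=> p q; rewrite !normcM !normc_ee !mul1r; exact: fK.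
rewrite -IntZ; last first.
  apply: (@ci_wt _ (L * (K * cpi * cpi))).
    by apply: cmM; [exact: test1_cm|exact: (cm2_row x m2)].
  move=> t; rewrite normcM mulrAC; apply: ler_pM => //; rewrite ?normc_ge0//.
apply: eq_Int => t; rewrite mul1r tens_pt fourier_pt mulrA//.
Qed.

Lemma norm_rV2 zeta : `|zeta| <= `|zeta 0 ix| + `|zeta 0 it|.
Proof.
rewrite [leLHS]mx_normrE; apply: bigmax_le => [|[i j] _ /=]; first exact: addr_ge0.
by rewrite ord1; move: j; apply: ixitP; rewrite ?lerDl ?lerDr.
Qed.

(** Here [u] is 1 + |zeta|, [v] is [br] of the first coordinate, [p] is 1 plus its negative part,
    and [q] is [br] of the second coordinate. The decay of [F] in [p] and of [G] in [q] pays for u^N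
    and for the growth v^n of [F]. *)
Let est_mr (A B K F G u p q v : R) N n : 0 <= A -> 0 <= K ->
  0 <= u -> 0 <= v -> 1 <= p -> 1 <= q -> u <= (1 + K) * (p * q) -> v <= u ->
  0 <= F -> 0 <= G -> F * p ^+ (N + n) <= A * v ^+ n -> G * q ^+ (N + n) <= B ->
  u ^+ N * (F * G) <= A * (1 + K) ^+ (N + n) * B.
Proof.
move=> A0 K0 u0 v0 p1 q1 hu hv F0 G0 hF hG.
have p0 : 0 < p by exact: lt_le_trans p1.
have q0 : 0 <= q by exact: le_trans q1.
have K1 : 0 <= 1 + K by rewrite addr_ge0.
have P0 : 0 < p ^+ (N + n) by exact: exprn_gt0.
rewrite -(ler_pM2r P0).
have e1 m : u ^+ m <= ((1 + K) * (p * q)) ^+ m.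
  by apply: lerXn2r; rewrite ?nnegrE// mulr_ge0// mulr_ge0// ltW.
apply: (@le_trans _ _ (u ^+ N * (A * u ^+ n) * G)).
  apply: (@le_trans _ _ (u ^+ N * (F * p ^+ (N + n)) * G)); first by apply: le_of_eq; ring.
  apply: ler_wpM2r => //; apply: ler_wpM2l; first exact: exprn_ge0.
  by apply: (le_trans hF); apply: ler_wpM2l => //; apply: lerXn2r; rewrite ?nnegrE.
apply: (@le_trans _ _ (A * u ^+ (N + n) * G)); first by apply: le_of_eq; rewrite exprD; ring.
apply: (@le_trans _ _ (A * ((1 + K) * (p * q)) ^+ (N + n) * G)).
  by apply: ler_wpM2r => //; apply: ler_wpM2l.
apply: (@le_trans _ _ (A * (1 + K) ^+ (N + n) * (G * q ^+ (N + n)) * p ^+ (N + n))).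
  by apply: le_of_eq; rewrite !exprMn; ring.
apply: ler_wpM2r; first exact: ltW.
by apply: ler_wpM2l => //; apply: mulr_ge0 => //; exact: exprn_ge0.
Qed.

(** The only directions excluded are the positive multiples of (1, 0). In a cone zeta1 < K |zeta2|
    the norm of zeta is controlled by the product of [1 + mm zeta1] and [br zeta2], exactly the
    quantities in which A_n[a] and [hat b] decrease rapidly. *)
Lemma un_microregular n y xi : positive_times y -> (xi 0 ix < 0) || (xi 0 it != 0) ->
  microregular positive_times (un n) y xi.
Proof.
move=> /cutoff_exists[a [b [d [ta tb d0 _ [tf chi1]]]]] xi0.
(* If the second coordinate of xi is 0 then the first is negative, and the cone contains xi for
   every K. Otherwise K times the modulus of the second coordinate is |xi1| + 1, which exceeds
   xi1. *)
pose K : R := if xi 0 it == 0 then 1 else (`|xi 0 ix| + 1) / `|xi 0 it|.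
have K0 : 0 <= K by rewrite /K; case: ifP => // _; rewrite divr_ge0// addr_ge0.
(* An open cone that avoids the half-line of the (zeta1, 0) with zeta1 >= 0. *)
exists (tens a b), [set zeta | zeta 0 ix < K * `|zeta 0 it|]; split; first split => //.
- by rewrite chi1 ?oner_eq0//; exact: ballxx.
- have -> : (fun zeta => [set zeta : 'rV[R]_(1 + 1) | zeta 0 ix < K * `|zeta 0 it|] zeta) =
      (fun zeta => K * `|zeta 0 it| - zeta 0 ix) @^-1` [set r | 0 < r].
    by apply/seteqP; split => z /=; rewrite subr_gt0.
  apply: open_comp => [z _|]; last exact: open_gt.
  have ci := @coord_continuous R 1 (1 + 1) 0.
  exact: (cvgB (cvgMr (cvg_norm (ci it z))) (ci ix z)).
- move=> l z l0 /=; rewrite !mxE normrM gtr0_norm// mulrCA => H.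
  by rewrite ltr_pM2l.
- rewrite /= /K; case: ifPn => [/eqP x0|x0].
    by move: xi0; rewrite x0 eqxx orbF normr0 mulr0.
  rewrite divfK ?normr_eq0//; apply: (le_lt_trans (ler_norm _)).
  by rewrite ltrDl.
move=> N; have [A A0 aA] := Ak_bound n (N + n) ta.
have [B B0 bB] := test1_rdec tb (N + n)%N.
exists (A * (1 + K) ^+ (N + n) * B) => zeta zG; rewrite fourier_compact_un// normcM.
have hn := norm_rV2 zeta.
have p1 : 1 <= 1 + mm (zeta 0 ix) by rewrite lerDl mm_ge0.
have q1 := br_ge1 (zeta 0 it).
have hb : 1 + `|zeta| <= (1 + K) * ((1 + mm (zeta 0 ix)) * br (zeta 0 it)).
  have hx : `|zeta 0 ix| <= K * `|zeta 0 it| + mm (zeta 0 ix).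
    have [z0|z0] := leP 0 (zeta 0 ix).
      by rewrite ger0_norm// mm_pos// addr0 ltW.
    rewrite ltr0_norm// /mm max_r; last by rewrite oppr_ge0 ltW.
    by rewrite lerDr mulr_ge0.
  have m0 := mm_ge0 (zeta 0 ix); rewrite /br; have t0 := normr_ge0 (zeta 0 it).
  apply: (@le_trans _ _ (1 + (K * `|zeta 0 it| + mm (zeta 0 ix) + `|zeta 0 it|))); first lra.
  move: (mm _) m0 (`|zeta 0 it|) t0 => m m0 t t0.
  have := mulr_ge0 m0 t0; have := mulr_ge0 K0 (mulr_ge0 m0 t0); have := mulr_ge0 K0 m0; lra.
have hx : br (zeta 0 ix) <= 1 + `|zeta| by rewrite /br lerD2l coord_norm.
have u0 : 0 <= 1 + `|zeta| by rewrite addr_ge0.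
exact: (est_mr A0 K0 u0 (br_ge0 _) p1 q1 hb hx (normc_ge0 _) (normc_ge0 _) (aA _) (bB _)).
Qed.

Lemma un_criterion n m : @hormander_criterion R (1 + 1) positive_times (un n) (un m).
Proof.
move=> y xi xi0 [/= Oy _ nv] [/= _ _ nw].
have [H|/norP[h1 h2]] := boolP ((xi 0 ix < 0) || (xi 0 it != 0)).
  by apply: nv; exact: un_microregular.
apply: nw; apply: un_microregular => //; apply/orP; left; rewrite mxE oppr_lt0.
move: h1 h2; rewrite -leNgt negbK => h1 /eqP h2; rewrite lt_neqAle h1 andbT.
by apply: contra xi0 => /eqP h; apply/eqP/eq_rV2; rewrite mxE.
Qed.

End Tensor.

(** * Fourier inversion in the plane *)

Section FourierInversion.
Context {R : realType}.
Local Notation C := R[i].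
Implicit Types (x t s p q r d : R) (a b phi : R -> C) (f g h : @cfun R (1 + 1)).

Lemma eeN x t : ee (- x) t = ee x (- t) :> C.
Proof. by rewrite /ee; congr expi; ring. Qed.

Lemma fourier_inv_pt f s t : fourier_inv f (pt s t) =
  Int2 (fun p q => ee (- s) p * ee (- t) q * f (pt p q)).
Proof.
rewrite /fourier_inv integral2E; apply: eq_Int => p; apply: eq_Int => q.
rewrite /at_pt; congr (_ * _); rewrite dot_pt pt_ix pt_it /ee -expiD.
by congr expi; ring.
Qed.

Lemma fourier_inv_test f s t : test2 f ->
  fourier_inv f (pt s t) = hat (margt (ee (- s)) f) (- t).
Proof.
move=> tf; have mf := test2_cm2 tf; have [K fK] := test2_dom tf.
rewrite fourier_inv_pt /Int2 (Int_swap (K := K)); last 2 first.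
- apply: cmM => //; apply: cmM.
  + by apply: (cm_comp (g := fun w : R * R => (- s, w.1)) _ cm_ee); mst.
  + by apply: (cm_comp (g := fun w : R * R => (- t, w.2)) _ cm_ee); mst.
- by move=> p q; rewrite !normcM !normc_ee !mul1r; exact: fK.
apply: eq_Int => q; have [tq _] := test2_slice q tf.
rewrite /margt -IntZ; last exact: ci_ee (test1_ci tq) (test1_cm tq).
by apply: eq_Int => p; rewrite -mulrA mulrCA.
Qed.

(** Inversion one variable at a time: for fixed s the partial transform [margt (ee (- s)) f] is
    again a test function of t, so that [inv_hat] serves in both variables. *)
Lemma fourier_fourier_inv f : test2 f -> fourier (fourier_inv f) = f.
Proof.
move=> tf; apply/funext => z; rewrite [z]ptE; move: (z 0 ix) (z 0 it) => x y.
have tG s : test1 (margt (ee (- s)) f).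
  by apply: (margt_family _ _ tf).1; [exact: cm_ee1|move=> t; rewrite normc_ee].
have [ty _] := test2_slice y tf.
rewrite fourier_pt -[RHS](inv_hat x ty); apply: eq_Int => s.
rewrite (_ : (fun t => _) = fun t => ee x s * (ee y t * hat (margt (ee (- s)) f) (- t))); last first.
  by apply/funext => t; rewrite /at_pt fourier_inv_test// mulrA.
have mh := cm_hat (test1_cm (tG s)).
rewrite IntZ; last first.
  have [K hK] := hat_wt (tG s); apply: (@ci_wt _ K).
    apply: cmM; first exact: cm_ee1.
    exact: cm_comp (@oppr_measurable R setT) mh.
  by move=> t; rewrite normcM normc_ee mul1r -[wt t]wtN; exact: hK.
rewrite eeC; congr (_ * _).
have <- : margt (ee (- s)) f y = Int (fun p => ee s (- p) * f (pt p y)).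
  by apply: eq_Int => p; rewrite eeN.
rewrite -[RHS](inv_hat y (tG s)); apply: eq_Int => t; rewrite eeC; congr (_ * _).
by apply: eq_Int => q; rewrite eeN.
Qed.

End FourierInversion.

(** * Products *)

Section Products.
Context {R : realType}.
Local Notation C := R[i].
Implicit Types (x t s p q r d : R) (f g h : @cfun R (1 + 1)) (k l : R -> R -> C).

(** Smoothness is left out: the pairings of this section are absolutely convergent integrals, for
    which boundedness, measurability and bounded support of the test function suffice. *)
Definition bump2 k := [/\ cm2 k, exists M, forall x t, normc (k x t) <= M & exists r, vanish2 r k].

Lemma test2_bump2 h : test2 h -> bump2 (at_pt h).
Proof. by move=> th; split; [exact: test2_cm2|exact: test2_bounded|case: th]. Qed.

Lemma bump2_lin (c : C) k l : bump2 k -> bump2 l -> bump2 (fun x t => c * k x t + l x t).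
Proof.
move=> [mk [M kM] [r kr]] [ml [N lN] [s ls]]; split.
- by apply: cmD => //; apply: cmM => //; exact: cm_cst.
- exists (normc c * M + N) => x t; apply: le_trans (normc_triangle _ _) _.
  by apply: lerD => //; rewrite normcM; apply: ler_wpM2l => //; exact: normc_ge0.
- exists (Num.max r s) => x t; rewrite !gt_max => H.
  rewrite kr ?ls ?mulr0 ?addr0//.
    by case/orP: H => /andP[_ ->]; rewrite ?orbT.
  by case/orP: H => /andP[-> _]; rewrite ?orbT.
Qed.

Lemma rd2_lin (c : C) k l : rd2 k -> rd2 l -> rd2 (fun x t => c * k x t + l x t).
Proof.
move=> [mk rk] [ml rl]; split.
  by apply: cmD => //; apply: cmM => //; exact: cm_cst.
move=> N; have [K K0 kK] := rk N; have [L L0 lL] := rl N.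
exists (normc c * K + L) => [|x t].
  by apply: addr_ge0 => //; apply: mulr_ge0 => //; exact: normc_ge0.
have w0 : 0 <= br x ^+ N * br t ^+ N by apply: mulr_ge0; exact: exprn_ge0 (br_ge0 _).
apply: (@le_trans _ _ ((normc c * normc (k x t) + normc (l x t)) * (br x ^+ N * br t ^+ N))).
  by apply: ler_wpM2r => //; rewrite -normcM; exact: normc_triangle.
rewrite mulrDl; apply: lerD => //; rewrite -mulrA.
by apply: ler_wpM2l => //; exact: normc_ge0.
Qed.

Lemma br_pt (N M : nat) x t : br x ^+ N * br t ^+ M <= (1 + `|pt x t|) ^+ (N + M).
Proof.
have hx : br x <= 1 + `|pt x t| by rewrite /br lerD2l -{1}(pt_ix x t) coord_norm.
have ht : br t <= 1 + `|pt x t| by rewrite /br lerD2l -{1}(pt_it x t) coord_norm.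
by rewrite exprD; apply: ler_pM; rewrite ?exprn_ge0 ?br_ge0//;
  apply: lerXn2r; rewrite ?nnegrE ?br_ge0// addr_ge0.
Qed.

Lemma weighted_bound (N M m : nat) f (B : R) x t : (N + M <= m)%N ->
  Cm_bound m (fun z => (1 + `|z|) ^+ m) B f ->
  normc (f (pt x t)) * (br x ^+ N * br t ^+ M) <= B.
Proof.
move=> NM /(_ [::] isT (pt x t)) /=; apply: le_trans; rewrite mulrC.
apply: ler_wpM2r; first exact: normc_ge0.
by apply: le_trans (br_pt _ _ _ _) _; apply: ler_weXn2l => //; rewrite lerDl.
Qed.

Lemma schwartz_rd2 f : schwartz f -> rd2 (at_pt f).
Proof.
move=> [sf bf]; split=> [|N]; first exact: smooth_cm2.
have [M fM] := bf (N + N)%N; have H x t := weighted_bound x t (leqnn (N + N)) fM.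
exists M => //; apply: le_trans (H 0 0).
by do 2?[apply: mulr_ge0]; rewrite ?normc_ge0// exprn_ge0// br_ge0.
Qed.

Section Cutoff.
Variables (a b : R -> C).
Hypotheses (ta : test1 a) (tb : test1 b).

Lemma TT_lin n (c : C) k l : rd2 k -> rd2 l ->
  TT n a b (fun x t => c * k x t + l x t) = c * TT n a b k + TT n a b l.
Proof.
move=> rk rl; have [K kK] := rd2_kerT n ta tb rk; have [L lL] := rd2_kerT n ta tb rl.
have mk := cm2_kerT n ta tb rk.1; have ml := cm2_kerT n ta tb rl.1.
have mc : cm2 (fun x t => c * kerT n a b k x t) by apply: cmM => //; exact: cm_cst.
have cK : dom2 (normc c * K) (fun x t => c * kerT n a b k x t).
  by move=> x t; rewrite normcM -mulrA; apply: ler_wpM2l; [exact: normc_ge0|exact: kK].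
rewrite /TT -(Int2Z c mk kK); apply: (etrans _ (Int2D mc ml cK lL)).
have ac (p q u : C) : (c * p + q) * u = c * (p * u) + q * u by rewrite mulrDl mulrA.
by apply: eq_Int => x; apply: eq_Int => t; exact: ac.
Qed.

Lemma cutoff_fourier n f k : at_pt f = k -> rd2 k ->
  dfourier (fmul (tens a b) (un n)) f = TT n a b k.
Proof. by move=> <-; exact: un_fourier. Qed.

Lemma cutoff_tempered n : is_tempered (dfourier (fmul (tens a b) (un n))).
Proof.
split=> [c f g /schwartz_rd2 rf /schwartz_rd2 rg|].
  rewrite (cutoff_fourier n erefl rf) (cutoff_fourier n erefl rg).
  by rewrite (cutoff_fourier n erefl (rd2_lin c rf rg)); exact: TT_lin.
have [K K0 HK] := TT_dom n ta tb.
exists (n + 2 + 2)%N, (K * cpi * cpi) => f M sf fM.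
have rf := schwartz_rd2 sf; rewrite (cutoff_fourier n erefl rf).
have fK := HK (at_pt f) M (fun x t => weighted_bound x t (leqnn _) fM).
apply: le_trans (Int2_bound (cm2_kerT n ta tb rf.1) fK) _.
by apply: le_of_eq; rewrite -!mulrA mulrC -!mulrA.
Qed.

Variables (j : nat) (f : @cfun R (1 + 1)).
Hypothesis sf : schwartz f.

Let G := convolution_fun f (reflection (dfourier (fmul (tens a b) (un j)))).
Let rf := schwartz_rd2 sf.
Let g x t := corr j a b (at_pt f) x t.

(** The reflection and the minus sign in f(x - y) cancel, which makes the convolution a
    correlation. *)
Lemma convolution_corr : at_pt G = g.
Proof.
apply/funext => x; apply/funext => t.
apply: (cutoff_fourier _ (k := fun s u => at_pt f (x + s) (t + u))); last exact: rd2_shift.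
apply/funext => s; apply/funext => u; rewrite /at_pt opprK; congr f.
by apply: eq_rV2; rewrite mxE ?pt_ix ?pt_it.
Qed.

Lemma corr_bump2_rd2 k : bump2 k -> rd2 (fun x t => g x t * k x t).
Proof.
move=> [mk [M kM] [r kr]]; have M0 : 0 <= M by apply: le_trans (kM 0 0); exact: normc_ge0.
have [K K0 gK] := corr_bound j ta tb rf.
apply: (@vanish2_rd2 _ r (K * br r ^+ (j + 4) * M)).
- by apply: cmM => //; exact: cm2_corr.
- by move=> x t xt; rewrite kr// mulr0.
move=> x t; have [xt|/norP[]] := boolP ((r < `|x|) || (r < `|t|)).
  rewrite kr// mulr0 normc0; apply: mulr_ge0 => //; apply: mulr_ge0 => //.
  exact: exprn_ge0 (br_ge0 _).
rewrite -!leNgt => xr _; rewrite normcM; apply: ler_pM; rewrite ?normc_ge0//.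
apply: le_trans (gK x t) _.
have m0 := mm_ge0 x.
apply: (@le_trans _ _ (K * (1 + mm x) ^+ (j + 4))).
  apply: ler_piMr; first by apply: mulr_ge0 => //; apply: exprn_ge0; exact: addr_ge0.
  by rewrite -[1]mulr1; apply: ler_pM; rewrite ?wt_ge0 ?wt_le1.
apply: ler_wpM2l => //; apply: lerXn2r; rewrite ?nnegrE ?br_ge0 ?addr_ge0//.
rewrite /br lerD2l; apply: (@le_trans _ _ `|x|); last exact: le_trans xr (ler_norm r).
by rewrite /mm ge_max normr_ge0 -normrN ler_norm.
Qed.

Let T' := fmul G (dfourier (fmul (tens a b) (un 0))).

Lemma convolution_pairing h : bump2 (at_pt h) ->
  T' h = TT 0 a b (fun x t => g x t * h (pt x t)).
Proof.
move=> bh; apply: cutoff_fourier; last exact: (corr_bump2_rd2 bh).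
by rewrite -convolution_corr.
Qed.

Lemma kerT_corr_dom K M k : dom2 K (kerT 0 a b g) -> (forall x t, normc (k x t) <= M) ->
  dom2 (K * M) (kerT 0 a b (fun x t => g x t * k x t)).
Proof.
move=> gK kM x t; have := gK x t; have := kM x t.
have -> : kerT 0 a b (fun x t => g x t * k x t) x t = kerT 0 a b g x t * k x t.
  by rewrite /kerT mulrAC.
move: (kerT 0 a b g x t) => z h1 h2; rewrite normcM mulrAC.
by apply: ler_pM => //; exact: normc_ge0.
Qed.

Lemma convolution_integrable : is_integrable_distribution T'.
Proof.
split=> [c h1 h2 /test_function_test2/test2_bump2 b1 /test_function_test2/test2_bump2 b2|].
  rewrite !convolution_pairing//; last exact: bump2_lin.
  rewrite -TT_lin; [|exact: corr_bump2_rd2|exact: corr_bump2_rd2].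
  congr (TT 0 a b _); apply/funext => x; apply/funext => t.
  by rewrite mulrDr mulrCA.
have [K gK] := corr_dom j ta tb rf.
(* Order 0: by [corr_dom] the functional is integration against an absolutely integrable
   function. *)
exists 0%N, (K * cpi * cpi) => h M /test_function_test2 th hM.
have bh := test2_bump2 th; rewrite convolution_pairing//.
have kM x t : normc (at_pt h x t) <= M by have := hM [::] isT (pt x t); rewrite mul1r.
have mk := cm2_kerT 0 ta tb (corr_bump2_rd2 bh).1.
apply: le_trans (Int2_bound mk (kerT_corr_dom gK kM)) _.
by apply: le_of_eq; rewrite -!mulrA [M * _]mulrC -!mulrA.
Qed.

Lemma bump2_scale e k : 0 < e -> bump2 k -> bump2 (fun x t => k (e * x) (e * t)).
Proof.
move=> e0 [mk [M kM] [r kr]]; split.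
- by apply: (cm_comp (g := fun w : R * R => (e * w.1, e * w.2)) _ mk); mst.
- by exists M => x t; exact: kM.
- exists (r / e) => x t; rewrite !ltr_pdivrMr// => H; apply: kr.
  by rewrite !normrM gtr0_norm// ![e * _]mulrC.
Qed.

(** For fixed (x, t) the dilated cutoffs are eventually equal to 1, so dominated convergence under
    [corr_dom] gives the integral without cutoff, which [TT_corr] evaluates. *)
Lemma convolution_one : pairing_one T'
  (un j.+1 (fun z => tens (fun x => a x * a x) (fun x => b x * b x) z * fourier f z)).
Proof.
move=> chi /test_function_test2 tchi chi1; apply/cvg_at_rightP => u [u0 ul].
have taa := test1M ta ta.1; have tbb := test1M tb tb.1.
rewrite un_fourier// -(TT_corr j ta tb rf).
have bchi := test2_bump2 tchi; have [mchi [M chiM] _] := bchi.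
have ptZ e x t : e *: pt x t = pt (e * x) (e * t).
  by apply: eq_rV2; rewrite mxE ?pt_ix ?pt_it.
have bn n : bump2 (fun x t => chi (pt (u n * x) (u n * t))) by exact: bump2_scale (u0 n) bchi.
have En n : T' (fun z => chi (u n *: z)) = TT 0 a b (fun x t => g x t * chi (pt (u n * x) (u n * t))).
  have at_ptZ : at_pt (fun z => chi (u n *: z)) = (fun x t => chi (pt (u n * x) (u n * t))).
    by apply/funext => x; apply/funext => t; rewrite /at_pt ptZ.
  have bh : bump2 (at_pt (fun z => chi (u n *: z))) by rewrite at_ptZ.
  apply: (etrans (convolution_pairing bh)).
  by congr (TT 0 a b _); apply/funext => x; apply/funext => t; rewrite ptZ.
have [K gK] := corr_dom j ta tb rf.
suff : ccvg (fun n => TT 0 a b (fun x t => g x t * chi (pt (u n * x) (u n * t)))) (TT 0 a b g).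
  by move=> /ccvg_norm; under eq_fun do rewrite -En.
apply: (Int2_dct (K := K * M)).
- by move=> n; apply: cm2_kerT => //; exact: (corr_bump2_rd2 (bn n)).1.
- by move=> n; apply: kerT_corr_dom gK _ => x t; exact: chiM.
move=> x t; have /pt_box[e e0 He] : \forall z \near pt 0 0, chi z = 1.
  by rewrite (_ : pt 0 0 = 0)//; apply: eq_rV2; rewrite ?pt_ix ?pt_it mxE.
have lim y : \forall n \near \oo, `|0 - u n * y| < e.
  have : (fun n => u n * y) @ \oo --> 0 * y by apply: cvgMl.
  by rewrite mul0r => /cvgr_dist_lt; apply.
apply: ccvg_near; near=> n; rewrite /kerT He ?mulr1//; near: n; exact: lim.
Unshelve. all: by end_near. Qed.

End Cutoff.

Lemma un_product j : @is_hormander_product R (1 + 1) positive_times (un j) (un 0) (un j.+1).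
Proof.
split; [exact: un_distribution|exact: un_distribution|exact: un_criterion|exact: un_distribution|].
move=> y /cutoff_exists[a [b [d [ta tb d0 dO [tchi chi1]]]]].
(* Both factors carry the cutoff a (x) b, so the convolution is the transform of v_(j+1) localized
   by a^2 (x) b^2, which equals 1 on the ball. *)
exists (ball y d), (tens a b),
  (fun h => un j.+1 (fun z => tens (fun x => a x * a x) (fun x => b x * b x) z * fourier h z)).
split.
- by split; [exact: ball_open|exact: ballxx|].
- by split.
- split; last by move=> f sf; exact: convolution_one.
  split; [exact: cutoff_tempered|exact: cutoff_tempered|move=> f sf].
  exact: convolution_integrable.
move=> f tf; rewrite /dfourier_inv fourier_fourier_inv; last exact: test_function_test2 tf.
congr (un _ _); apply/funext => z.
have [zV|zV] := pselect (ball y d z).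
  have := chi1 z zV; rewrite /tens => H.
  by rewrite mulrACA H !mul1r.
have [_ [K [_ KV fK]]] := tf; rewrite fK ?mulr0// => Kz; exact/zV/KV.
Qed.

End Products.

Theorem proposition3p4 (R : realType) :
  let u0 : functional 1 := @inv_x_plus_i0 R in
  let u : functional (1 + 1) := tensor u0 (regular (fun=> 1)) in
  [/\ is_distribution setT u0,
      cvg_distribution (fun eps => regular (inv_x_plus_ieps eps)) u0 &
      forall c : R, 0 < c ->
        weak_solution_ivp c u (fun=> u0) u0 (fun=> 0)].
Proof.
move=> u0 u; have uE : u = un 0 by exact: tensor_un.
split; [exact: inv_x_plus_i0_distribution|exact: inv_x_plus_i0_limit|move=> c c0].
rewrite {}uE /u0; split.
- exists (un 1), (un 2); split; [exact: un_product|exact: un_product|].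
  by move=> f /test_function_test2; exact: wave_identity.
- by move=> t _; exact: inv_x_plus_i0_distribution.
- exact: un0_slices.
- by [].
move=> f _; rewrite (_ : (fun h => _) = fun=> 0); first exact: cvg_cst.
by apply/funext => h; rewrite subrr mulr0 subr0 normc0.
Qed.
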